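(* Let $X$ be an elliptic vector field, i.e. a germ of semicomplete holomorphic vector field on $(\mathbb{C}^2,0)$ having, in suitable local coordinates $(x,y)$, one of the following forms, where $a\in\mathbb{N}$ and $f$ is a germ of holomorphic function with $f(0,0)\neq0$: - $X = (xy(x-y))^a f\,[x(x-2y)\,\partial/\partial x + y(y-2x)\,\partial/\partial y]$; - $X = (xy(x-y)^2)^a f\,[x(x-3y)\,\partial/\partial x + y(y-3x)\,\partial/\partial y]$; - $X = (xy^2(x-y)^3)^a f\,[x(2x-5y)\,\partial/\partial x + y(y-4x)\,\partial/\partial y]$; - $X = (x^3+y^2)^a f\,[2y\,\partial/\partial x - 3x^2\,\partial/\partial y]$; - $X = (y(y-x^2))^a f\,[(2y-x^2)\,\partial/\partial x + 2xy\,\partial/\partial y]$; - $X = (y(y-x^2)^2)^a f\,[(3y-x^2)\,\partial/\partial x + 4xy\,\partial/\partial y]$. Then there is no germ of holomorphic vector field $Y$ on $(\mathbb{C}^2,0)$ forming a rank $2$ system of commuting vector fields with $X$.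
   Context: $\mathbb{N}$ contains $0$. Two vector fields $X,Y$ form a rank $2$ system of commuting vector fields if $[X,Y]=0$ and $X,Y$ are not linearly dependent everywhere. Semicomplete: a holomorphic vector field $X$ on an open set $U$ is semicomplete on $U$ if for every $p\in U$ there is a solution $\phi:V_p\subset\mathbb{C}\to U$ of $X$, defined on a domain $V_p\ni 0$, with $\phi(0)=p$, $\phi'(T)=X(\phi(T))$, such that whenever $\{T_i\}\subset V_p$ converges to a point of the boundary of $V_p$, the sequence $\phi(T_i)$ leaves every compact subset of $U$. A germ is semicomplete if it has a semicomplete representative on some neighborhood of the origin. *)

(* Defs.v *)
From HB Require Import structures.
From mathcomp Require Import all_boot all_order all_algebra.
From mathcomp Require Import complex.
From mathcomp Require Import all_classical all_reals all_analysis.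

Set Implicit Arguments.
Unset Strict Implicit.
Unset Printing Implicit Defensive.

Import Order.TTheory GRing.Theory Num.Theory.
Import numFieldNormedType.Exports.

Local Open Scope classical_set_scope.
Local Open Scope ring_scope.

(* The normed space structure over R[i] is attached to the regular module
   R[i]^o, so that differentiability below is complex differentiability. *)
Notation C1 R := (R[i]^o)%type.
Notation C2 R := (R[i]^o * R[i]^o)%type.

(* A germ at the origin is represented by a total function of which only the
   values near 0 are meaningful: two representatives define the same germ iff
   they agree near 0. *)
Definition holomorphic_germ (R : realType) (W : normedModType R[i])
  (F : C2 R -> W) : Prop := \forall p \near (0 : C2 R), differentiable F p.

Definition holomorphic_on (R : realType) (U : set (C2 R)) (X : C2 R -> C2 R) :
  Prop := forall p, U p -> differentiable X p.

Definition domain (R : realType) (V : set (C1 R)) : Prop :=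
  [/\ V !=set0, open V & connected V].

Definition solution_on (R : realType) (X : C2 R -> C2 R) (V : set (C1 R))
  (phi : C1 R -> C2 R) : Prop :=
  forall T, V T -> is_derive T (1 : C1 R) phi (X (phi T)).

Definition semicomplete_on (R : realType) (U : set (C2 R))
  (X : C2 R -> C2 R) : Prop :=
  forall p, U p -> exists (V : set (C1 R)) (phi : C1 R -> C2 R),
    [/\ domain V, V 0, (forall T, V T -> U (phi T)) &
    [/\ phi 0 = p, solution_on X V phi &
      forall (T : nat -> C1 R) (t : C1 R),
        (forall n, V (T n)) -> T n @[n --> \oo] --> t ->
        (closure V `\` interior V) t ->
        forall K : set (C2 R), compact K -> K `<=` U ->
          \forall n \near \oo, ~ K (phi (T n))]].

Definition semicomplete_germ (R : realType) (X : C2 R -> C2 R) : Prop :=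
  exists (U : set (C2 R)) (Z : C2 R -> C2 R),
    [/\ open U, U 0, holomorphic_on U Z, semicomplete_on U Z
      & \forall p \near (0 : C2 R), Z p = X p].

(* Germ of biholomorphism of (C^2, 0), with inverse germ Psi. *)
Definition local_coordinates (R : realType) (Phi : C2 R -> C2 R) : Prop :=
  exists Psi : C2 R -> C2 R,
    [/\ holomorphic_germ Phi, holomorphic_germ Psi, Phi 0 = 0, Psi 0 = 0 &
      (\forall p \near (0 : C2 R), Psi (Phi p) = p) /\
      (\forall q \near (0 : C2 R), Phi (Psi q) = q)].

(* elliptic_form g N : the vector fields of this type are the g^a f N; the
   pair N x y lists the components of N along d/dx and d/dy. *)
Inductive elliptic_form (R : realType) :
  (C1 R -> C1 R -> C1 R) -> (C1 R -> C1 R -> C2 R) -> Prop :=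
| EllipticForm1 : elliptic_form
    (fun x y => x * y * (x - y))
    (fun x y => (x * (x - 2 * y), y * (y - 2 * x)))
| EllipticForm2 : elliptic_form
    (fun x y => x * y * (x - y) ^+ 2)
    (fun x y => (x * (x - 3 * y), y * (y - 3 * x)))
| EllipticForm3 : elliptic_form
    (fun x y => x * y ^+ 2 * (x - y) ^+ 3)
    (fun x y => (x * (2 * x - 5 * y), y * (y - 4 * x)))
| EllipticForm4 : elliptic_form
    (fun x y => x ^+ 3 + y ^+ 2)
    (fun x y => (2 * y, - (3 * x ^+ 2)))
| EllipticForm5 : elliptic_form
    (fun x y => y * (y - x ^+ 2))
    (fun x y => (2 * y - x ^+ 2, 2 * x * y))
| EllipticForm6 : elliptic_form
    (fun x y => y * (y - x ^+ 2) ^+ 2)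
    (fun x y => (3 * y - x ^+ 2, 4 * x * y)).

(* The expression g^a f N of X in the coordinates (x, y) = Phi p is written
   as the equality of the push-forward of X by Phi with g^a f N. *)
Definition elliptic (R : realType) (X : C2 R -> C2 R) : Prop :=
  [/\ holomorphic_germ X, semicomplete_germ X &
    exists (Phi : C2 R -> C2 R) (a : nat) (f : C2 R -> C1 R) g N,
      [/\ local_coordinates Phi, holomorphic_germ f, f 0 != 0,
        elliptic_form g N &
        \forall p \near (0 : C2 R),
          let q := Phi p in
          'd Phi p (X p) = (g q.1 q.2 ^+ a * f q) *: N q.1 q.2]].

Definition lie_bracket (R : realType) (X Y : C2 R -> C2 R) (p : C2 R) : C2 R :=
  'd Y p (X p) - 'd X p (Y p).

Definition rank2_commuting (R : realType) (X Y : C2 R -> C2 R) : Prop :=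
  (\forall p \near (0 : C2 R), lie_bracket X Y p = 0) /\
  ~ (\forall p \near (0 : C2 R), ~~ free [:: X p; Y p]).

(* Main.v *)
From HB Require Import structures.
Require Import Defs.
From mathcomp Require Import all_boot all_order all_algebra.
From mathcomp Require Import complex.
From mathcomp Require Import all_classical all_reals all_analysis.
From mathcomp Require Import ring lra.

Set Implicit Arguments.
Unset Strict Implicit.
Unset Printing Implicit Defensive.

Import Order.TTheory GRing.Theory Num.Theory.
Import numFieldNormedType.Exports.

Local Open Scope classical_set_scope.
Local Open Scope ring_scope.

(** Why no commuting field exists.

    In the coordinates (x, y) the field is h N with h = g^a f, where N raises
    weighted degrees by one for suitable weights (p, q) of (x, y), and g is a
    weighted homogeneous first integral of N of weight d.  With the Euler
    field E = p x d/dx + q y d/dy one has [E, N] = N.  Let W be the expression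
    of a commuting field in these coordinates, put A = det (W, N) and
    B = det (E, W) / f.  Since E and N are generically independent,
    [h N, W] = 0 amounts to two scalar equations, with k = div N:
      N(A) = k A,    N(B) = k B + A psi,    psi(0) = (1 + a d) / f(0),
    and psi(0) is not 0 ([N_detWN], [N_detEWf]).

    Let a_m be the lowest weighted homogeneous part of A, and b the part of B
    of weight m - 1.  Restricted to the chart (x, y) = (s^p, s^q t), both
    become polynomials in t that satisfy
      mu a_m' = (k - m lam) a_m,
      mu b' = (k - (m - 1) lam) b + psi(0) a_m,
    where lam and mu describe N in this chart.  Hence w = b / a_m is a
    rational solution of mu w' = lam w + psi(0): a rational time function of N
    along a level of g.  It does not exist, because a pole of w at t would be
    a root of mu with lam(t) + r mu'(t) = 0 for its order r, so that w would
    be a polynomial, whose leading term cannot cancel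
    ([no_rational_solution]).  In the six models the numbers - lam / mu' at
    the roots of mu are 1/2, 1/3, 1/4, 1/6, never positive integers; this
    reflects that the regular levels of g are punctured elliptic curves, on
    which the time form has nonzero periods.  So A = 0
    ([commuting_part_vanishes]), W is collinear with N, and the two fields are
    linearly dependent at every point ([push_dependent]).

    The expansions of the germs rest on complex differentiability near 0 alone.
    Goursat's bisection, applied in polar coordinates around a point w of a
    disc, gives Cauchy's formula ([cauchy_formula]) and power series with
    uniform remainders ([power_series]).  Expanding one variable after the
    other gives Taylor series in two variables ([double_series]), and Cauchy's
    estimate transfers them to partial derivatives ([taylor_exists]).  The
    second order Taylor polynomial shows that partial derivatives are again
    differentiable and that mixed ones commute ([holo_partial]); this is what
    the naturality of the bracket under coordinate changes requires
    ([push_comm]). *)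

(** * The real-valued modulus and differentiability in epsilon-delta form *)

Section Modulus.
Variable R : realType.
Implicit Types (z w : R[i]) (x : R).

Notation nc := (@Normc.normc R).

Lemma nc0 : nc 0 = 0. Proof. exact: Normc.normc0. Qed.
Lemma nc1 : nc 1 = 1. Proof. exact: Normc.normc1. Qed.
Lemma ncM z w : nc (z * w) = nc z * nc w. Proof. exact: Normc.normcM. Qed.
Lemma ncV z : nc z^-1 = (nc z)^-1. Proof. exact: Normc.normcV. Qed.
Lemma ncN z : nc (- z) = nc z.
Proof. by case: z => a b /=; rewrite !sqrrN. Qed.
Lemma ncB z w : nc (z - w) = nc (w - z).
Proof. by rewrite -ncN opprB. Qed.
Lemma ncD z w : nc (z + w) <= nc z + nc w.
Proof. exact: le_normcD. Qed.
Lemma nc_ge0 z : 0 <= nc z. Proof. by case: z => a b; exact: sqrtr_ge0. Qed.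
Lemma nc_eq0 z : (nc z == 0) = (z == 0).
Proof. by apply/eqP/eqP=> [/Normc.eq0_normc//|->]; rewrite nc0. Qed.
Lemma nc_gt0 z : (0 < nc z) = (z != 0).
Proof. by rewrite lt0r nc_ge0 andbT nc_eq0. Qed.
Lemma ncX z n : nc (z ^+ n) = nc z ^+ n.
Proof. by elim: n => [|n IH]; rewrite ?expr0 ?nc1// !exprS ncM IH. Qed.
Lemma nc_real x : nc x%:C%C = `|x|.
Proof. by rewrite /= expr0n /= addr0 sqrtr_sqr. Qed.
Lemma ler_Re_nc z : `|complex.Re z| <= nc z.
Proof.
case: z => a b /=; rewrite -sqrtr_sqr ler_sqrt ?addr_ge0 ?sqr_ge0//.
by rewrite lerDl sqr_ge0.
Qed.
Lemma ler_Im_nc z : `|complex.Im z| <= nc z.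
Proof.
case: z => a b /=; rewrite -sqrtr_sqr ler_sqrt ?addr_ge0 ?sqr_ge0//.
by rewrite lerDr sqr_ge0.
Qed.
Lemma nc_le_ReIm z : nc z <= `|complex.Re z| + `|complex.Im z|.
Proof.
case: z => a b /=.
rewrite -[leRHS]ger0_norm ?addr_ge0// -sqrtr_sqr ler_sqrt ?sqr_ge0//.
rewrite sqrrD !real_normK ?num_real// -addrA lerD2l lerDr.
by rewrite mulrn_wge0 ?mulr_ge0.
Qed.
Lemma nc_sum (I : Type) (r : seq I) (P : pred I) (F : I -> R[i]) :
  nc (\sum_(i <- r | P i) F i) <= \sum_(i <- r | P i) nc (F i).
Proof.
apply: (big_ind2 (fun a b => nc a <= b)); rewrite ?nc0 //.
by move=> a b c d h1 h2; apply: le_trans (ncD _ _) (lerD h1 h2).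
Qed.
Lemma normCE z : `|z| = (nc z)%:C%C. Proof. by []. Qed.

Lemma ncBD z w : nc z - nc w <= nc (z - w).
Proof. by rewrite lerBlDr -{1}(subrK w z) ncD. Qed.

Lemma ncBle z w : nc (z - w) <= nc z + nc w.
Proof. by rewrite -(ncN w) ncD. Qed.

Lemma posC (e : R[i]) : 0 < e -> exists2 d : R, 0 < d & e = d%:C%C.
Proof. by case: e => a b; rewrite ltcE /= => /andP[/eqP -> a0]; exists a. Qed.


Lemma div_pow2_lt x (e : R) : 0 < e -> exists n, x / 2 ^+ n < e.
Proof.
move=> e0; pose n := (Num.truncn (x / e)).+1; exists n.
rewrite ltr_pdivrMr ?exprn_gt0// [e * _]mulrC -ltr_pdivrMr//.
apply: lt_trans (truncnS_gt _) _.
by have := @ltn_expl 2 n isT; rewrite -(ltr_nat R) natrX.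
Qed.


Lemma small_eq0 z (h : forall e : R, 0 < e -> nc z <= e) : z = 0.
Proof.
apply: Normc.eq0_normc; apply/eqP; rewrite eq_le nc_ge0 andbT.
by apply/ler_addgt0Pl => e e0; rewrite addr0; exact: h.
Qed.

End Modulus.

Section NearC.
Variable R : realType.
Notation nc := (@Normc.normc R).

Lemma nearC (z : R[i]^o) (P : R[i]^o -> Prop) :
  (\forall x \near z, P x) <->
  exists2 d : R, 0 < d & forall x, nc (x - z) < d -> P x.
Proof.
split.
- move/nbhs_ballP => [e /= /posC[d d0 ->] h]; exists d => // x xz; apply: h.
  by rewrite /ball /= normCE ncB ltcR.
- move=> [d d0 h]; apply/nbhs_ballP; exists d%:C%C; rewrite /= ?ltcR //.
  by move=> x; rewrite /ball /= normCE ltcR => xz; apply: h; rewrite ncB.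
Qed.

Lemma nearC2 (p : C2 R) (P : C2 R -> Prop) :
  (\forall q \near p, P q) <->
  exists2 d : R, 0 < d &
    forall x y, nc (x - p.1) < d -> nc (y - p.2) < d -> P (x, y).
Proof.
split.
- move/nbhs_ballP => [e /= /posC[d d0 ->] h]; exists d => // x y xz yz; apply: h.
  by split; rewrite /ball /= normCE ncB ltcR.
- move=> [d d0 h]; apply/nbhs_ballP; exists d%:C%C; rewrite /= ?ltcR //.
  move=> [x y] [] /=; rewrite /ball /= !normCE !ltcR => xz yz.
  by apply: h; rewrite ncB.
Qed.

Lemma normC2E (p : C2 R) : `|p| = (Num.max (nc p.1) (nc p.2))%:C%C.
Proof.
rewrite prod_normE !normCE /Order.max /= ltcR.
by case: ifP.
Qed.

(** The norm of R[i] is R[i]-valued, hence only partially ordered; this lemma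
    and the next one exchange the differential of the library for estimates
    between real numbers. *)
Lemma diffC2P (F : C2 R -> C1 R) (p : C2 R) :
  differentiable F p ->
  forall e : R, 0 < e -> exists2 d : R, 0 < d &
    forall u v, nc u < d -> nc v < d ->
      nc (F (p.1 + u, p.2 + v) - F p - 'd F p (u, v)) <= e * Num.max (nc u) (nc v).
Proof.
move=> dF e e0.
have /eqaddoP /(_ e%:C%C) := diff_locally dF.
rewrite ltcR => /(_ e0) /nearC2[d d0 h]; exists d => // u v ud vd.
have := h u v; rewrite !subr0 => /(_ ud vd) /=.
rewrite normC2E /= -rmorphM normCE lecR.
rewrite !fctE /=.
have -> : (u, v) + p = (p.1 + u, p.2 + v).
  by case: p {dF h} => x y; congr pair; rewrite addrC.
by rewrite opprD addrA.
Qed.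

Lemma diffC2I (F : C2 R -> C1 R) (p : C2 R) (a b : R[i]) :
  (forall e : R, 0 < e -> exists2 d : R, 0 < d &
    forall u v, nc u < d -> nc v < d ->
      nc (F (p.1 + u, p.2 + v) - F p - (a * u + b * v)) <= e * Num.max (nc u) (nc v)) ->
  differentiable F p /\ forall u v, 'd F p (u, v) = a * u + b * v.
Proof.
move=> h.
pose L : C2 R -> C1 R := fun q => (a : C1 R) * q.1 + (b : C1 R) * q.2.
have L_lin : linear L.
  by move=> k [u1 v1] [u2 v2]; rewrite /L /= /GRing.scale /=; ring.
pose LM := GRing.isLinear.Build _ _ _ _ _ L_lin.
pose LL : {linear C2 R -> C1 R} := HB.pack L LM.
have Lc : continuous LL.
  move=> q; apply: cvgD; apply: cvgM; try exact: cvg_cst.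
    exact: cvg_fst.
  exact: cvg_snd.
have FL (e : R[i]) : 0 < e -> \forall q \near (0 : C2 R),
    `|(F \o shift p - (cst (F p) + (LL : C2 R -> C1 R))) q| <= e * `|q|.
  move=> /posC[d d0 ->]; apply/nearC2.
  have [d' d'0 h'] := h d d0; exists d' => // u v; rewrite !subr0 => ud vd.
  rewrite normC2E /= -rmorphM normCE lecR.
  apply: le_trans (h' u v ud vd); rewrite le_eqVlt; apply/orP; left; apply/eqP.
  rewrite !fctE /=.
  have -> : (u, v) + p = (p.1 + u, p.2 + v).
    by case: p {h h'} => x y; congr pair; rewrite addrC.
  by rewrite opprD addrA.
have dF : 'd F p = LL :> (C2 R -> C1 R).
  by apply: diff_unique => //; apply/eqaddoP; exact: FL.
split; last by move=> u v; rewrite dF.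
by apply/diff_locallyP; rewrite dF; split => //; apply/eqaddoP; exact: FL.
Qed.

End NearC.

(** * Antiderivatives of real and complex functions of a real variable *)
Section Antiderivatives.
Variable R : realType.
Notation nc := (@Normc.normc R).

Lemma derive_bound (F f : R -> R) (a b M : R) : a <= b ->
  (forall x, a <= x <= b -> is_derive x (1 : R) F (f x)) ->
  (forall x, a <= x <= b -> `|f x| <= M) ->
  `|F b - F a| <= M * (b - a).
Proof.
move=> ab dF fM.
have [||x xab ->] := @MVT_segment _ F f a b ab.
- by move=> x; rewrite in_itv /= => /andP[ax xb]; apply: dF; rewrite !ltW.
- apply: continuous_in_subspaceT => x; rewrite inE /= in_itv /= => xab.
  apply/differentiable_continuous/derivable1_diffP.
  by have [] := dF _ xab.
- rewrite normrM [`|b - a|]ger0_norm ?subr_ge0//.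
  by rewrite ler_wpM2r ?subr_ge0//; apply: fM; rewrite in_itv /= in xab.
Qed.


Lemma antiderivative_from (g : R -> R) (c : R) : continuous g ->
  exists G : R -> R, forall x, c < x -> is_derive x (1 : R) G (g x).
Proof.
move=> gc.
exists (fun x => (\int[@lebesgue_measure R]_(t in [set` `[c, x]]) (g t))%R) => x cx.
have [||] := @continuous_FTC1_closed R g c x (x + 1) _ _ cx (gc x).
- by rewrite ltrDl.
- apply: continuous_compact_integrable; first exact: segment_compact.
  by apply: continuous_subspaceT.
- by move=> d e; split; [exact: d|rewrite -derive1E; exact: e].
Qed.

(** The integrals from -n, normalised to vanish at 0, agree where they are
    defined, so they glue to an antiderivative on the whole line. *)
Lemma antiderivative_real (g : R -> R) : continuous g ->
  exists G : R -> R, forall x, is_derive x (1 : R) G (g x).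
Proof.
move=> gc.
pose P (n : nat) (G : R -> R) := forall x : R, - n%:R < x -> is_derive x (1 : R) G (g x).
have ex n : exists G, P n G by exact: antiderivative_from.
pose F n := projT1 (cid (ex n)).
have FP n : P n (F n) by rewrite /F; case: cid.
have agree (n m : nat) (x : R) : (0 < n <= m)%N -> - n%:R < x -> F n x - F n 0 = F m x - F m 0.
  move=> /andP[n0 nm] nx.
  have nmR : - m%:R <= - n%:R :> R by rewrite lerN2 ler_nat.
  have n0R : - n%:R < 0 :> R by rewrite oppr_lt0 ltr0n.
  pose D : R -> R := fun y => F n y - F m y.
  have dD (y : R) : - n%:R < y -> is_derive y (1 : R) D 0.
    move=> ny; rewrite -(subrr (g y)); apply: is_deriveB.
      exact: FP.
    by apply: FP; apply: le_lt_trans nmR ny.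
  have E : D x = D 0.
    apply/eqP; rewrite -subr_eq0 -normr_le0.
    have [x0|x0] := leP 0 x.
      rewrite -[leRHS](mul0r (x - 0)); apply: (@derive_bound D (fun=> 0)) => // y.
        by move=> /andP[y0 _]; apply: dD; apply: lt_le_trans y0.
      by rewrite normr0.
    rewrite distrC -[leRHS](mul0r (0 - x)); apply: (@derive_bound D (fun=> 0)).
    - exact: ltW.
    - by move=> y /andP[y0 _]; apply: dD; apply: lt_le_trans y0.
    - by move=> *; rewrite normr0.
  by move: E; rewrite /D => /eqP; rewrite subr_eq => /eqP ->; ring.
exists (fun x => F (Num.truncn `|x|).+2 x - F (Num.truncn `|x|).+2 0) => x.
pose m := (Num.truncn `|x|).+3.
have xm : `|x| + 1 < m%:R.
  rewrite /m -addn1 natrD ltrD2r.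
  by apply: lt_le_trans (truncnS_gt _) _; rewrite ler_nat.
apply: (@near_eq_is_derive _ _ _ (fun y => F m y - F m 0)); last first.
  rewrite -[g x]subr0; apply: is_deriveB.
  apply: FP; rewrite ltrNl; apply: le_lt_trans xm.
  by rewrite -normrN ler_wpDr// ler_norm.
near=> y.
have xy : `|x - y| < 1 by near: y; exact: (@nbhsx_ballx _ _ _ _ ltr01).
have yx : `|y| < `|x| + 1.
  rewrite -[y](subrK x) addrC; apply: le_lt_trans (ler_normD _ _) _.
  by rewrite ltrD2l distrC.
apply/esym/agree.
  rewrite /m !ltnS /= -ltnS -(ltr_nat R).
  apply: (@le_lt_trans _ _ `|y|); first by rewrite truncn_le.
  apply: lt_trans yx _; rewrite -[in ltRHS]addn1 natrD ltrD2r.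
  exact: truncnS_gt.
rewrite ltrNl; apply: (@le_lt_trans _ _ `|y|).
  by rewrite -normrN ler_norm.
apply: lt_trans (truncnS_gt _) _.
by rewrite ltr_nat.
Unshelve. all: by end_near.
Qed.

End Antiderivatives.

Section ComplexAntiderivatives.
Variable R : realType.
Notation nc := (@Normc.normc R).
Notation Re := (@complex.Re R).
Notation Im := (@complex.Im R).

(** Line integrals are handled as increments of antiderivatives: they exist
    by continuity, are additive by ring identities, and are estimated by the
    mean value theorem.  Derivatives are taken componentwise because R[i] is
    a normed space over itself and not over R. *)
Definition cder (G g : R -> R[i]) := forall x : R,
  is_derive x (1 : R) (fun t => Re (G t)) (Re (g x)) /\
  is_derive x (1 : R) (fun t => Im (G t)) (Im (g x)).

Definition ccont (g : R -> R[i]) :=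
  continuous (fun t => Re (g t)) /\ continuous (fun t => Im (g t)).

Lemma antiderivative (g : R -> R[i]) : ccont g -> exists G, cder G g.
Proof.
move=> [/antiderivative_real[G1 h1] /antiderivative_real[G2 h2]].
by exists (fun t => Complex (G1 t) (G2 t)) => x; split; [exact: h1|exact: h2].
Qed.

(** The factor 2 is the price of bounding the two components separately. *)
Lemma cder_bound (G g : R -> R[i]) (a b M : R) : cder G g -> a <= b ->
  (forall x, a <= x <= b -> nc (g x) <= M) ->
  nc (G b - G a) <= 2 * M * (b - a).
Proof.
move=> dG ab gM.
apply: le_trans (nc_le_ReIm _) _; rewrite !raddfB /=.
rewrite -mulrA mulr_natl mulr2n lerD //.
- apply: (@derive_bound _ (fun t => Re (G t)) (fun t => Re (g t))) => // x xab.
    by have [] := dG x.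
  by apply: le_trans (ler_Re_nc _) _; exact: gM.
- apply: (@derive_bound _ (fun t => Im (G t)) (fun t => Im (g t))) => // x xab.
    by have [] := dG x.
  by apply: le_trans (ler_Im_nc _) _; exact: gM.
Qed.

Lemma cder_eq (G g h : R -> R[i]) : cder G g -> (forall x, g x = h x) -> cder G h.
Proof. by move=> dG gh x; rewrite -gh. Qed.

Lemma cderD (G g H h : R -> R[i]) : cder G g -> cder H h ->
  cder (fun t => G t + H t) (fun t => g t + h t).
Proof.
move=> dG dH x; have [G1 G2] := dG x; have [H1 H2] := dH x.
split; rewrite raddfD /=.
- have -> : (fun t => Re (G t + H t)) = (fun t => Re (G t)) \+ (fun t => Re (H t)).
    by apply/funext => t; rewrite raddfD.
  exact: is_deriveD.
- have -> : (fun t => Im (G t + H t)) = (fun t => Im (G t)) \+ (fun t => Im (H t)).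
    by apply/funext => t; rewrite raddfD.
  exact: is_deriveD.
Qed.

Lemma cderZ (c : R[i]) (G g : R -> R[i]) : cder G g ->
  cder (fun t => c * G t) (fun t => c * g t).
Proof.
move=> dG x; have [G1 G2] := dG x; case: c => a b.
have ReM (z w : R[i]) : Re (z * w) = Re z * Re w - Im z * Im w by case: z; case: w.
have ImM (z w : R[i]) : Im (z * w) = Re z * Im w + Im z * Re w.
  by case: z => ? ?; case: w => ? ? /=; rewrite addrC.
split; rewrite ?ReM ?ImM /=.
- have -> : (fun t => Re (Complex a b * G t)) =
      (a \*: (fun t => Re (G t) : R^o)) \- (b \*: (fun t => Im (G t) : R^o)).
    by apply/funext => t; rewrite ReM.
  exact: is_deriveB.
- have -> : (fun t => Im (Complex a b * G t)) =
      (a \*: (fun t => Im (G t) : R^o)) \+ (b \*: (fun t => Re (G t) : R^o)).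
    by apply/funext => t; rewrite ImM.
  exact: is_deriveD.
Qed.

Lemma cderB (G g H h : R -> R[i]) : cder G g -> cder H h ->
  cder (fun t => G t - H t) (fun t => g t - h t).
Proof.
move=> dG dH; have := cderD dG (cderZ (-1) dH).
have -> : (fun t => G t + -1 * H t) = (fun t => G t - H t).
  by apply/funext => t; rewrite mulN1r.
by move=> /cder_eq; apply => x; rewrite mulN1r.
Qed.

Lemma cder_sum n (G g : nat -> R -> R[i]) :
  (forall k, cder (G k) (g k)) ->
  cder (fun t => \sum_(k < n) G k t) (fun t => \sum_(k < n) g k t).
Proof.
move=> h; elim: n => [|n IH].
  move=> x; split.
    have -> : (fun t => Re (\sum_(k < 0) G k t)) = cst 0.
      by apply/funext => t; rewrite big_ord0.
    by rewrite big_ord0; exact: is_derive_cst.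
  have -> : (fun t => Im (\sum_(k < 0) G k t)) = cst 0.
    by apply/funext => t; rewrite big_ord0.
  by rewrite big_ord0; exact: is_derive_cst.
have := cderD IH (h n).
have -> : (fun t => \sum_(k < n) G k t + G n t) = (fun t => \sum_(k < n.+1) G k t).
  by apply/funext => t; rewrite big_ord_recr.
by move=> /cder_eq; apply => x; rewrite big_ord_recr.
Qed.

Lemma cder_inc (G H g h : R -> R[i]) (a b : R) : cder G g -> cder H h ->
  (forall x, g x = h x) -> a <= b -> G b - G a = H b - H a.
Proof.
move=> dG dH gh ab.
have := cder_bound (M := 0) (cderB dG dH) ab.
rewrite mulr0 mul0r => E; apply/eqP; rewrite -subr_eq0 -nc_eq0 eq_le nc_ge0 andbT.
have -> : G b - G a - (H b - H a) = (G b - H b) - (G a - H a) by ring.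
by apply: E => x _; rewrite gh subrr nc0.
Qed.

Definition expi (t : R) : R[i] := Complex (cos t) (sin t).

Lemma nc_expi t : nc (expi t) = 1.
Proof. by rewrite /= cos2Dsin2 sqrtr1. Qed.
Lemma expi0 : expi 0 = 1. Proof. by rewrite /expi cos0 sin0. Qed.
Lemma expiD s t : expi (s + t) = expi s * expi t.
Proof. by rewrite /expi cosD sinD; congr Complex; rewrite addrC. Qed.
Lemma expi2pi : expi (2 * pi) = 1.
Proof.
by rewrite mulr_natl /expi cos2pi sin2pi.
Qed.
Lemma expi_neq0 t : expi t != 0.
Proof. by rewrite -nc_eq0 nc_expi oner_eq0. Qed.
Lemma expiN t : expi (- t) = (expi t)^-1.
Proof.
apply: (mulIf (expi_neq0 t)); rewrite mulVf ?expi_neq0//.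
by rewrite -expiD addNr expi0.
Qed.
Lemma expiX t n : expi t ^+ n = expi (n%:R * t).
Proof.
elim: n => [|n IH]; first by rewrite mul0r expi0.
by rewrite exprS IH -expiD -[in RHS]nat1r mulrDl mul1r.
Qed.

Lemma cder_expi (c : R) :
  cder (fun t => expi (c * t)) (fun t => c%:C%C * 'i%C * expi (c * t)).
Proof.
move=> x; have dc : is_derive x (1 : R) (fun t => c * t) c.
  have -> : (fun t => c * t) = (c \*: (id : R -> R^o)) by [].
  by apply: is_derive_eq; rewrite /GRing.scale /= mulr1.
split => /=.
- have := @is_derive1_comp _ cos (fun t => c * t) x _ _ (is_derive_cos _) dc.
  rewrite /comp => h; apply: (is_derive_eq h).
  by rewrite /GRing.scale /=; ring.
- have := @is_derive1_comp _ sin (fun t => c * t) x _ _ (is_derive_sin _) dc.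
  rewrite /comp => h; apply: (is_derive_eq h).
  by rewrite /GRing.scale /=; ring.
Qed.

Lemma cder_expR : cder (fun t => (expR t)%:C%C) (fun t => (expR t)%:C%C).
Proof. by move=> x; split => /=; [exact: is_derive_expR|exact: is_derive_cst]. Qed.

Lemma cder_id : cder (fun t => t%:C%C) (fun t => 1).
Proof. by move=> x; split => /=; [exact: is_derive_id|exact: is_derive_cst]. Qed.

End ComplexAntiderivatives.


Section Continuity.
Variable R : realType.
Notation nc := (@Normc.normc R).
Notation Re := (@complex.Re R).
Notation Im := (@complex.Im R).

Lemma ccontP (u : R -> R[i]^o) : continuous u -> ccont u.
Proof.
move=> cu; split => x; apply/cvgrPdist_lt => e e0;
  (have : \forall t \near x, nc (u t - u x) < e
    by apply: (cu x (fun z => nc (z - u x) < e)); apply/nearC; exists e).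
- apply: filterS => t; rewrite -normrN opprB -raddfB /=.
  by apply: le_lt_trans; exact: ler_Re_nc.
- apply: filterS => t; rewrite -normrN opprB -raddfB /=.
  by apply: le_lt_trans; exact: ler_Im_nc.
Qed.

Lemma continuous_Complex (a b : R -> R) : continuous a -> continuous b ->
  continuous (fun t => Complex (a t) (b t) : R[i]^o).
Proof.
move=> ca cb x P /nearC[e e0 h].
have e2 : 0 < e / 2 by rewrite divr_gt0.
have /cvgrPdist_lt/(_ _ e2) ha := ca x.
have /cvgrPdist_lt/(_ _ e2) hb := cb x.
near=> t; apply: h; apply: le_lt_trans (nc_le_ReIm _) _.
rewrite !raddfB /= (splitr e) ltrD // distrC.
  by near: t.
by near: t.
Unshelve. all: by end_near.
Qed.

Lemma continuous_expi : continuous (fun t => expi t : R[i]^o).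
Proof. by apply: continuous_Complex; [exact: continuous_cos|exact: continuous_sin]. Qed.

Lemma continuous_expRc : continuous (fun t => (expR t)%:C%C : R[i]^o).
Proof.
by apply: continuous_Complex; [exact: continuous_expR|move=> ?; exact: cvg_cst].
Qed.

End Continuity.

(** * Goursat's lemma and Cauchy's formula *)
Section Bisection.
Variable R : realType.

(** A quantity that is at most the sum of its values on the four quarters of a
    rectangle loses at most a factor four at each step towards some point. *)
Lemma bisection (J : R -> R -> R -> R -> R) (l m : R) : 0 <= l -> 0 <= m ->
  (forall a b c d x y, a <= x <= b -> c <= y <= d ->
     J a b c d <= J a x c y + J x b c y + J a x y d + J x b y d) ->
  forall a c : R, exists s t : R, 
    [/\ a <= s <= a + l, c <= t <= c + m &
    forall n, exists a' c',
      [/\ a <= a' <= s, s <= a' + l / 2 ^+ n <= a + l, 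
          c <= c' <= t, t <= c' + m / 2 ^+ n <= c + m &
        J a (a + l) c (c + m) <= 4 ^+ n * J a' (a' + l / 2 ^+ n) c' (c' + m / 2 ^+ n)]].
Proof.
move=> l0 m0 Jsub a c.
pose Q n (p : R * R) := J p.1 (p.1 + l / 2 ^+ n) p.2 (p.2 + m / 2 ^+ n).
have halve (x : R) n : x / 2 ^+ n = x / 2 ^+ n.+1 + x / 2 ^+ n.+1.
  by rewrite exprS; field; rewrite expf_neq0.
have step n (p : R * R) : exists q : R * R,
    [/\ p.1 <= q.1, q.1 + l / 2 ^+ n.+1 <= p.1 + l / 2 ^+ n,
     p.2 <= q.2, q.2 + m / 2 ^+ n.+1 <= p.2 + m / 2 ^+ n & Q n p <= 4 * Q n.+1 q].
  set x := p.1 + l / 2 ^+ n.+1; set y := p.2 + m / 2 ^+ n.+1.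
  have lg k : 0 <= l / 2 ^+ k by rewrite divr_ge0// exprn_ge0.
  have mg k : 0 <= m / 2 ^+ k by rewrite divr_ge0// exprn_ge0.
  have px : p.1 <= x by rewrite lerDl.
  have py : p.2 <= y by rewrite lerDl.
  have xl : x + l / 2 ^+ n.+1 = p.1 + l / 2 ^+ n by rewrite (halve l n) addrA.
  have ym : y + m / 2 ^+ n.+1 = p.2 + m / 2 ^+ n by rewrite (halve m n) addrA.
  have := Jsub p.1 (p.1 + l / 2 ^+ n) p.2 (p.2 + m / 2 ^+ n) x y.
  rewrite -xl -ym px py !lerDl !lg !mg => /(_ isT isT) h.
  have [h1|h1] := lerP (Q n p) (4 * Q n.+1 p).
    by exists p; split; rewrite ?lexx // -?xl -?ym lerDl.
  have [h2|h2] := lerP (Q n p) (4 * Q n.+1 (x, p.2)).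
    by exists (x, p.2); split; rewrite //= -?xl -?ym ?lerDl.
  have [h3|h3] := lerP (Q n p) (4 * Q n.+1 (p.1, y)).
    by exists (p.1, y); split; rewrite //= -?xl -?ym ?lerDl.
  exists (x, y); split; rewrite //= -?xl -?ym //.
  move: h h1 h2 h3; rewrite /Q /= -xl -ym -/x -/y; lra.
(* lower left corners of the nested rectangles *)
have [u [u0 uS]] : exists u : nat -> R * R, u 0%N = (a, c) /\ forall n,
    [/\ (u n).1 <= (u n.+1).1, (u n.+1).1 + l / 2 ^+ n.+1 <= (u n).1 + l / 2 ^+ n,
     (u n).2 <= (u n.+1).2, (u n.+1).2 + m / 2 ^+ n.+1 <= (u n).2 + m / 2 ^+ n
     & Q n (u n) <= 4 * Q n.+1 (u n.+1)].
  pose nxt n p := projT1 (cid (step n p)).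
  exists (fix u n := if n is k.+1 then nxt k (u k) else (a, c)); split => // n.
  exact: (projT2 (cid (step n _))).
have nested (v : nat -> R) (k : R) : 0 <= k -> (forall n, v n <= v n.+1) ->
    (forall n, v n.+1 + k / 2 ^+ n.+1 <= v n + k / 2 ^+ n) ->
    exists s, forall n, [/\ v 0%N <= v n <= s & s <= v n + k / 2 ^+ n <= v 0%N + k].
  move=> k0 v1 v2.
  have v1' i j : (i <= j)%N -> v i <= v j.
    by move=> ij; exact: (homo_leq (@lexx _ R) le_trans v1).
  have v2' i j : (i <= j)%N -> v j + k / 2 ^+ j <= v i + k / 2 ^+ i.
    by move=> ij; apply: (homo_leq (r := fun x y => y <= x) (@lexx _ R) _ v2) => // y x z yx /le_trans; exact.
  have v3 i j : v i <= v j + k / 2 ^+ j.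
    apply: (le_trans (v1' i (maxn i j) (leq_maxl _ _))).
    apply: le_trans (v2' j (maxn i j) (leq_maxr _ _)).
    by rewrite lerDl divr_ge0// exprn_ge0.
  exists (sup (range v)) => n; split; apply/andP; split.
  - exact: v1'.
  - apply: sup_ubound; last by exists n.
    by exists (v 0%N + k / 2 ^+ 0) => _ [i _ <-].
  - apply: ge_sup; first by exists (v 0%N), 0%N.
    by move=> _ [i _ <-].
  - by apply: le_trans (v2' 0%N n _) _ => //; rewrite expr0 divr1.
have [s hs] := nested (fun n => (u n).1) l l0 (fun n => let: And5 h _ _ _ _ := uS n in h)
  (fun n => let: And5 _ h _ _ _ := uS n in h).
have [t ht] := nested (fun n => (u n).2) m m0 (fun n => let: And5 _ _ h _ _ := uS n in h)
  (fun n => let: And5 _ _ _ h _ := uS n in h).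
move: hs ht; rewrite u0 /= => hs ht.
exists s, t; split.
- have [/andP[h1 h2] /andP[h3 h4]] := hs 0%N.
  by rewrite (le_trans h1 h2) (le_trans h3 h4).
- have [/andP[h1 h2] /andP[h3 h4]] := ht 0%N.
  by rewrite (le_trans h1 h2) (le_trans h3 h4).
- move=> n; exists (u n).1, (u n).2.
  have [h1 h2] := hs n; have [h3 h4] := ht n; split => //.
  elim: n {h1 h2 h3 h4} => [|n IH]; first by rewrite u0 !expr0 !divr1 mul1r.
  apply: le_trans IH _; rewrite exprSr -mulrA ler_pM2l ?exprn_gt0//.
  by have [] := uS n.
Qed.

End Bisection.

Section Cauchy.
Variable R : realType.
Notation nc := (@Normc.normc R).

Definition cdiff (f : R[i] -> R[i]) (z l : R[i]) := forall e : R, 0 < e ->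
  exists2 d : R, 0 < d & forall u, nc u < d -> nc (f (z + u) - f z - l * u) <= e * nc u.

Variables (f : R[i]^o -> R[i]^o) (r : R) (w : R[i]).
Hypothesis fcont : continuous f.
Hypothesis r0 : 0 < r.
Hypothesis fdiff : forall z, nc z <= r -> exists l, cdiff f z l.
Hypothesis wr : nc w < r.

Definition circ (t : R) : R[i] := r%:C%C * expi t.
(** Polar coordinates around w: the half-strip s <= 0, 0 <= t <= 2 pi covers
    the punctured disc, and s = 0 is the circle.  The differential of z along
    them satisfies dz / (z - w) = ds + i [ker] t dt. *)
Definition polar (s t : R) : R[i] := w + (expR s)%:C%C * (circ t - w).
Definition ker (t : R) : R[i] := circ t / (circ t - w).

Lemma nc_circ t : nc (circ t) = r.
Proof. by rewrite ncM nc_real nc_expi mulr1 gtr0_norm. Qed.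

Lemma nc_circB t : r - nc w <= nc (circ t - w).
Proof. by rewrite -{1}(nc_circ t) ncBD. Qed.

Lemma circB_neq0 t : circ t - w != 0.
Proof. by rewrite -nc_gt0; apply: lt_le_trans (nc_circB t); rewrite subr_gt0. Qed.

Lemma nc_ker t : nc (ker t) <= r / (r - nc w).
Proof.
rewrite ncM ncV nc_circ ler_pM2l// lef_pV2 ?nc_circB// ?posrE ?subr_gt0//.
by rewrite nc_gt0 circB_neq0.
Qed.

Lemma cder_circ : cder circ (fun t => 'i%C * circ t).
Proof.
have := cderZ r%:C%C (@cder_expi R 1).
have -> : (fun t => r%:C%C * expi (1 * t)) = circ by apply/funext => t; rewrite mul1r.
by move=> /cder_eq; apply => x; rewrite /circ !mul1r; ring.
Qed.

Lemma circ_continuous : continuous (circ : R -> R[i]^o).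
Proof.
by move=> t; apply: cvgM; [exact: cvg_cst|exact: continuous_expi].
Qed.

Lemma ker_continuous : continuous (ker : R -> R[i]^o).
Proof.
move=> t; apply: cvgM; first exact: circ_continuous.
apply: cvgV; first exact: circB_neq0.
by apply: cvgB; [exact: circ_continuous|exact: cvg_cst].
Qed.

Lemma polar_continuous_t s : continuous (polar s : R -> R[i]^o).
Proof.
move=> t; apply: cvgD; first exact: cvg_cst.
apply: cvgM; first exact: cvg_cst.
by apply: cvgB; [exact: circ_continuous|exact: cvg_cst].
Qed.

Lemma polar_continuous_s t : continuous (polar ^~ t : R -> R[i]^o).
Proof.
move=> s; apply: cvgD; first exact: cvg_cst.
by apply: cvgM; [exact: continuous_expRc|exact: cvg_cst].
Qed.

Lemma ang_cont s : ccont (fun t => f (polar s t) * ('i%C * ker t)).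
Proof.
apply: (@ccontP _ (fun t => f (polar s t) * ('i%C * ker t))) => t; apply: cvgM.
  by apply: (@continuous_comp _ _ _ (polar s : R -> R[i]^o) f); [exact: polar_continuous_t|exact: fcont].
by apply: cvgM; [exact: cvg_cst|exact: ker_continuous].
Qed.

Lemma rad_cont t : ccont (fun s => f (polar s t)).
Proof.
apply: (@ccontP _ (fun s => f (polar s t))) => s.
by apply: (@continuous_comp _ _ _ (polar ^~ t : R -> R[i]^o) f); [exact: polar_continuous_s|exact: fcont].
Qed.

Lemma ker_cont : ccont (fun t => 'i%C * ker t).
Proof.
by apply: (@ccontP _ (fun t => 'i%C * ker t)) => t; apply: cvgM; [exact: cvg_cst|exact: ker_continuous].
Qed.

(** Antiderivatives of f(z) dz / (z - w) along the arcs at level s and along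
    the rays of angle t. *)
Definition Ang s := projT1 (cid (antiderivative (ang_cont s))).
Definition Rad t := projT1 (cid (antiderivative (rad_cont t))).
Definition Ker := projT1 (cid (antiderivative ker_cont)).

Lemma AngP s : cder (Ang s) (fun t => f (polar s t) * ('i%C * ker t)).
Proof. exact: (projT2 (cid (antiderivative (ang_cont s)))). Qed.
Lemma RadP t : cder (Rad t) (fun s => f (polar s t)).
Proof. exact: (projT2 (cid (antiderivative (rad_cont t)))). Qed.
Lemma KerP : cder Ker (fun t => 'i%C * ker t).
Proof. exact: (projT2 (cid (antiderivative ker_cont))). Qed.

(** The integral of f(z) dz / (z - w) along the boundary of the image of the
    rectangle [a, b] x [c, d]. *)
Definition bdry a b c d : R[i] :=
  (Ang b d - Ang b c) - (Ang a d - Ang a c)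
  - ((Rad d b - Rad d a) - (Rad c b - Rad c a)).

Lemma bdry_sub a b c d x y :
  bdry a b c d = bdry a x c y + bdry x b c y + bdry a x y d + bdry x b y d.
Proof. by rewrite /bdry; ring. Qed.

(** The form is exact on affine functions, so only the distance from f to an
    affine function contributes. *)
Lemma bdry_small a b c d (al be : R[i]) (eta : R) : a <= b -> c <= d ->
  (forall s t, a <= s <= b -> c <= t <= d ->
     nc (f (polar s t) - (al + be * (polar s t - w))) <= eta) ->
  nc (bdry a b c d) <= 4 * eta * (r / (r - nc w) * (d - c) + (b - a)).
Proof.
move=> ab cd h.
have ac : a <= a <= b by rewrite lexx.
have bc : a <= b <= b by rewrite lexx andbT.
have cc : c <= c <= d by rewrite lexx.
have dc : c <= d <= d by rewrite lexx andbT.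
pose A0 s t := al * Ker t + (be * (expR s)%:C%C) * circ t.
have A0P s : cder (A0 s) (fun t => (al + be * (polar s t - w)) * ('i%C * ker t)).
  have /cder_eq := cderD (cderZ al KerP) (cderZ (be * (expR s)%:C%C) cder_circ).
  apply => t; rewrite /polar [w + _]addrC addrK /ker.
  by field; exact: circB_neq0.
pose D0 t s := al * s%:C%C + (be * (circ t - w)) * (expR s)%:C%C.
have D0P t : cder (D0 t) (fun s => al + be * (polar s t - w)).
  have /cder_eq := cderD (cderZ al (@cder_id R)) (cderZ (be * (circ t - w)) (@cder_expR R)).
  by apply => s; rewrite /polar; ring.
have hA s : a <= s <= b ->
    nc (Ang s d - A0 s d - (Ang s c - A0 s c)) <= 2 * eta * (r / (r - nc w) * (d - c)).
  move=> sab.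
  have -> : 2 * eta * (r / (r - nc w) * (d - c)) =
            2 * (eta * (r / (r - nc w))) * (d - c) by ring.
  apply: (cder_bound (cderB (AngP s) (A0P s)) cd) => t tcd.
  rewrite -mulrBl ncM; apply: ler_pM; rewrite ?nc_ge0//; first exact: h.
  by rewrite ncM /= expr0n expr1n add0r sqrtr1 mul1r; exact: nc_ker.
have hD t : c <= t <= d ->
    nc (Rad t b - D0 t b - (Rad t a - D0 t a)) <= 2 * eta * (b - a).
  move=> tcd; apply: (cder_bound (cderB (RadP t) (D0P t)) ab) => s sab.
  exact: h.
have -> : bdry a b c d =
    (Ang b d - A0 b d - (Ang b c - A0 b c)) - (Ang a d - A0 a d - (Ang a c - A0 a c))
  - ((Rad d b - D0 d b - (Rad d a - D0 d a)) - (Rad c b - D0 c b - (Rad c a - D0 c a))).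
  by rewrite /bdry /A0 /D0; ring.
apply: le_trans (ncBle _ _) _.
have h1 := ncBle (Ang b d - A0 b d - (Ang b c - A0 b c)) (Ang a d - A0 a d - (Ang a c - A0 a c)).
have h2 := ncBle (Rad d b - D0 d b - (Rad d a - D0 d a)) (Rad c b - D0 c b - (Rad c a - D0 c a)).
have := hA b bc; have := hA a ac; have := hD c cc; have := hD d dc; lra.
Qed.

Lemma polar0 t : polar 0 t = circ t.
Proof. by rewrite /polar expR0 mul1r addrC subrK. Qed.

Lemma nc_polar s t : s <= 0 -> nc (polar s t) <= r.
Proof.
move=> s0; have e1 : expR s <= 1 by rewrite -expR0 ler_expR.
have e0 := expR_ge0 s.
have -> : polar s t = (1 - expR s)%:C%C * w + (expR s)%:C%C * circ t.
  by rewrite /polar rmorphB rmorph1; ring.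
apply: le_trans (ncD _ _) _; rewrite (ncM _ w) (ncM _ (circ t)) !nc_real nc_circ.
rewrite [`|expR s|]ger0_norm// ger0_norm ?subr_ge0//.
have : (1 - expR s) * nc w <= (1 - expR s) * r by rewrite ler_wpM2l ?subr_ge0// ltW.
lra.
Qed.


Lemma polar_lip s s' t t' : s <= 0 -> s' <= 0 ->
  nc (polar s t - polar s' t') <= 2 * r * (`|s - s'| + `|t - t'|).
Proof.
move=> s0 s'0.
have hexp (x y : R) : x <= y -> y <= 0 -> `|expR y - expR x| <= `|y - x|.
  move=> xy y0; rewrite [leRHS]ger0_norm ?subr_ge0// -[leRHS]mul1r.
  apply: (derive_bound (f := @expR R)) => // z /andP[xz zy].
  by rewrite ger0_norm ?expR_ge0// -expR0 ler_expR (le_trans zy).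
have hE : `|expR s - expR s'| <= `|s - s'|.
  have [ss|/ltW ss] := leP s' s; first exact: hexp.
  by rewrite distrC [leRHS]distrC; exact: hexp.
have hcirc (x y : R) : x <= y -> nc (circ y - circ x) <= 2 * r * `|y - x|.
  move=> xy; rewrite [`|_|]ger0_norm ?subr_ge0//.
  apply: (cder_bound cder_circ) => // z _.
  by rewrite (ncM _ (circ z)) nc_circ /= expr0n expr1n add0r sqrtr1 mul1r.
have hC : nc (circ t - circ t') <= 2 * r * `|t - t'|.
  have [tt|/ltW tt] := leP t' t; first exact: hcirc.
  by rewrite ncB distrC; exact: hcirc.
have -> : polar s t - polar s' t' =
    (expR s - expR s')%:C%C * (circ t - w) + (expR s')%:C%C * (circ t - circ t').
  by rewrite /polar rmorphB; ring.
apply: le_trans (ncD _ _) _; rewrite (ncM _ (circ t - w)) (ncM _ (circ t - _)) !nc_real mulrDr; apply: lerD.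
  rewrite mulrC; apply: ler_pM => //; rewrite ?nc_ge0//.
  apply: le_trans (ncBle _ _) _; rewrite nc_circ; move: wr; lra.
rewrite -[leRHS]mul1r; apply: ler_pM => //; rewrite ?nc_ge0//.
by rewrite ger0_norm ?expR_ge0// -expR0 ler_expR.
Qed.

(** Near the limit point of a bisection, f is affine up to an error small
    compared with the diameter; by [bdry_small] the boundary integral is then
    small compared with the area. *)
Lemma goursat a b c d : a <= b -> b <= 0 -> c <= d -> bdry a b c d = 0.
Proof.
move=> ab b0 cd; set l := b - a; set m := d - c.
have l0 : 0 <= l by rewrite subr_ge0.
have m0 : 0 <= m by rewrite subr_ge0.
have K0 : 0 < r / (r - nc w) by rewrite divr_gt0// subr_gt0.
set K := r / (r - nc w) in K0.
have [|s [t [sab tcd h]]] := @bisection R (fun a b c d => nc (bdry a b c d)) l m l0 m0 _ a c.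
  move=> a1 b1 c1 d1 x y _ _; rewrite (bdry_sub a1 b1 c1 d1 x y).
  by do 2![apply: le_trans (ncD _ _) _; rewrite lerD2r]; exact: ncD.
rewrite /l /m [a + _]addrC subrK [c + _]addrC subrK -/l -/m in sab tcd h.
have [s0 z1] : s <= 0 /\ nc (polar s t) <= r.
  have s0 : s <= 0 by move: sab b0; lra.
  by split => //; exact: nc_polar.
have [L hL] := fdiff z1.
apply: small_eq0 => e e0.
set B := 8 * r * (l + m) * (K * m + l).
have B0 : 0 <= B.
  apply: mulr_ge0; last by apply: addr_ge0 => //; apply: mulr_ge0 => //; exact: ltW.
  by apply: mulr_ge0; [apply: mulr_ge0 => //; exact: ltW|exact: addr_ge0].
have e1 : 0 < e / (B + 1) by rewrite divr_gt0// ltr_wpDl.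
have [dl dl0 hd] := hL _ e1.
have [n hn] : exists n, 2 * r * (l / 2 ^+ n + m / 2 ^+ n) < dl.
  have [n hn] := div_pow2_lt (2 * r * (l + m)) dl0.
  by exists n; rewrite -mulrDl mulrA.
have [a' [c' [/andP[aa as'] /andP[sa ab'] /andP[cc ct] /andP[tc cd'] hJ]]] := h n.
apply: le_trans hJ _.
set ln := l / 2 ^+ n in hn sa ab' *; set mn := m / 2 ^+ n in hn tc cd' *.
have ln0 : 0 <= ln by rewrite divr_ge0// exprn_ge0.
have mn0 : 0 <= mn by rewrite divr_ge0// exprn_ge0.
have hQ : nc (bdry a' (a' + ln) c' (c' + mn)) <=
    4 * (e / (B + 1) * (2 * r * (ln + mn))) * (K * mn + ln).
  have := @bdry_small a' (a' + ln) c' (c' + mn)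
    (f (polar s t) - L * (polar s t - w)) L (e / (B + 1) * (2 * r * (ln + mn))).
  rewrite !lerDl ln0 mn0 ![_ + ln - _]addrAC ![_ + mn - _]addrAC !subrr !add0r.
  apply => // s' t' /andP[s1 s2] /andP[t1 t2].
  have s'0 : s' <= 0 by move: ab' b0; lra.
  set u := polar s' t' - polar s t.
  have hu : nc u <= 2 * r * (ln + mn).
    apply: le_trans (polar_lip _ _ s'0 s0) _.
    rewrite ler_pM2l ?mulr_gt0//; apply: lerD; rewrite ler_norml; lra.
  have -> : f (polar s' t') - (f (polar s t) - L * (polar s t - w) + L * (polar s' t' - w))
     = f (polar s t + u) - f (polar s t) - L * u.
    have -> : polar s t + u = polar s' t' by rewrite /u addrC subrK.
    by rewrite /u; ring.
  apply: le_trans (hd u _) _; first exact: le_lt_trans hu hn.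
  by rewrite ler_pM2l.
apply: (@le_trans _ _ (4 ^+ n * (4 * (e / (B + 1) * (2 * r * (ln + mn))) * (K * mn + ln)))).
  by rewrite ler_pM2l// exprn_gt0.
have -> : 4 ^+ n * (4 * (e / (B + 1) * (2 * r * (ln + mn))) * (K * mn + ln)) =
    e * (B / (B + 1)).
  have B1 : B + 1 != 0 by rewrite gt_eqF// ltr_wpDl.
  have -> : (4 : R) ^+ n = 2 ^+ n * 2 ^+ n by rewrite -exprMn; congr (_ ^+ n); ring.
  have p2 : (2 : R) ^+ n != 0 by rewrite expf_neq0.
  have -> : e * (B / (B + 1)) = e * (8 * r * (l + m) * (K * m + l)) / (B + 1) by rewrite mulrA.
  rewrite /ln /mn; move: B1 p2; clearbody B K l m; move: (2 ^+ n) => P B1 p2.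
  by field; rewrite B1 p2.
rewrite ger_pMr// ler_pdivrMr ?mul1r ?lerDl// ltr_wpDl//.
Qed.

(** The two rays bounding the strip coincide, so their contributions to the
    boundary integral cancel. *)
Lemma ang_indep s : s <= 0 ->
  Ang 0 (2 * pi) - Ang 0 0 = Ang s (2 * pi) - Ang s 0.
Proof.
move=> s0; have p0 : 0 <= 2 * pi :> R by rewrite mulr_ge0// pi_ge0.
have := goursat s0 (lexx 0) p0; rewrite /bdry.
rewrite (cder_inc (RadP (2 * pi)) (RadP 0) _ s0); last first.
  by move=> x; rewrite /polar /circ expi2pi expi0.
by rewrite subrr subr0 => /subr0_eq.
Qed.

(** As s tends to -oo the arc shrinks to w, and f becomes constant on it. *)
Theorem cauchy_formula :
  Ang 0 (2 * pi) - Ang 0 0 = f w * (Ker (2 * pi) - Ker 0).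
Proof.
have p0 : 0 <= 2 * pi :> R by rewrite mulr_ge0// pi_ge0.
apply/eqP; rewrite -subr_eq0; apply/eqP/small_eq0 => e e0.
have K0 : 0 < r / (r - nc w) by rewrite divr_gt0// subr_gt0.
set K := r / (r - nc w) in K0.
set e1 := e / (2 * K * (2 * pi) + 1).
have den0 : 0 < 2 * K * (2 * pi) + 1 by rewrite ltr_wpDl// mulr_ge0// mulr_ge0// ltW.
have e10 : 0 < e1 by rewrite divr_gt0.
have [d d0 hd] : exists2 d : R, 0 < d & forall x, nc (x - w) < d -> nc (f x - f w) < e1.
  apply/nearC; have P : nbhs (f w) (fun z => nc (z - f w) < e1) by apply/nearC; exists e1.
  exact: (fcont P).
pose q := Num.min 1 (d / (4 * r)).
have q0 : 0 < q by rewrite lt_min ltr01 divr_gt0// mulr_gt0.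
have q1 : q <= 1 by rewrite ge_min lexx.
have qd : q * (2 * r) < d.
  have : q <= d / (4 * r) by rewrite ge_min lexx orbT.
  rewrite ler_pdivlMr ?mulr_gt0// => qd.
  have : 0 < q * r by rewrite mulr_gt0.
  by move: qd; lra.
have s0 : ln q <= 0 by rewrite ln_le0.
rewrite (ang_indep s0).
have := cder_bound (M := e1 * K) (cderB (AngP (ln q)) (cderZ (f w) KerP)) p0.
have -> : Ang (ln q) (2 * pi) - f w * Ker (2 * pi) - (Ang (ln q) 0 - f w * Ker 0)
  = Ang (ln q) (2 * pi) - Ang (ln q) 0 - f w * (Ker (2 * pi) - Ker 0) by ring.
move=> h; apply: le_trans (h _) _.
  move=> t _; rewrite -mulrBl ncM; apply: ler_pM; rewrite ?nc_ge0//.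
    apply/ltW/hd; rewrite /polar [w + _]addrC addrK ncM nc_real lnK ?posrE//.
    rewrite gtr0_norm//; apply: le_lt_trans qd; rewrite ler_pM2l//.
    by apply: le_trans (ncBle _ _) _; rewrite nc_circ; move: wr; lra.
  by rewrite ncM /= expr0n expr1n add0r sqrtr1 mul1r; exact: nc_ker.
rewrite subr0.
have -> : 2 * (e1 * K) * (2 * pi) = e1 * (2 * K * (2 * pi)) by ring.
rewrite /e1 mulrAC ler_pdivrMr// ler_pM2l// lerDl //.
Qed.

End Cauchy.

(** * Power series of a function of one complex variable *)
Section OneVariable.
Variable R : realType.
Notation nc := (@Normc.normc R).

Lemma cdiff_continuous (f : R[i]^o -> R[i]^o) (z l : R[i]^o) : cdiff f z l ->
  {for z, continuous f}.
Proof.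
move=> h P /nearC[e e0 hP].
have [d d0 hd] := h 1 ltr01.
have L0 : 0 < nc l + 1 by rewrite ltr_wpDl ?nc_ge0.
apply/nearC; exists (Num.min d (e / (nc l + 1))).
  by rewrite lt_min d0 divr_gt0.
move=> x; rewrite lt_min => /andP[xd xe]; apply: hP.
have := hd _ xd; rewrite [z + _]addrC subrK mul1r => H.
have -> : f x - f z = (f x - f z - l * (x - z)) + l * (x - z) by rewrite subrK.
apply: le_lt_trans (ncD _ _) _; rewrite ncM.
move: xe; rewrite ltr_pdivlMr// => xe.
by move: xe H; rewrite mulrDr mulr1 [nc l * _]mulrC; lra.
Qed.

Lemma nc_continuous : continuous (fun z : R[i]^o => nc z : R^o).
Proof.
move=> z P /nbhs_ballP[e /= e0 hP]; apply/nearC; exists e => // x xz; apply: hP.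
rewrite /ball /=.
rewrite ltr_norml; have := ncBD z x; have := ncBD x z; rewrite (ncB z x).
move: xz; lra.
Qed.

(** Radial projection onto a closed disc.  Composing with it makes a function
    continuous on the whole plane, so that all its polar slices have global
    antiderivatives, without changing it on the disc. *)
Definition retract (r : R) (z : R[i]^o) : R[i]^o :=
  z * (r / Num.max r (nc z))%:C%C.

Lemma retract_id r z : 0 < r -> nc z <= r -> retract r z = z.
Proof. by move=> r0 zr; rewrite /retract max_l// divff ?gt_eqF// mulr1. Qed.

Lemma nc_retract r z : 0 < r -> nc (retract r z) <= r.
Proof.
move=> r0; rewrite ncM nc_real.
have m0 : 0 < Num.max r (nc z) by rewrite lt_max r0.
rewrite ger0_norm; last by rewrite divr_ge0 ?ltW.
rewrite mulrA ler_pdivrMr// mulrC ler_pM2l//.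
by rewrite le_max lexx orbT.
Qed.

Lemma retract_continuous r : 0 < r -> continuous (retract r).
Proof.
move=> r0.
have gen (T : topologicalType) (g : T -> R[i]^o) (h : T -> R) :
    continuous g -> continuous h ->
    continuous (fun x => g x * (r / Num.max r (h x))%:C%C : R[i]^o).
  move=> cg ch x; apply: cvgM; first exact: cg.
  have hr : continuous (fun x => r / Num.max r (h x)).
    move=> y; apply: cvgM; first exact: cvg_cst.
    apply: cvgV; first by rewrite gt_eqF// lt_max r0.
    by apply: continuous_max; [exact: cvg_cst|exact: ch].
  apply: (@continuous_comp _ _ _ (fun x => r / Num.max r (h x))
    (fun x => x%:C%C : R[i]^o)); first exact: hr.
  by apply: continuous_Complex => ?; [exact: cvg_id|exact: cvg_cst].
by apply: (gen _ (fun z => z)); [move=> z P|exact: nc_continuous].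
Qed.

Section Expansion.
Variables (f : R[i]^o -> R[i]^o) (r M : R).
Hypothesis fcont : continuous f.
Hypothesis r0 : 0 < r.
Hypothesis fdiff : forall z, nc z <= r -> exists l, cdiff f z l.
Hypothesis fM : forall z, nc z = r -> nc (f z) <= M.

Notation circ := (circ r).

Lemma circ_neq0 t : circ t != 0.
Proof. by rewrite -nc_gt0 nc_circ. Qed.

Lemma coef_cont k : ccont (fun t => f (circ t) * ('i%C * (circ t)^-1 ^+ k)).
Proof.
apply: (@ccontP _ (fun t => f (circ t) * ('i%C * (circ t)^-1 ^+ k))) => t.
apply: cvgM.
  by apply: (@continuous_comp _ _ _ (circ : R -> R[i]^o) f); [exact: circ_continuous|exact: fcont].
apply: cvgM; first exact: cvg_cst.
have h : (circ x)^-1 @[x --> t] --> ((circ t)^-1 : R[i]^o).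
  by apply: cvgV; [exact: circ_neq0|exact: circ_continuous].
elim: k => [|k IH]; first exact: cvg_cst.
have -> : (fun x => (circ x)^-1 ^+ k.+1) = (fun x => (circ x)^-1 * (circ x)^-1 ^+ k).
  by apply/funext => x; rewrite exprS.
by rewrite exprS; apply: (@cvgM _ _ (nbhs t)); [exact: h|exact: IH].
Qed.

Definition Coef k := projT1 (cid (antiderivative (coef_cont k))).
Lemma CoefP k : cder (Coef k) (fun t => f (circ t) * ('i%C * (circ t)^-1 ^+ k)).
Proof. exact: (projT2 (cid (antiderivative (coef_cont k)))). Qed.

Definition taylor k : R[i] :=
  (2 * pi)^-1%:C%C * - 'i%C * (Coef k (2 * pi) - Coef k 0).

Lemma pi2_ge0 : 0 <= 2 * pi :> R. Proof. by rewrite mulr_ge0// pi_ge0. Qed.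

Lemma pi2_gt0 : 0 < 2 * pi :> R. Proof. by rewrite mulr_gt0// pi_gt0. Qed.

Lemma nc_i : nc 'i%C = 1. Proof. by rewrite /= expr0n expr1n add0r sqrtr1. Qed.

Lemma taylor_bound k : nc (taylor k) <= 2 * M / r ^+ k.
Proof.
rewrite !ncM ncN nc_i mulr1 nc_real gtr0_norm ?invr_gt0 ?pi2_gt0//.
rewrite mulrC ler_pdivrMr ?pi2_gt0//.
have -> : 2 * M / r ^+ k * (2 * pi) = 2 * (M / r ^+ k) * (2 * pi - 0) by ring.
apply: (cder_bound (CoefP k) pi2_ge0) => t _.
rewrite !ncM ncX ncV nc_i mul1r nc_circ// exprVn ler_wpM2r//.
  by rewrite invr_ge0 exprn_ge0// ltW.
by apply: fM; rewrite nc_circ.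
Qed.

(** The geometric series of 1 / (1 - w / z), with its exact remainder. *)
Lemma ker_expand w n t : nc w < r ->
  ker r w t = \sum_(k < n) w ^+ k * (circ t)^-1 ^+ k
              + (w / circ t) ^+ n * ker r w t.
Proof.
move=> wr; have c0 := circ_neq0 t; have cw := circB_neq0 r0 wr t.
elim: n => [|n IH]; first by rewrite big_ord0 add0r mul1r.
rewrite {1}IH big_ord_recr /= -addrA; congr (_ + _).
rewrite -exprMn exprSr -mulrA -[X in _ = X + _]mulr1 -mulrDr; congr (_ * _).
by rewrite /ker; field; rewrite c0 cw.
Qed.

Lemma ker_tail w n t c : nc w < r ->
  c * ker r w t - \sum_(k < n) w ^+ k * (c * (circ t)^-1 ^+ k)
  = c * ((w / circ t) ^+ n * ker r w t).
Proof.
move=> wr; rewrite {1}(ker_expand n t wr) mulrDr mulr_sumr addrAC -sumrB.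
by rewrite big1 ?add0r// => k _; rewrite mulrCA subrr.
Qed.

Lemma nc_ker2 w t : nc w <= r / 2 -> nc (ker r w t) <= 2.
Proof.
move=> wr; have wr' : nc w < r by move: wr r0; lra.
apply: le_trans (nc_ker r0 wr' t) _.
by rewrite ler_pdivrMr ?subr_gt0//; move: wr; lra.
Qed.

Lemma nc_wcirc w n t : nc ((w / circ t) ^+ n) = (nc w / r) ^+ n.
Proof. by rewrite ncX ncM ncV nc_circ. Qed.

(** The winding number of the circle around w: all terms of the geometric
    series but the constant one have periodic antiderivatives. *)
Lemma ker_total w (wr : nc w < r) : nc w <= r / 2 ->
  Ker r0 wr (2 * pi) - Ker r0 wr 0 = (2 * pi)%:C%C * 'i%C.
Proof.
move=> wr2.
pose q k : R -> R[i] := if k is 0%N then fun t => 'i%C * t%:C%C else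
  fun t => (- (r ^+ k * k%:R)^-1)%:C%C * expi (- k%:R * t).
have qP k : cder (q k) (fun t => 'i%C * (circ t)^-1 ^+ k).
  case: k => [|k]; first by apply: (cder_eq (cderZ 'i%C (@cder_id R))) => t; rewrite expr0.
  apply: (cder_eq (cderZ (- (r ^+ k.+1 * k.+1%:R)^-1)%:C%C (@cder_expi R (- k.+1%:R)))) => t.
  have rn : r ^+ k.+1 != 0 by rewrite expf_neq0// gt_eqF.
  have kn : (k.+1%:R : R) != 0 by rewrite pnatr_eq0.
  have E : (- (r ^+ k.+1 * k.+1%:R)^-1)%:C%C * (- k.+1%:R)%:C%C = (r ^+ k.+1)%:C%C^-1 :> R[i].
    rewrite -rmorphM -fmorphV; congr (_%:C%C).
    by move: (_%:R) (_ ^+ _) rn kn => x y y0 x0; field; rewrite y0 x0.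
  rewrite mulrA mulrA E mulNr expiN -expiX exprVn exprMn invfM rmorphXn.
  by rewrite [X in X * _]mulrC -mulrA.
have qinc k : q k (2 * pi) - q k 0 = if k is 0%N then (2 * pi)%:C%C * 'i%C else 0.
  case: k => [|k] /=; first by rewrite rmorph0 mulr0 subr0 mulrC.
  rewrite mulr0 expi0 mulNr expiN -expiX expi2pi expr1n invr1.
  by rewrite subrr.
have main n : nc (Ker r0 wr (2 * pi) - Ker r0 wr 0 - (2 * pi)%:C%C * 'i%C) <=
    (8 * pi) / 2 ^+ n.
  have := cder_bound (M := 2 / 2 ^+ n) (cderB (KerP r0 wr)
    (cder_sum n.+1 (fun k => cderZ (w ^+ k) (qP k)))) pi2_ge0.
  have -> : Ker r0 wr (2 * pi) - \sum_(k < n.+1) w ^+ k * q k (2 * pi)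
     - (Ker r0 wr 0 - \sum_(k < n.+1) w ^+ k * q k 0) =
     Ker r0 wr (2 * pi) - Ker r0 wr 0 - \sum_(k < n.+1) w ^+ k * (q k (2 * pi) - q k 0).
    under [in RHS]eq_bigr do rewrite mulrBr.
    by rewrite sumrB; ring.
  rewrite big_ord_recl qinc expr0 mul1r big1 ?addr0; last first.
    by move=> k _; rewrite qinc /= mulr0.
  move=> h; apply: le_trans (h _) _; last by rewrite subr0; lra.
  move=> t _; rewrite (ker_tail _ _ _ wr) (ncM 'i%C) nc_i mul1r (ncM (_ ^+ _)) nc_wcirc mulrC.
  have wr0 : 0 <= nc w / r by rewrite divr_ge0 ?nc_ge0// ltW.
  apply: ler_pM; [exact: nc_ge0|by rewrite exprn_ge0|exact: nc_ker2|].
  rewrite -exprVn.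
  have h2 : nc w / r <= 2^-1 by rewrite ler_pdivrMr// mulrC.
  apply: (@le_trans _ _ ((2^-1) ^+ n.+1)).
    by rewrite lerXn2r// nnegrE ?divr_ge0 ?nc_ge0// ltW.
  by rewrite exprS ger_pMl ?exprn_gt0//; lra.
apply/eqP; rewrite -subr_eq0; apply/eqP/small_eq0 => e e0.
have [n hn] := div_pow2_lt (8 * pi) e0.
exact: le_trans (main n) (ltW hn).
Qed.

(** Integrating the geometric series in Cauchy's formula. *)
Lemma taylor_expansion w n : nc w <= r / 2 ->
  nc (f w - \sum_(k < n) taylor k * w ^+ k) <= 4 * M * (nc w / r) ^+ n.
Proof.
move=> wr2; have wr : nc w < r by move: wr2 r0; lra.
have := cauchy_formula fcont r0 fdiff wr; rewrite (ker_total wr wr2) => cf.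
have := cder_bound (M := M * (nc w / r) ^+ n * 2) (cderB (AngP fcont r0 wr 0)
  (cder_sum n (fun k => cderZ (w ^+ k) (CoefP k)))) pi2_ge0.
have -> : Ang fcont r0 wr 0 (2 * pi) - \sum_(k < n) w ^+ k * Coef k (2 * pi)
   - (Ang fcont r0 wr 0 0 - \sum_(k < n) w ^+ k * Coef k 0) =
   Ang fcont r0 wr 0 (2 * pi) - Ang fcont r0 wr 0 0
   - \sum_(k < n) w ^+ k * (Coef k (2 * pi) - Coef k 0).
  under [in RHS]eq_bigr do rewrite mulrBr.
  by rewrite sumrB; ring.
rewrite cf => h.
have pi0 : (2 * pi)%:C%C != 0 :> R[i] by rewrite fmorph_eq0 gt_eqF// pi2_gt0.
have i2 : ('i%C : R[i]) * 'i%C = -1 by rewrite -expr2 sqr_i.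
have -> : f w - \sum_(k < n) taylor k * w ^+ k = (2 * pi)^-1%:C%C * - 'i%C *
   (f w * ((2 * pi)%:C%C * 'i%C) - \sum_(k < n) w ^+ k * (Coef k (2 * pi) - Coef k 0)).
  rewrite mulrBr mulr_sumr; congr (_ - _).
    rewrite fmorphV.
    have -> : (2 * pi)%:C%C^-1 * - 'i%C * (f w * ((2 * pi)%:C%C * 'i%C)) =
      - ('i%C * 'i%C) * f w * ((2 * pi)%:C%C / (2 * pi)%:C%C) by ring.
    by rewrite i2 opprK mul1r divff// mulr1.
  by apply: eq_bigr => k _; rewrite /taylor; ring.
rewrite !ncM ncN nc_i mulr1 nc_real gtr0_norm ?invr_gt0 ?pi2_gt0//.
rewrite mulrC ler_pdivrMr ?pi2_gt0//.
apply: le_trans (h _) _; last by rewrite subr0; lra.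
move=> t _; rewrite polar0.
have -> : f (circ t) * ('i%C * ker r w t)
    - \sum_(k < n) w ^+ k * (f (circ t) * ('i%C * (circ t)^-1 ^+ k))
    = f (circ t) * 'i%C * ((w / circ t) ^+ n * ker r w t).
  by rewrite -(ker_tail _ _ _ wr) mulrA; under [in RHS]eq_bigr do rewrite -mulrA.
rewrite ncM (ncM (f _)) nc_i mulr1 (ncM (_ ^+ _)) nc_wcirc mulrA.
have wr0 : 0 <= nc w / r by rewrite divr_ge0 ?nc_ge0// ltW.
apply: ler_pM; [by rewrite mulr_ge0 ?nc_ge0 ?exprn_ge0|exact: nc_ge0| |exact: nc_ker2].
by apply: ler_wpM2r; rewrite ?exprn_ge0//; apply: fM; rewrite nc_circ.
Qed.

End Expansion.

End OneVariable.

Section PowerSeries.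
Variable R : realType.
Notation nc := (@Normc.normc R).

(** The expansion that Cauchy's formula gives on the circle of radius r, M
    being a bound of f there: the factor 2 comes from [cder_bound], and another
    factor 2 bounds the Cauchy kernel on the disc of radius r / 2. *)
Definition expands (f : R[i] -> R[i]) (c : nat -> R[i]) (r M : R) :=
  (forall k, nc (c k) <= 2 * M / r ^+ k) /\
  forall w n, nc w <= r / 2 ->
    nc (f w - \sum_(k < n) c k * w ^+ k) <= 4 * M * (nc w / r) ^+ n.

Lemma power_series (f : R[i] -> R[i]) (r r1 M : R) : 0 < r -> r < r1 ->
  (forall z, nc z < r1 -> exists l, cdiff f z l) ->
  (forall z, nc z = r -> nc (f z) <= M) -> exists c, expands f c r M.
Proof.
move=> r0 rr1 fd fM.
pose r2 := (r + r1) / 2.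
have [r20 [rr2 r21]] : 0 < r2 /\ r < r2 /\ r2 < r1 by rewrite /r2; split; [|split]; lra.
pose g : R[i]^o -> R[i]^o := fun z => f (retract r2 z).
have gc : continuous g.
  move=> z; apply: (@continuous_comp _ _ _ (@retract R r2) (f : R[i]^o -> R[i]^o)).
    exact: retract_continuous.
  have [|l hl] := fd (retract r2 z); last exact: cdiff_continuous hl.
  by apply: le_lt_trans r21; exact: nc_retract.
have gE z : nc z <= r2 -> g z = f z by move=> h; rewrite /g retract_id.
have gd z : nc z <= r -> exists l, cdiff g z l.
  move=> zr; have [|l hl] := fd z; first exact: le_lt_trans zr rr1.
  exists l => e e0; have [d d0 hd] := hl e e0.
  exists (Num.min d (r2 - r)) => [|u].
    by rewrite lt_min d0 subr_gt0.
  rewrite lt_min => /andP[ud ur]; rewrite !gE; first exact: hd.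
    exact: le_trans zr (ltW rr2).
  by apply: le_trans (ncD _ _) _; move: zr ur; lra.
have gM z : nc z = r -> nc (g z) <= M.
  by move=> zr; rewrite gE ?fM// zr ltW.
exists (taylor gc r0); split => [k|w n wr].
  exact: taylor_bound.
rewrite -(gE w); first exact: taylor_expansion.
by move: wr; lra.
Qed.

Lemma le_linear_eq0 (z : R[i]) (C d : R) : 0 < d ->
  (forall w, w != 0 -> nc w <= d -> nc z <= C * nc w) -> z = 0.
Proof.
move=> d0 h; apply: small_eq0 => e e0.
pose x := Num.min d (e / (`|C| + 1)).
have C0 : 0 < `|C| + 1 by rewrite ltr_wpDl.
have x0 : 0 < x by rewrite lt_min d0 divr_gt0.
have xC : nc x%:C%C = x by rewrite nc_real gtr0_norm.
apply: le_trans (h x%:C%C _ _) _; rewrite ?xC.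
- by rewrite -nc_gt0 xC.
- by rewrite ge_min lexx.
- have : x <= e / (`|C| + 1) by rewrite ge_min lexx orbT.
  rewrite ler_pdivlMr// => hx; apply: le_trans hx.
  by rewrite mulrC ler_pM2l//; have := ler_norm C; lra.
Qed.

Lemma poly_order_eq0 n (c : nat -> R[i]) (K d : R) : 0 < d ->
  (forall w, w != 0 -> nc w <= d ->
     nc (\sum_(k < n) c k * w ^+ k) <= K * nc w ^+ n) ->
  forall k, (k < n)%N -> c k = 0.
Proof.
elim: n c => [//|n IH] c d0 h.
have E w : \sum_(k < n.+1) c k * w ^+ k = c 0%N + w * \sum_(i < n) c i.+1 * w ^+ i.
  rewrite big_ord_recl expr0 mulr1; congr (_ + _).
  by rewrite mulr_sumr; apply: eq_bigr => i _; rewrite exprS mulrCA.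
have c0 : c 0%N = 0.
  apply: (@le_linear_eq0 _ (`|K| + \sum_(i < n) nc (c i.+1)) (Num.min 1 d)).
    by rewrite lt_min ltr01.
  move=> w w0; rewrite le_min => /andP[w1 wd].
  have := h w w0 wd; rewrite E => hw.
  have -> : c 0%N = c 0%N + w * \sum_(i < n) c i.+1 * w ^+ i
     - w * \sum_(i < n) c i.+1 * w ^+ i by rewrite addrK.
  apply: le_trans (ncBle _ _) _; rewrite mulrDl; apply: lerD.
    apply: (le_trans hw); rewrite exprS mulrCA mulrC ler_wpM2r ?nc_ge0//.
    apply: (@le_trans _ _ (`|K| * nc w ^+ n)).
      by rewrite ler_wpM2r ?exprn_ge0 ?nc_ge0// ler_norm.
    by rewrite ler_piMr// exprn_ile1// nc_ge0.
  rewrite ncM mulrC ler_wpM2r ?nc_ge0//.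
  apply: le_trans (nc_sum _ _ _) _; apply: ler_sum => i _.
  by rewrite ncM ncX ler_piMr ?nc_ge0// exprn_ile1// nc_ge0.
case=> [//|k] kn; apply: (IH (fun k => c k.+1)) => // w w0 wd.
have := h w w0 wd; rewrite E c0 add0r.
by rewrite ncM exprS mulrCA ler_pM2l// nc_gt0.
Qed.

(** Coefficients are unique, so a linear relation between functions holds
    between their coefficients; this turns bounds on combinations of functions
    into bounds on combinations of coefficients. *)
Lemma expands_linear (I : Type) (s : seq I) (al : I -> R[i]) (f : I -> R[i] -> R[i])
    (c : I -> nat -> R[i]) (g : R[i] -> R[i]) (e : nat -> R[i]) (r M M' : R) :
  0 < r -> (forall i, expands (f i) (c i) r M) -> expands g e r M' ->
  (forall w, nc w <= r / 2 -> g w = \sum_(i <- s) al i * f i w) ->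
  forall j, e j = \sum_(i <- s) al i * c i j.
Proof.
move=> r0 fe ge gE j.
pose n := j.+1.
pose A := \sum_(i <- s) nc (al i) * (4 * M).
have r2 : 0 < r / 2 by rewrite divr_gt0.
suff H : forall k, (k < n)%N -> e k - \sum_(i <- s) al i * c i k = 0.
  by apply/eqP; rewrite -subr_eq0 H.
apply: (@poly_order_eq0 n _ ((4 * M' + A) / r ^+ n) (r / 2)) => // w _ wr.
have -> : \sum_(k < n) (e k - \sum_(i <- s) al i * c i k) * w ^+ k =
  \sum_(i <- s) al i * (f i w - \sum_(k < n) c i k * w ^+ k) -
  (g w - \sum_(k < n) e k * w ^+ k).
  have -> : \sum_(i <- s) al i * (f i w - \sum_(k < n) c i k * w ^+ k) =
      \sum_(i <- s) al i * f i w - \sum_(i <- s) al i * \sum_(k < n) c i k * w ^+ k.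
    by under eq_bigr do rewrite mulrBr; rewrite sumrB.
  have ab (U V W : R[i]) : (U - V) - (U - W) = W - V by ring.
  rewrite gE// ab; under eq_bigr do rewrite mulrBl.
  rewrite sumrB; congr (_ - _).
  under [in RHS]eq_bigr do rewrite mulr_sumr.
  rewrite exchange_big /=; apply: eq_bigr => k _.
  by rewrite mulr_suml; apply: eq_bigr => i _; rewrite mulrA.
apply: le_trans (ncBle _ _) _.
have wrn : 0 <= (nc w / r) ^+ n by rewrite exprn_ge0// divr_ge0 ?nc_ge0// ltW.
have -> : (4 * M' + A) / r ^+ n * nc w ^+ n = A * (nc w / r) ^+ n + 4 * M' * (nc w / r) ^+ n.
  by rewrite expr_div_n; ring.
apply: lerD; last by have [_] := ge; apply.
apply: le_trans (nc_sum _ _ _) _; rewrite mulr_suml; apply: ler_sum => i _.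
rewrite ncM -mulrA ler_wpM2l ?nc_ge0//.
by have [_] := fe i; apply.
Qed.

(** Cauchy's criterion for a limit at 0, with a rate.  For a real function the
    limit is the supremum of the lower bounds q(h) - C |h|. *)
Lemma lipschitz_limit (q : R[i] -> R[i]) (C d : R) : 0 < d ->
  (forall h h', h != 0 -> h' != 0 -> nc h < d -> nc h' < d ->
     nc (q h - q h') <= C * (nc h + nc h')) ->
  exists L, forall h, h != 0 -> nc h < d -> nc (q h - L) <= 2 * C * nc h.
Proof.
move=> d0 H.
have real (u : R[i] -> R) : (forall h h', h != 0 -> h' != 0 -> nc h < d -> nc h' < d ->
     `|u h - u h'| <= C * (nc h + nc h')) ->
  exists L, forall h, h != 0 -> nc h < d -> `|u h - L| <= C * nc h.
  move=> hu.
  pose S := [set y | exists h, [/\ h != 0, nc h < d & y = u h - C * nc h]].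
  have ub h : h != 0 -> nc h < d -> ubound S (u h + C * nc h).
    move=> h0 hd _ [h' [h'0 h'd ->]].
    by have := hu h h' h0 h'0 hd h'd; rewrite ler_norml => /andP[]; lra.
  have [h1 h10 h1d] : exists2 h1, h1 != 0 & nc h1 < d.
    exists (d / 2)%:C%C; rewrite ?nc_real; first by rewrite fmorph_eq0 gt_eqF// divr_gt0.
    by rewrite gtr0_norm ?divr_gt0//; lra.
  exists (sup S) => h h0 hd.
  have s1 : u h - C * nc h <= sup S.
    apply: ub_le_sup; last by exists h.
    by exists (u h + C * nc h); exact: ub.
  have s2 : sup S <= u h + C * nc h.
    by apply: ge_sup; [exists (u h1 - C * nc h1), h1|exact: ub].
  by rewrite ler_norml; apply/andP; split; lra.
have [|L1 hL1] := real (fun h => complex.Re (q h)).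
  move=> h h' h0 h'0 hd h'd; apply: le_trans (H h h' h0 h'0 hd h'd).
  by rewrite -raddfB; exact: ler_Re_nc.
have [|L2 hL2] := real (fun h => complex.Im (q h)).
  move=> h h' h0 h'0 hd h'd; apply: le_trans (H h h' h0 h'0 hd h'd).
  by rewrite -raddfB; exact: ler_Im_nc.
exists (Complex L1 L2) => h h0 hd.
apply: le_trans (nc_le_ReIm _) _; rewrite !raddfB /=.
by have := hL1 h h0 hd; have := hL2 h h0 hd; lra.
Qed.

End PowerSeries.

(** * Taylor series in two variables *)
Section TwoVariables.
Variable R : realType.
Notation nc := (@Normc.normc R).

Lemma le_of_eq (x y : R) : x = y -> x <= y.
Proof. by move->. Qed.

Definition tdiff (G : R[i] -> R[i] -> R[i]) (x y a b : R[i]) := forall e : R, 0 < e ->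
  exists2 d : R, 0 < d & forall u v, nc u < d -> nc v < d ->
    nc (G (x + u) (y + v) - G x y - (a * u + b * v)) <= e * Num.max (nc u) (nc v).

(** The coefficient c j k belongs to the monomial x^k y^j. *)
Definition tpoly (c : nat -> nat -> R[i]) n (x y : R[i]) : R[i] :=
  \sum_(j < n) (\sum_(k < n - j) c j k * x ^+ k) * y ^+ j.

Lemma tdiff_x G x y a b : tdiff G x y a b -> cdiff (G ^~ y) x a.
Proof.
move=> h e e0; have [d d0 hd] := h e e0; exists d => // u ud.
by have := hd u 0 ud; rewrite nc0 addr0 mulr0 addr0 max_l ?nc_ge0//; apply.
Qed.

Lemma tdiff_y G x y a b : tdiff G x y a b -> cdiff (G x) y b.
Proof.
move=> h e e0; have [d d0 hd] := h e e0; exists d => // u ud.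
have := hd 0 u; rewrite nc0 addr0 mulr0 add0r max_r ?nc_ge0//; exact.
Qed.

Lemma cdiffD (f g : R[i] -> R[i]) z l m : cdiff f z l -> cdiff g z m ->
  cdiff (fun x => f x + g x) z (l + m).
Proof.
move=> hf hg e e0; have e2 : 0 < e / 2 by rewrite divr_gt0.
have [d d0 hd] := hf _ e2; have [d' d'0 hd'] := hg _ e2.
exists (Num.min d d') => [|u]; first by rewrite lt_min d0.
rewrite lt_min => /andP[ud ud'].
have -> : f (z + u) + g (z + u) - (f z + g z) - (l + m) * u =
  (f (z + u) - f z - l * u) + (g (z + u) - g z - m * u) by ring.
by apply: le_trans (ncD _ _) _; have := hd u ud; have := hd' u ud'; lra.
Qed.

Lemma cdiffZ (k : R[i]) (f : R[i] -> R[i]) z l : cdiff f z l ->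
  cdiff (fun x => k * f x) z (k * l).
Proof.
move=> hf e e0; have K0 : 0 < nc k + 1 by rewrite ltr_wpDl ?nc_ge0.
have [|d d0 hd] := hf (e / (nc k + 1)); first by rewrite divr_gt0.
exists d => // u ud.
have -> : k * f (z + u) - k * f z - k * l * u = k * (f (z + u) - f z - l * u) by ring.
rewrite ncM; apply: (@le_trans _ _ (nc k * (e / (nc k + 1) * nc u))).
  by rewrite ler_wpM2l ?nc_ge0//; exact: hd.
rewrite mulrA ler_wpM2r ?nc_ge0// mulrCA ger_pMr//.
by rewrite ler_pdivrMr// mul1r lerDl.
Qed.

Lemma cdiff_shift (f : R[i] -> R[i]) z h l : cdiff f (z + h) l ->
  cdiff (fun u => f (z + u)) h l.
Proof.
by move=> hf e e0; have [d d0 hd] := hf e e0; exists d => // u ud; rewrite addrA; exact: hd.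
Qed.

Variables (G : R[i] -> R[i] -> R[i]) (rho M : R).
Hypothesis rho0 : 0 < rho.
Hypothesis HG : forall x y, nc x < rho -> nc y < rho -> exists a b, tdiff G x y a b.
Hypothesis HM : forall x y, nc x < rho -> nc y < rho -> nc (G x y) <= M.

Let r := rho / 2.
Let r0 : 0 < r. Proof. by rewrite divr_gt0. Qed.
Let rr : r < rho. Proof. by rewrite /r; move: rho0; lra. Qed.
Let M0 : 0 <= M.
Proof. by apply: le_trans (HM (x := 0) (y := 0) _ _); rewrite ?nc0 ?nc_ge0. Qed.

Lemma slice_y x : nc x < rho -> exists c, expands (G x) c r M.
Proof.
move=> xr; apply: (power_series r0 rr).
  by move=> z zr; have [a [b h]] := HG xr zr; exists b; exact: tdiff_y h.
by move=> z zr; apply: HM => //; rewrite zr.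
Qed.

Lemma ycoefs : exists e, forall x, nc x < rho -> expands (G x) (e x) r M.
Proof.
have h x : exists c, nc x < rho -> expands (G x) c r M.
  have [xr|_] := boolP (nc x < rho); last by exists (fun=> 0).
  by have [c hc] := slice_y xr; exists c.
by exists (fun x => projT1 (cid (h x))) => x; exact: (projT2 (cid (h x))).
Qed.

Definition quot (f : R[i] -> R[i]) x h := (f (x + h) - f x) / h.

(** The second order expansion in x makes the difference quotients converge
    at a rate that does not depend on y. *)
Lemma quot_lip x y h h' : nc x < r -> nc y < rho -> h != 0 -> h' != 0 ->
  nc h < r / 4 -> nc h' < r / 4 ->
  nc (quot (G ^~ y) x h - quot (G ^~ y) x h') <= 4 * M / (r / 2) ^+ 2 * (nc h + nc h').
Proof.
move=> xr yr h0 h'0 hr h'r.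
have r20 : 0 < r / 2 by rewrite divr_gt0.
have r2r : r / 2 < r by move: r0; lra.
have in_rho u : nc u < r -> nc (x + u) < rho.
  by move=> ur; apply: le_lt_trans (ncD _ _) _; rewrite /r in ur xr; lra.
have [||c hc] := @power_series R (fun u => G (x + u) y) (r / 2) r M r20 r2r.
- move=> z zr; have [a [b hab]] := HG (in_rho _ zr) yr.
  by exists a; apply: (@cdiff_shift (G ^~ y)); exact: tdiff_x hab.
- by move=> z zr; apply: HM => //; apply: in_rho; rewrite zr.
have c0 : c 0%N = G x y.
  have := hc.2 0 1%N; rewrite nc0 mul0r expr1 mulr0 => /(_ _).
  rewrite big_ord1 expr0 mulr1 addr0 => H; apply/esym/eqP.
  by rewrite -subr_eq0 -nc_eq0 eq_le nc_ge0 H// divr_ge0// ltW.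
have key u : u != 0 -> nc u < r / 4 ->
    nc (quot (G ^~ y) x u - c 1%N) <= 4 * M / (r / 2) ^+ 2 * nc u.
  move=> u0 ur.
  have := hc.2 u 2%N; rewrite big_ord_recl big_ord1 expr0 mulr1 c0 expr1 => H.
  have -> : quot (G ^~ y) x u - c 1%N = (G (x + u) y - (G x y + c 1%N * u)) / u.
    by rewrite /quot; field.
  rewrite ncM ncV ler_pdivrMr ?nc_gt0//.
  apply: le_trans (H _) _; first by move: ur r0; lra.
  by rewrite expr_div_n; apply: le_of_eq; ring.
have -> : quot (G ^~ y) x h - quot (G ^~ y) x h' =
  (quot (G ^~ y) x h - c 1%N) - (quot (G ^~ y) x h' - c 1%N) by ring.
apply: le_trans (ncBle _ _) _; rewrite mulrDr; apply: lerD; exact: key.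
Qed.

(** The coefficients of the expansion in y are differentiable in x: by
    [expands_linear] their difference quotients are the coefficients of the
    difference quotients of G, to which [quot_lip] applies. *)
Lemma ycoef_cdiff (e : R[i] -> nat -> R[i]) j x :
  (forall x, nc x < rho -> expands (G x) (e x) r M) ->
  nc x < r -> exists l, cdiff (e ^~ j) x l.
Proof.
move=> he xr; have r40 : 0 < r / 4 by rewrite divr_gt0.
set C := 4 * M / (r / 2) ^+ 2.
have xrho : nc x < rho by exact: lt_trans xr rr.
have in_rho u : nc u < r / 4 -> nc (x + u) < rho.
  by move=> ur; apply: le_lt_trans (ncD _ _) _; rewrite /r in ur xr; move: rho0; lra.
have [|L hL] := @lipschitz_limit R (quot (e ^~ j) x) (2 * C / r ^+ j) (r / 4) r40.
  move=> h h' h0 h'0 hr h'r.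
  pose pt i := nth x [:: x + h; x + h'] i.
  pose al i : R[i] := nth 0 [:: h^-1; - h'^-1; h'^-1 - h^-1] i.
  have ptr i : nc (pt i) < rho.
    by case: i => [|[|[|i]]] //=; exact: in_rho.
  have [||d hd] := @power_series R
     (fun y => \sum_(i <- [:: 0; 1; 2]%N) al i * G (pt i) y) r rho (C * (nc h + nc h')) r0 rr.
  - move=> z zr.
    have hz i : exists b, cdiff (G (pt i)) z b.
      by have [a [b hab]] := HG (ptr i) zr; exists b; exact: tdiff_y hab.
    have [b0 h0b] := hz 0%N; have [b1 h1b] := hz 1%N; have [b2 h2b] := hz 2%N.
    exists (al 0%N * b0 + (al 1%N * b1 + al 2%N * b2)).
    have := cdiffD (cdiffZ (al 0%N) h0b) (cdiffD (cdiffZ (al 1%N) h1b) (cdiffZ (al 2%N) h2b)).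
    congr cdiff; apply/funext => t.
    by rewrite !big_cons big_nil addr0.
  - move=> z zr; rewrite !big_cons big_nil addr0 /al /pt /=.
    have := @quot_lip x z h h' xr _ h0 h'0 hr h'r; rewrite zr rr => /(_ isT).
    by congr (nc _ <= _); rewrite /quot; ring.
  have -> : quot (e ^~ j) x h - quot (e ^~ j) x h' = d j.
    rewrite (@expands_linear R _ [:: 0; 1; 2]%N al (fun i => G (pt i)) (fun i => e (pt i)) _ _ r M _ r0 _ hd).
    - by rewrite !big_cons big_nil addr0 /al /pt /quot /=; ring.
    - by move=> i; exact: he.
    - by [].
  by apply: le_trans (hd.1 j) _; apply: le_of_eq; ring.
exists L => ep ep0; pose K := 2 * (2 * C / r ^+ j).
have K0 : 0 <= K.
  have C0 : 0 <= C by apply: divr_ge0; [exact: mulr_ge0|rewrite exprn_ge0// ltW// divr_gt0].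
  have P0 : 0 <= r ^+ j by rewrite exprn_ge0// ltW.
  by apply: mulr_ge0 => //; apply: divr_ge0 => //; exact: mulr_ge0.
have K1 : 0 < K + 1 by rewrite ltr_wpDl.
exists (Num.min (r / 4) (ep / (K + 1))) => [|u]; first by rewrite lt_min r40 divr_gt0.
rewrite lt_min => /andP[u4 ue].
have [->|u0] := eqVneq u 0.
  by rewrite addr0 mulr0 subrr subr0 nc0 mulr0.
have := hL u u0 u4.
have -> : e (x + u) j - e x j - L * u = (quot (e ^~ j) x u - L) * u.
  by rewrite /quot; field.
rewrite ncM -/K => H; rewrite ler_wpM2r ?nc_ge0//; apply: (le_trans H).
move: ue; rewrite ltr_pdivlMr// => /ltW; apply: le_trans.
by rewrite mulrC ler_wpM2l ?nc_ge0// lerDl.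
Qed.

(** Expansion of G in y, then of its coefficients in x.  The second clause
    follows from the geometric decay of both remainders. *)
Theorem double_series : exists (c : nat -> nat -> R[i]),
  (forall n, exists K : R, forall x y, nc x <= rho / 8 -> nc y <= rho / 8 ->
     nc (G x y - tpoly c n x y) <= K * Num.max (nc x) (nc y) ^+ n) /\
  ((forall j k, c j k = 0) -> forall x y, nc x <= rho / 8 -> nc y <= rho / 8 -> G x y = 0).
Proof.
have [e he] := ycoefs.
have r20 : 0 < r / 2 by rewrite divr_gt0.
have r2r : r / 2 < r by move: r0; lra.
have hc' j : exists c, expands (e ^~ j) c (r / 2) (2 * M / r ^+ j).
  apply: (power_series r20 r2r) => [z zr|z zr]; first exact: ycoef_cdiff he zr.
  have zr' : nc z < rho by rewrite zr; move: rr r2r; lra.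
  exact: (he z zr').1.
have [c hc] : exists c : nat -> nat -> R[i],
    forall j, expands (e ^~ j) (c j) (r / 2) (2 * M / r ^+ j).
  by exists (fun j => projT1 (cid (hc' j))) => j; exact: (projT2 (cid (hc' j))).
have conv x : nc x <= rho / 8 -> nc x < rho /\ nc x <= r / 2 / 2 /\ nc x <= r / 2.
  by rewrite /r; have := nc_ge0 x; move: rho0; lra.
exists c; split.
  move=> n; exists (4 * M / r ^+ n +
    \sum_(j < n) 4 * (2 * M / r ^+ j) / (r / 2) ^+ (n - j)) => x y hx hy.
  have [x1 [x2 x3]] := conv x hx; have [y1 [y2 y3]] := conv y hy.
  set m := Num.max (nc x) (nc y).
  have xm : nc x <= m by rewrite le_max lexx.
  have ym : nc y <= m by rewrite le_max lexx orbT.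
  have m0 : 0 <= m := le_trans (nc_ge0 x) xm.
  have -> : G x y - tpoly c n x y = (G x y - \sum_(j < n) e x j * y ^+ j)
      + \sum_(j < n) (e x j - \sum_(k < n - j) c j k * x ^+ k) * y ^+ j.
    have -> : \sum_(j < n) (e x j - \sum_(k < n - j) c j k * x ^+ k) * y ^+ j =
        \sum_(j < n) e x j * y ^+ j - tpoly c n x y.
      by under eq_bigr do rewrite mulrBl; rewrite sumrB.
    by rewrite addrA subrK.
  apply: le_trans (ncD _ _) _; rewrite mulrDl; apply: lerD.
    have [_ H] := he x x1; apply: le_trans (H y n y3) _.
    rewrite expr_div_n mulrA mulrAC; apply: ler_pM => //.
    - by rewrite divr_ge0 ?mulr_ge0// ?exprn_ge0// ltW.
    - by rewrite exprn_ge0 ?nc_ge0.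
    - by rewrite lerXn2r// ?nnegrE ?nc_ge0.
  apply: le_trans (nc_sum _ _ _) _; rewrite mulr_suml; apply: ler_sum => j _.
  have jn : (j <= n)%N by exact: ltnW.
  have [_ H] := hc j; rewrite ncM ncX.
  apply: (@le_trans _ _ (4 * (2 * M / r ^+ j) * (nc x / (r / 2)) ^+ (n - j) * nc y ^+ j)).
    by rewrite ler_wpM2r ?exprn_ge0 ?nc_ge0//; exact: H.
  have A0 : 0 <= 4 * (2 * M / r ^+ j).
    by rewrite mulr_ge0// divr_ge0 ?mulr_ge0// ?exprn_ge0// ltW.
  have B0 : 0 <= ((r / 2) ^+ (n - j))^-1 by rewrite invr_ge0 exprn_ge0// ltW.
  have mE : m ^+ n = m ^+ (n - j) * m ^+ j by rewrite -exprD subnK.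
  have -> : 4 * (2 * M / r ^+ j) * (nc x / (r / 2)) ^+ (n - j) * nc y ^+ j =
     4 * (2 * M / r ^+ j) * ((r / 2) ^+ (n - j))^-1 * (nc x ^+ (n - j) * nc y ^+ j).
    by rewrite [(nc x / _) ^+ _]expr_div_n; ring.
  rewrite mE.
  apply: ler_wpM2l; first exact: mulr_ge0.
  apply: ler_pM; rewrite ?exprn_ge0 ?nc_ge0//.
    by rewrite lerXn2r// ?nnegrE ?nc_ge0.
  by rewrite lerXn2r// ?nnegrE ?nc_ge0.
move=> c0 x y hx hy.
have [x1 [x2 x3]] := conv x hx; have [y1 [y2 y3]] := conv y hy.
have vanish (z : R[i]) (A q : R) : 0 <= A -> 0 <= q -> q <= 1 / 2 ->
    (forall n, nc z <= A * q ^+ n) -> z = 0.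
  move=> A0 q0 q2 h; apply: small_eq0 => ep ep0.
  have [n hn] := div_pow2_lt A ep0; apply: le_trans (ltW hn).
  apply: le_trans (h n) _; apply: ler_wpM2l => //.
  by rewrite -exprVn lerXn2r ?nnegrE//; lra.
have e0 j : e x j = 0.
  have [_ H] := hc j; apply: (vanish _ (4 * (2 * M / r ^+ j)) (nc x / (r / 2))).
  - by rewrite mulr_ge0// divr_ge0 ?mulr_ge0// ?exprn_ge0// ltW.
  - by rewrite divr_ge0 ?nc_ge0// ltW.
  - by rewrite ler_pdivrMr//; move: x2; lra.
  - move=> n; have := H x n x2; rewrite big1 ?subr0// => k _.
    by rewrite c0 mul0r.
have [_ H] := he x x1; apply: (vanish _ (4 * M) (nc y / r)).
- by rewrite mulr_ge0.
- by rewrite divr_ge0 ?nc_ge0// ltW.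
- by rewrite ler_pdivrMr//; move: y3; lra.
- move=> n; have := H y n y3; rewrite big1 ?subr0// => k _.
  by rewrite e0 mul0r.
Qed.

End TwoVariables.

(** * Cauchy's estimate and Taylor series of partial derivatives *)
Section CauchyEstimate.
Variable R : realType.
Notation nc := (@Normc.normc R).


Lemma cauchy_estimate (f : R[i] -> R[i]) (r r1 B : R) l : 0 < r -> r < r1 ->
  (forall z, nc z < r1 -> exists l, cdiff f z l) ->
  (forall z, nc z = r -> nc (f z) <= B) -> cdiff f 0 l -> nc l <= 2 * B / r.
Proof.
move=> r0 rr1 fd fB fl.
have [c [cB ce]] := power_series r0 rr1 fd fB.
have c0 : c 0%N = f 0.
  have := ce 0 1%N; rewrite nc0 mul0r expr1 mulr0 => /(_ _).
  rewrite big_ord1 expr0 mulr1 => H; apply/esym/eqP.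
  by rewrite -subr_eq0 -nc_eq0 eq_le nc_ge0 H// divr_ge0// ltW.
suff -> : l = c 1%N by have := cB 1%N; rewrite expr1.
apply/eqP; rewrite -subr_eq0; apply/eqP/small_eq0 => e e0.
have e2 : 0 < e / 2 by rewrite divr_gt0.
have [d d0 hd] := fl _ e2.
set C := 4 * B / r ^+ 2.
have C0 : 0 < `|C| + 1 by rewrite ltr_wpDl.
pose x := Num.min (d / 2) (Num.min (r / 2) (e / 2 / (`|C| + 1))).
have x0 : 0 < x by rewrite !lt_min !divr_gt0.
have xd : x < d by apply: (@le_lt_trans _ _ (d / 2)); [rewrite ge_min lexx|lra].
have xr : x <= r / 2 by rewrite /x !ge_min lexx /= orbT.
have xe : x * (`|C| + 1) <= e / 2.
  by rewrite -ler_pdivlMr// /x !ge_min lexx !orbT.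
have xC : nc x%:C%C = x by rewrite nc_real gtr0_norm.
have xn0 : x%:C%C != 0 :> R[i] by rewrite -nc_gt0 xC.
have h1 := hd x%:C%C; rewrite xC add0r in h1.
have h2 := ce x%:C%C 2%N.
rewrite xC big_ord_recl big_ord1 expr0 mulr1 c0 expr1 /= in h2.
rewrite -(ler_pM2r x0) -{1}xC -ncM.
have -> : (l - c 1%N) * x%:C%C = (f x%:C%C - (f 0 + c (bump 0 0) * x%:C%C)) -
   (f x%:C%C - f 0 - l * x%:C%C) by rewrite /bump /=; ring.
apply: le_trans (ncBle _ _) _.
have := h1 xd; have := h2 xr.
have -> : 4 * B * (x / r) ^+ 2 = C * x * x by rewrite /C expr_div_n; ring.
have : C * x <= e / 2.
  apply: le_trans xe; rewrite mulrC ler_wpM2l ?ltW//.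
  by have := ler_norm C; lra.
move=> h3; have : C * x * x <= e / 2 * x by rewrite ler_wpM2r// ltW.
lra.
Qed.

Lemma cdiff_eq (f g : R[i] -> R[i]) z l : (forall x, f x = g x) -> cdiff f z l -> cdiff g z l.
Proof. by move=> fg; have -> : g = f by apply/funext => x. Qed.

Lemma cdiff_cst (a z : R[i]) : cdiff (fun=> a) z 0.
Proof.
move=> e e0; exists 1 => // u _.
by rewrite subrr mul0r subrr nc0 mulr_ge0 ?nc_ge0 ?ltW.
Qed.

Lemma cdiff_mulX (f : R[i] -> R[i]) z l : cdiff f z l ->
  cdiff (fun x => x * f x) z (f z + z * l).
Proof.
move=> hf e e0.
have K0 : 0 < nc z + 1 by rewrite ltr_wpDl ?nc_ge0.
have L0 : 0 < nc l + 1 by rewrite ltr_wpDl ?nc_ge0.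
have [|d d0 hd] := hf (e / 2 / (nc z + 1)); first by rewrite !divr_gt0.
exists (Num.min 1 (Num.min d (e / 2 / (nc l + 1)))).
  by rewrite !lt_min ltr01 d0 !divr_gt0.
move=> u; rewrite !lt_min => /and3P[u1 ud ue].
have -> : (z + u) * f (z + u) - z * f z - (f z + z * l) * u =
  (z + u) * (f (z + u) - f z - l * u) + l * u * u by ring.
apply: le_trans (ncD _ _) _; rewrite !ncM.
have -> : e * nc u = (nc z + 1) * (e / 2 / (nc z + 1) * nc u) + e / 2 * nc u.
  by field; rewrite gt_eqF.
apply: lerD.
  apply: ler_pM; rewrite ?nc_ge0//; last exact: hd.
  by apply: le_trans (ncD _ _) _; rewrite lerD2l ltW.
rewrite ler_wpM2r ?nc_ge0//; move: ue; rewrite ltr_pdivlMr// => /ltW; apply: le_trans.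
by rewrite mulrC ler_wpM2l ?nc_ge0// lerDl.
Qed.

Lemma cdiff_exp k z : cdiff (fun x : R[i] => x ^+ k) z (k%:R * z ^+ k.-1).
Proof.
elim: k => [|k IH]; first by rewrite mul0r; exact: cdiff_cst.
apply: (cdiff_eq (f := fun x => x * x ^+ k)) => [x|]; first by rewrite exprS.
have := cdiff_mulX IH; congr cdiff.
case: k {IH} => [|k]; first by rewrite expr0 mul0r mulr0 addr0 mul1r.
by rewrite /= mulrCA -exprS -[in RHS]nat1r mulrDl mul1r.
Qed.

Lemma cdiff_sum n (f : nat -> R[i] -> R[i]) (l : nat -> R[i]) z :
  (forall k, cdiff (f k) z (l k)) ->
  cdiff (fun x => \sum_(k < n) f k x) z (\sum_(k < n) l k).
Proof.
move=> h; elim: n => [|n IH].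
  rewrite big_ord0; apply: (cdiff_eq (f := fun=> 0)); last exact: cdiff_cst.
  by move=> x; rewrite big_ord0.
rewrite big_ord_recr; apply: (cdiff_eq (f := fun x => \sum_(k < n) f k x + f n x)).
  by move=> x; rewrite big_ord_recr.
exact: cdiffD.
Qed.

Definition tpoly_x (c : nat -> nat -> R[i]) n (x y : R[i]) : R[i] :=
  \sum_(j < n) (\sum_(k < n - j) c j k * (k%:R * x ^+ k.-1)) * y ^+ j.

Definition tpoly_y (c : nat -> nat -> R[i]) n (x y : R[i]) : R[i] :=
  \sum_(j < n) (\sum_(k < n - j) c j k * x ^+ k) * (j%:R * y ^+ j.-1).

Lemma cdiff_tpoly_x c n x y : cdiff (tpoly c n ^~ y) x (tpoly_x c n x y).
Proof.
apply: (@cdiff_sum n (fun j x => (\sum_(k < n - j) c j k * x ^+ k) * y ^+ j)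
  (fun j => (\sum_(k < n - j) c j k * (k%:R * x ^+ k.-1)) * y ^+ j)) => j.
rewrite mulrC; apply: (cdiff_eq (f := fun x => y ^+ j * \sum_(k < n - j) c j k * x ^+ k)).
  by move=> z; rewrite mulrC.
apply: cdiffZ; apply: (@cdiff_sum _ (fun k x => c j k * x ^+ k) (fun k => c j k * (k%:R * x ^+ k.-1))) => k.
exact/cdiffZ/cdiff_exp.
Qed.

Lemma cdiff_tpoly_y c n x y : cdiff (tpoly c n x) y (tpoly_y c n x y).
Proof.
apply: (@cdiff_sum n (fun j y => (\sum_(k < n - j) c j k * x ^+ k) * y ^+ j)
  (fun j => (\sum_(k < n - j) c j k * x ^+ k) * (j%:R * y ^+ j.-1))) => j.
exact/cdiffZ/cdiff_exp.
Qed.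

(** Cauchy's estimate on the disc around x whose radius m is the maximum of
    |x| and |y|: H is there of size (2 m)^(n+2).  At the origin
    itself, small discs are used instead. *)
Lemma order_partial (H : R[i] -> R[i] -> R[i]) (rho K : R) n : 0 < rho -> 
  (forall x y, nc x < rho -> nc y < rho -> exists l, cdiff (H ^~ y) x l) ->
  (forall x y, nc x < rho -> nc y < rho ->
     nc (H x y) <= K * Num.max (nc x) (nc y) ^+ n.+2) ->
  exists K', forall x y l, nc x < rho / 4 -> nc y < rho / 4 -> cdiff (H ^~ y) x l ->
     nc l <= K' * Num.max (nc x) (nc y) ^+ n.+1.
Proof.
move=> rho0 Hd HK; exists (2 * K * 2 ^+ n.+2) => x y l xr yr hl.
set m := Num.max (nc x) (nc y).
have xm : nc x <= m by rewrite le_max lexx.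
have ym : nc y <= m by rewrite le_max lexx orbT.
have m0 : 0 <= m := le_trans (nc_ge0 x) xm.
have m4 : m < rho / 4 by rewrite gt_max xr.
have K0 : 0 <= K.
  have rr : 0 < rho / 2 by rewrite divr_gt0.
  have rc : nc (rho / 2)%:C%C = rho / 2 by rewrite nc_real gtr0_norm.
  have rl : rho / 2 < rho by move: rho0; lra.
  have := HK (rho / 2)%:C%C 0; rewrite nc0 rc (max_l (ltW rr)) => /(_ rl rho0) h.
  by have := le_trans (nc_ge0 _) h; rewrite (pmulr_lge0 _ (exprn_gt0 _ rr)).
have P0 : 0 <= 2 * K * 2 ^+ n.+2.
  by apply: mulr_ge0; [exact: mulr_ge0|exact: exprn_ge0].
have est (s : R) : 0 < s -> s < rho / 2 -> m <= s ->
    nc l <= 2 * K * 2 ^+ n.+2 * s ^+ n.+1.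
  move=> s0 sr ms.
  have dom z : nc z < rho / 2 -> nc (x + z) < rho.
    by move=> zr; apply: le_lt_trans (ncD _ _) _; move: xr zr; lra.
  have := @cauchy_estimate (fun z => H (x + z) y) s (rho / 2) (K * (2 * s) ^+ n.+2) l s0 sr.
  have -> : 2 * (K * (2 * s) ^+ n.+2) / s = 2 * K * 2 ^+ n.+2 * s ^+ n.+1.
    rewrite exprMn (exprSr s n.+1); move: (2 ^+ _) (s ^+ _) => p q.
    by field; rewrite gt_eqF.
  apply.
  - move=> z zr; have [|a ha] := Hd (x + z) y (dom _ zr); first by move: yr; lra.
    by exists a; apply: (@cdiff_shift _ (H ^~ y)).
  - move=> z zs; apply: le_trans (HK _ _ _ _) _; [by apply: dom; rewrite zs|by move: yr; lra|].
    rewrite ler_wpM2l// lerXn2r// ?nnegrE ?le_max ?nc_ge0//.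
      by rewrite mulr_ge0// ltW.
    rewrite ge_max; apply/andP; split; last by move: ym ms; lra.
    by apply: le_trans (ncD _ _) _; rewrite zs; move: xm ms; lra.
  - by apply: (@cdiff_shift _ (H ^~ y)); rewrite addr0.
have [mpos|] := ltP 0 m; first by apply: est => //; lra.
move=> mle; have mE : m = 0 by apply/eqP; rewrite eq_le mle.
suff -> : l = 0 by rewrite nc0; apply: mulr_ge0 => //; exact: exprn_ge0.
apply: (@le_linear_eq0 _ _ (2 * K * 2 ^+ n.+2) (Num.min 1 (rho / 4))).
  by rewrite lt_min ltr01 divr_gt0.
move=> w w0; rewrite le_min => /andP[w1 wr].
apply: le_trans (est (nc w) _ _ _) _; [by rewrite nc_gt0|by move: wr rho0; lra|by rewrite mE nc_ge0|].
rewrite ler_wpM2l//.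
by rewrite exprS ler_piMr ?nc_ge0// exprn_ile1// nc_ge0.
Qed.

End CauchyEstimate.

Section Jets.
Variable R : realType.
Notation nc := (@Normc.normc R).

Definition D1 (F : C2 R -> C1 R) (q : C2 R) : C1 R := 'd F q (1, 0).
Definition D2 (F : C2 R -> C1 R) (q : C2 R) : C1 R := 'd F q (0, 1).

Lemma diffE12 (F : C2 R -> C1 R) (q : C2 R) (u v : R[i]) :
  'd F q (u, v) = D1 F q * u + D2 F q * v.
Proof.
have -> : (u, v) = u *: ((1, 0) : C2 R) + v *: ((0, 1) : C2 R).
  by congr pair; rewrite /= /GRing.scale /= mulr1 mulr0 ?addr0 ?add0r.
rewrite linearD !linearZ /= /D1 /D2 /GRing.scale /=.
by rewrite [u * _]mulrC [v * _]mulrC.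
Qed.

Lemma diff_tdiff (F : C2 R -> C1 R) (p : C2 R) : differentiable F p ->
  tdiff (fun x y => F (x, y)) p.1 p.2 (D1 F p) (D2 F p).
Proof.
move=> dF e e0; have [d d0 hd] := diffC2P dF e0; exists d => // u v ud vd.
by have := hd u v ud vd; rewrite diffE12; case: (p).
Qed.

Lemma tdiff_diff (F : C2 R -> C1 R) (p : C2 R) a b :
  tdiff (fun x y => F (x, y)) p.1 p.2 a b ->
  [/\ differentiable F p, D1 F p = a & D2 F p = b].
Proof.
move=> h.
have [|dF dE] := @diffC2I R F p a b.
  move=> e e0; have [d d0 hd] := h e e0; exists d => // u v ud vd.
  by have := hd u v ud vd; case: (p).
split => //; rewrite ?/D1 ?/D2 dE.
  by rewrite mulr1 mulr0 addr0.
by rewrite mulr1 mulr0 add0r.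
Qed.

Lemma tdiff_shift (G : R[i] -> R[i] -> R[i]) x y u v a b :
  tdiff G (x + u) (y + v) a b -> tdiff (fun u v => G (x + u) (y + v)) u v a b.
Proof.
move=> h e e0; have [d d0 hd] := h e e0; exists d => // s t sd td.
by rewrite !addrA; exact: hd.
Qed.

(** For the same truncation the remainders of the partial derivatives are one
    order weaker than those of F.  The last clause is the identity theorem. *)
Record taylor_at (F : C2 R -> C1 R) (p : C2 R) (c : nat -> nat -> R[i]) (d : R) :
  Prop := TaylorAt {
  taylor_gt0 : 0 < d;
  taylor_fun : forall n, exists K : R, forall x y, nc x < d -> nc y < d ->
    nc (F (p.1 + x, p.2 + y) - tpoly c n x y) <= K * Num.max (nc x) (nc y) ^+ n;
  taylor_D1 : forall n, exists K : R, forall x y, nc x < d -> nc y < d ->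
    nc (D1 F (p.1 + x, p.2 + y) - tpoly_x c n.+2 x y)
      <= K * Num.max (nc x) (nc y) ^+ n.+1;
  taylor_D2 : forall n, exists K : R, forall x y, nc x < d -> nc y < d ->
    nc (D2 F (p.1 + x, p.2 + y) - tpoly_y c n.+2 x y)
      <= K * Num.max (nc x) (nc y) ^+ n.+1;
  taylor_inj : (forall j k, c j k = 0) -> forall x y, nc x < d -> nc y < d ->
    F (p.1 + x, p.2 + y) = 0 }.

Theorem taylor_exists (F : C2 R -> C1 R) (p : C2 R) :
  (\forall q \near p, differentiable F q) -> exists c d, taylor_at F p c d.
Proof.
move=> hF.
have Fc : {for p, continuous F}.
  by apply: differentiable_continuous; exact: nbhs_singleton hF.
have hb : \forall q \near p, nc (F q) <= nc (F p) + 1.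
  have hP : nbhs (F p) (fun z => nc (z - F p) < 1) by apply/nearC; exists 1.
  have H : nbhs p (fun q => nc (F q - F p) < 1) := Fc _ hP.
  apply: filterS H => q hq.
  by rewrite -[X in nc X](subrK (F p)); apply: le_trans (ncD _ _) _; rewrite addrC lerD2l ltW.
have [rho rho0 hrho] := (nearC2 _ _).1 (filterI hF hb).
set M := nc (F p) + 1 in hrho.
pose G x y := F (p.1 + x, p.2 + y).
have hd x y : nc x < rho -> nc y < rho -> tdiff G x y (D1 F (p.1 + x, p.2 + y)) (D2 F (p.1 + x, p.2 + y)).
  move=> xr yr; apply: (@tdiff_shift (fun x y => F (x, y))).
  apply: (@diff_tdiff F (p.1 + x, p.2 + y)).
  by have [] := hrho (p.1 + x) (p.2 + y); rewrite // addrC addKr.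
have hM x y : nc x < rho -> nc y < rho -> nc (G x y) <= M.
  move=> xr yr.
  by have [] := hrho (p.1 + x) (p.2 + y); rewrite // addrC addKr.
have [|c [c1 c2]] := @double_series R G rho M rho0 _ hM.
  by move=> x y xr yr; exists (D1 F (p.1 + x, p.2 + y)), (D2 F (p.1 + x, p.2 + y)); exact: hd.
have rho8 : 0 < rho / 8 by rewrite divr_gt0.
have lt8 x : nc x < rho / 8 -> nc x < rho by move: rho0; lra.
exists c, (rho / 8 / 4); split.
- by rewrite divr_gt0.
- move=> n; have [K hK] := c1 n; exists K => x y xr yr.
  by apply: hK; move: xr yr rho0; lra.
- move=> n; have [K hK] := c1 n.+2.
  have [||K' hK'] := @order_partial R (fun x y => G x y - tpoly c n.+2 x y) (rho / 8) K n rho8.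
  + move=> x y xr yr.
    have h1 := cdiffD (tdiff_x (hd x y (lt8 _ xr) (lt8 _ yr))) (cdiffZ (-1) (@cdiff_tpoly_x R c n.+2 x y)).
    eexists; apply: cdiff_eq h1 => z; by rewrite mulN1r.
  + by move=> x y xr yr; apply: hK; rewrite ltW.
  exists K' => x y xr yr; apply: hK' => //.
  have x8 : nc x < rho / 8 by move: xr rho0; lra.
  have y8 : nc y < rho / 8 by move: yr rho0; lra.
  have h1 := cdiffD (tdiff_x (hd x y (lt8 _ x8) (lt8 _ y8))) (cdiffZ (-1) (@cdiff_tpoly_x R c n.+2 x y)).
  rewrite -[- tpoly_x _ _ _ _]mulN1r; apply: cdiff_eq h1 => z; by rewrite mulN1r.
- move=> n; have [K hK] := c1 n.+2.
  have [||K' hK'] := @order_partial R (fun y x => G x y - tpoly c n.+2 x y) (rho / 8) K n rho8.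
  + move=> y x yr xr.
    have h1 := cdiffD (tdiff_y (hd x y (lt8 _ xr) (lt8 _ yr))) (cdiffZ (-1) (@cdiff_tpoly_y R c n.+2 x y)).
    eexists; apply: cdiff_eq h1 => z; by rewrite mulN1r.
  + by move=> y x yr xr; rewrite maxC; apply: hK; rewrite ltW.
  exists K' => x y xr yr; rewrite maxC; apply: hK' => //.
  have x8 : nc x < rho / 8 by move: xr rho0; lra.
  have y8 : nc y < rho / 8 by move: yr rho0; lra.
  have h1 := cdiffD (tdiff_y (hd x y (lt8 _ x8) (lt8 _ y8))) (cdiffZ (-1) (@cdiff_tpoly_y R c n.+2 x y)).
  rewrite -[- tpoly_y _ _ _ _]mulN1r; apply: cdiff_eq h1 => z; by rewrite mulN1r.
- by move=> h x y xr yr; apply: c2 => //; move: xr yr rho0; lra.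
Qed.


Lemma tdiff_quadratic (G : R[i] -> R[i] -> R[i]) (g0 a b : R[i]) (K d : R) : 0 < d ->
  (forall x y, nc x < d -> nc y < d ->
     nc (G x y - (g0 + a * x + b * y)) <= K * Num.max (nc x) (nc y) ^+ 2) ->
  tdiff G 0 0 a b.
Proof.
move=> d0 h e e0.
have g00 : G 0 0 = g0.
  have := h 0 0; rewrite nc0 => /(_ d0 d0).
  rewrite !mulr0 !addr0 max_l// expr0n mulr0 => H; apply/eqP.
  by rewrite -subr_eq0 -nc_eq0 eq_le H nc_ge0.
have K0 : 0 < `|K| + 1 by rewrite ltr_wpDl.
exists (Num.min d (e / (`|K| + 1))) => [|u v]; first by rewrite lt_min d0 divr_gt0.
rewrite !lt_min => /andP[ud ue] /andP[vd ve].
rewrite !add0r g00.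
have -> : G u v - g0 - (a * u + b * v) = G u v - (g0 + a * u + b * v) by ring.
apply: le_trans (h u v ud vd) _.
set m := Num.max (nc u) (nc v).
have m0 : 0 <= m by rewrite le_max nc_ge0.
have me : m * (`|K| + 1) <= e.
  by rewrite -ler_pdivlMr// ge_max !ltW.
rewrite expr2 mulrA ler_wpM2r//; apply: le_trans me.
by rewrite mulrC ler_wpM2l//; have := ler_norm K; lra.
Qed.

(** A function with a first order expansion up to a quadratic error is
    differentiable; for both partial derivatives that expansion comes from the
    second order Taylor polynomial, whose coefficient of x y gives the two
    mixed derivatives. *)
Theorem holo_partial (F : C2 R -> C1 R) (p : C2 R) :
  (\forall q \near p, differentiable F q) ->
  [/\ differentiable (D1 F) p, differentiable (D2 F) p & D2 (D1 F) p = D1 (D2 F) p].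
Proof.
move=> /taylor_exists [c [d hc]]; have d0 := taylor_gt0 hc.
have [K1 h1] := taylor_D1 hc 1%N.
have [K2 h2] := taylor_D2 hc 1%N.
have shift0 (G : C2 R -> C1 R) a b : tdiff (fun u v => G (p.1 + u, p.2 + v)) 0 0 a b ->
    tdiff (fun x y => G (x, y)) p.1 p.2 a b.
  move=> h e e0; have [d' d'0 hd] := h e e0; exists d' => // u v ud vd.
  by have := hd u v ud vd; rewrite !add0r !addr0.
have t1 : tdiff (fun x y => D1 F (x, y)) p.1 p.2 (2 * c 0%N 2%N) (c 1%N 1%N).
  apply/shift0/(@tdiff_quadratic _ (c 0%N 1%N) _ _ K1 d d0) => x y xd yd.
  have := h1 x y xd yd; congr (nc (_ - _) <= _).
  rewrite /tpoly_x 3!big_ord_recr big_ord0 /= subn0.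
  rewrite (_ : (3 - 1)%N = 2%N)// (_ : (3 - 2)%N = 1%N)//.
  rewrite !(big_ord_recr, big_ord0) /=; ring.
have t2 : tdiff (fun x y => D2 F (x, y)) p.1 p.2 (c 1%N 1%N) (2 * c 2%N 0%N).
  apply/shift0/(@tdiff_quadratic _ (c 1%N 0%N) _ _ K2 d d0) => x y xd yd.
  have := h2 x y xd yd; congr (nc (_ - _) <= _).
  rewrite /tpoly_y 3!big_ord_recr big_ord0 /= subn0.
  rewrite (_ : (3 - 1)%N = 2%N)// (_ : (3 - 2)%N = 1%N)//.
  rewrite !(big_ord_recr, big_ord0) /=; ring.
have [dD1 _ E1] := tdiff_diff t1; have [dD2 E2 _] := tdiff_diff t2.
by split => //; rewrite E1 E2.
Qed.

End Jets.

(** * A linear differential equation without rational solutions *)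
Section Riccati.
Variable K : numClosedFieldType.
Implicit Types (a b q : {poly K}) (c : K).

(** For w = b / a the hypothesis is mu w' = lam w + c, and m + 1 is the order
    of the pole of w at t: compare the coefficients of (X - t)^(- m - 2), then
    of (X - t)^(- m - 1). *)
Lemma pole_relation (lam mu q b : {poly K}) c (t : K) m :
  let a := q * ('X - t%:P) ^+ m.+1 in
  mu * (b^`() * a - a^`() * b) = lam * a * b + c *: a ^+ 2 ->
  q.[t] != 0 -> b.[t] != 0 ->
  root mu t /\ lam.[t] + m.+1%:R * mu^`().[t] = 0.
Proof.
move=> a; set P : {poly K} := 'X - t%:P in a *.
have P0 : P != 0 by rewrite polyXsubC_eq0.
have Pt : P.[t] = 0 by rewrite !hornerE subrr.
have aE : a = P ^+ m * (q * P) by rewrite /a exprS; ring.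
have da : a^`() = P ^+ m * (q^`() * P + m.+1%:R * q).
  rewrite /a derivM deriv_exp /= derivXsubC mul1r exprS mulrnAr -mulr_natl; ring.
have a2 : c *: a ^+ 2 = P ^+ m * (c *: (q ^+ 2 * P ^+ m.+2)).
  by rewrite -scalerAr aE !exprS; congr (_ *: _); ring.
rewrite a2 da aE => H qt bt.
have H1 : mu * (b^`() * (q * P) - (q^`() * P + m.+1%:R * q) * b) =
   lam * (q * P) * b + c *: (q ^+ 2 * P ^+ m.+2).
  move: H; set X := q * P; set Y := q^`() * P + _; set Z := c *: _; set Q := P ^+ m => H.
  apply: (@mulfI _ Q); first exact: expf_neq0.
  rewrite /=.
  have -> : Q * (mu * (b^`() * X - Y * b)) = mu * (b^`() * (Q * X) - Q * Y * b) by ring.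
  by rewrite H; ring.
have root_mu : root mu t.
  move: (congr1 (fun p => p.[t]) H1).
  rewrite !(hornerE, hornerZ, horner_exp) /= subrr !(mulr0, mul0r, add0r, exprS, addr0).
  move/eqP; rewrite mulf_eq0 => /orP[//|].
  rewrite oppr_eq0 !mulf_eq0 (negPf qt) (negPf bt) !orbF => /eqP.
  by rewrite hornerMn hornerC => /eqP; rewrite pnatr_eq0.
split => //; have /factor_theorem [mu1 mu1E] := root_mu.
have dmu : mu^`().[t] = mu1.[t].
  by rewrite mu1E derivM derivXsubC mulr1 hornerD hornerM Pt mulr0 add0r.
have H2 : mu1 * (b^`() * (q * P) - (q^`() * P + m.+1%:R * q) * b) =
   lam * q * b + c *: (q ^+ 2 * P ^+ m.+1).
  apply: (mulIf P0); rewrite [LHS]mulrAC -mu1E H1 mulrDl; congr (_ + _); first by ring.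
  by rewrite -scalerAl [P ^+ m.+2]exprSr mulrA.
move: (congr1 (fun p => p.[t]) H2).
rewrite !(hornerE, hornerZ, horner_exp) /= subrr !(mulr0, mul0r, add0r, exprS, addr0).
rewrite hornerMn hornerC => H3.
apply: (mulIf bt); apply: (mulIf qt); rewrite !mul0r dmu.
rewrite mulrDl mulrDl [lam.[t] * _ * _]mulrAC -H3; ring.
Qed.

(** Poles of w = b / a are excluded by [pole_relation]; then w is a polynomial
    and its leading term, of degree n, would give n m2 = l1. *)
Lemma no_rational_solution (lam mu : {poly K}) (m0 m1 m2 l0 l1 c : K) a b :
  mu = m2 *: 'X^2 + m1 *: 'X + m0%:P -> lam = l1 *: 'X + l0%:P ->
  (forall t m, root mu t -> lam.[t] + m.+1%:R * mu^`().[t] != 0) ->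
  (forall n, n%:R * m2 != l1) ->
  mu * (b^`() * a - a^`() * b) = lam * a * b + c *: a ^+ 2 ->
  a != 0 -> c = 0.
Proof.
move=> muE lamE Hroot Hinf H a0.
set g := gcdp a b.
have g0 : g != 0 by rewrite gcdp_eq0 negb_and a0.
have cop : coprimep (a %/ g) (b %/ g) by apply: coprimep_div_gcd; rewrite a0.
have aE : a = (a %/ g) * g by rewrite divpK// dvdp_gcdl.
have bE : b = (b %/ g) * g by rewrite divpK// dvdp_gcdr.
move: cop aE bE; move: (a %/ g) (b %/ g) => a1 b1 cop aE bE; clearbody g.
have H1 : mu * (b1^`() * a1 - a1^`() * b1) = lam * a1 * b1 + c *: a1 ^+ 2.
  apply: (@mulfI _ (g ^+ 2)); first by rewrite expf_neq0.
  transitivity (mu * (b^`() * a - a^`() * b)).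
    by rewrite aE bE !derivM; ring.
  by rewrite H mulrDr -scalerAr aE bE; congr (_ + _); [ring|congr (_ *: _); ring].
have a10 : a1 != 0 by apply: contraNneq a0; rewrite aE => ->; rewrite mul0r.
have [sa|/closed_rootP[t ta]] := eqVneq (size a1) 1%N; last first.
  exfalso; have [m [q]] := multiplicity_XsubC a1 t.
  rewrite a10 /= => qt a1E.
  have b1t : b1.[t] != 0.
    by apply: (coprimep_root cop).
  have mpos : (0 < m)%N.
    by rewrite lt0n; apply: contraNneq qt => m0'; move: ta; rewrite a1E m0' expr0 mulr1.
  move: a1E; rewrite -(prednK mpos) => a1E; rewrite a1E in H1.
  have [rt E] := pole_relation H1 qt b1t.
  by have := Hroot t m.-1 rt; rewrite E eqxx.
have /size_poly1P[al al0 a1E] : size a1 == 1%N by rewrite sa.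
move: H1; rewrite a1E derivC mul0r subr0 => H1.
have H2 : mu * b1^`() = lam * b1 + (c * al)%:P.
  apply: (@mulIf _ al%:P); first by rewrite polyC_eq0.
  by rewrite -mulrA H1 mulrDl -mul_polyC polyCM; ring.
have [b10|b10] := eqVneq b1 0.
  move: H2; rewrite b10 deriv0 !mulr0 add0r => /esym/eqP.
  by rewrite polyC_eq0 mulf_eq0 (negPf al0) orbF => /eqP.
exfalso; pose n := (size b1).-1.
have sb : size b1 = n.+1 by rewrite /n prednK// size_poly_gt0.
have big k : (n < k)%N -> b1`_k = 0 by move=> nk; rewrite nth_default// sb.
move: (congr1 (fun p : {poly K} => p`_n.+1) H2).
rewrite muE lamE !mulrDl !coefD coefC /= -!scalerAl !coefZ !mul_polyC !coefZ.
rewrite coefXnM coefXM coefXM /= !coef_deriv (big n.+1)// (big n.+2)//.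
rewrite !mulr0 !mul0rn !mulr0 !addr0.
case: ltnP => [n1|n1].
  have n0 : n = 0%N by move: n1; case: (n).
  rewrite n0 mulr0 => /esym/eqP.
  rewrite mulf_eq0 => /orP[/eqP l10|].
    by have := Hinf 0%N; rewrite mul0r l10 eqxx.
  by rewrite -lead_coef_eq0 lead_coefE -/n n0 in b10; rewrite (negPf b10).
have nE : (n.+1 - 2).+1 = n by move: n1; case: (n) => [//|k] _; rewrite !subSS subn0.
rewrite nE mulrnAr -mulrnAl -mulr_natl => /eqP.
rewrite -subr_eq0 -mulrBl mulf_eq0 subr_eq0 (negPf (Hinf n)) /=.
by rewrite -lead_coef_eq0 lead_coefE -/n in b10; rewrite (negPf b10).
Qed.

End Riccati.

(** * Asymptotic expansions along weighted rays *)
Section Asymptotics.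
Variable R : realType.
Notation nc := (@Normc.normc R).
Notation K := R[i].

(** Expansion of phi at 0 up to order n.  The point 0 is left out, since
    identities between pullbacks are divided by s. *)
Definition asym n (phi : K -> K) (c : nat -> K) := exists C d : R, 0 < d /\
  forall s, s != 0 -> nc s < d -> nc (phi s - \sum_(i < n) c i * s ^+ i) <= C * nc s ^+ n.

Lemma asym_uniq n phi psi c e : asym n phi c -> asym n psi e ->
  (exists2 d : R, 0 < d & forall s, s != 0 -> nc s < d -> phi s = psi s) ->
  forall i, (i < n)%N -> c i = e i.
Proof.
move=> [C [d [d0 h]]] [C' [d' [d'0 h']]] [d1 d10 hh] i ni.
apply/eqP; rewrite -subr_eq0; apply/eqP; move: i ni.
apply: (@poly_order_eq0 R n (fun i => c i - e i) (C + C') (Num.min d (Num.min d' d1) / 2)).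
  by rewrite divr_gt0// !lt_min d0 d'0.
move=> s s0 hs.
have m0 : 0 < Num.min d (Num.min d' d1) by rewrite !lt_min d0 d'0.
have : nc s < Num.min d (Num.min d' d1) by move: hs m0; lra.
rewrite !lt_min => /and3P[sd sd' sd1].
have -> : \sum_(k < n) (c k - e k) * s ^+ k =
    (psi s - \sum_(k < n) e k * s ^+ k) - (phi s - \sum_(k < n) c k * s ^+ k).
  under eq_bigr do rewrite mulrBl.
  by rewrite sumrB (hh s s0 sd1); ring.
apply: le_trans (ncBle _ _) _; rewrite mulrDl addrC.
by apply: lerD; [exact: h|exact: h'].
Qed.

Lemma asymD n phi psi c e : asym n phi c -> asym n psi e ->
  asym n (fun s => phi s + psi s) (fun i => c i + e i).
Proof.
move=> [C [d [d0 h]]] [C' [d' [d'0 h']]]; exists (C + C'), (Num.min d d').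
split; first by rewrite lt_min d0.
move=> s s0; rewrite lt_min => /andP[sd sd'].
have -> : phi s + psi s - \sum_(i < n) (c i + e i) * s ^+ i =
   (phi s - \sum_(i < n) c i * s ^+ i) + (psi s - \sum_(i < n) e i * s ^+ i).
  under eq_bigr do rewrite mulrDl.
  by rewrite big_split /=; ring.
apply: le_trans (ncD _ _) _; rewrite mulrDl.
by apply: lerD; [exact: h|exact: h'].
Qed.

Lemma asymZ n a phi c : asym n phi c -> asym n (fun s => a * phi s) (fun i => a * c i).
Proof.
move=> [C [d [d0 h]]]; exists (nc a * C), d; split=> // s s0 sd.
have -> : a * phi s - \sum_(i < n) a * c i * s ^+ i = a * (phi s - \sum_(i < n) c i * s ^+ i).
  by rewrite mulrBr mulr_sumr; congr (_ - _); apply: eq_bigr => i _; rewrite mulrA.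
by rewrite ncM -mulrA ler_wpM2l ?nc_ge0//; exact: h.
Qed.

Lemma asym_eq n phi psi c e : asym n phi c -> (forall s, s != 0 -> phi s = psi s) ->
  (forall i, (i < n)%N -> c i = e i) -> asym n psi e.
Proof.
move=> [C [d [d0 h]]] hp hc; exists C, d; split => // s s0 sd.
rewrite -hp//; under eq_bigr do rewrite -hc//.
exact: h.
Qed.

Lemma asym_mulX n phi c : asym n phi c ->
  asym n.+1 (fun s => s * phi s) (fun i => if i is j.+1 then c j else 0).
Proof.
move=> [C [d [d0 h]]]; exists C, d; split => // s s0 sd.
rewrite big_ord_recl mul0r add0r.
have -> : s * phi s - \sum_(i < n) c i * s ^+ (lift ord0 i) =
   s * (phi s - \sum_(i < n) c i * s ^+ i).
  rewrite mulrBr mulr_sumr; congr (_ - _); apply: eq_bigr => i _.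
  by rewrite lift0 exprS mulrCA.
by rewrite ncM exprS mulrCA ler_wpM2l ?nc_ge0//; exact: h.
Qed.

(** Weights dominate degrees, so a monomial of weight below n occurs in the
    triangular sum, whose other monomials are of order n. *)
Lemma asym_weight n p q (b : nat -> nat -> K) : (0 < p)%N -> (0 < q)%N ->
  asym n (fun s => \sum_(j < n) \sum_(k < n - j) b j k * s ^+ (p * k + q * j))
    (fun i => \sum_(j < i.+1) \sum_(k < i.+1 | (p * k + q * j == i)%N) b j k).
Proof.
move=> p0 q0.
pose S := \sum_(j < n) \sum_(k < n - j) nc (b j k).
exists S, 1; split => // s s0 /ltW s1.
pose T s : K := \sum_(j < n) \sum_(k < n | (p * k + q * j < n)%N) b j k * s ^+ (p * k + q * j).
have TE : \sum_(i < n) (\sum_(j < i.+1) \sum_(k < i.+1 | (p * k + q * j == i)%N) b j k) * s ^+ i = T s.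
  have E (i : 'I_n) : (\sum_(j < i.+1) \sum_(k < i.+1 | (p * k + q * j == i)%N) b j k) * s ^+ i
    = \sum_(j < n) \sum_(k < n | (p * k + q * j == i)%N) b j k * s ^+ i.
    rewrite mulr_suml (big_ord_widen n (fun j => (\sum_(k < i.+1 | (p * k + q * j == i)%N) b j k) * s ^+ i))//.
    rewrite big_mkcond /=; apply: eq_bigr => j _.
    have pk k : (k <= p * k)%N by rewrite leq_pmull.
    have qj : (j <= q * j)%N by rewrite leq_pmull.
    case: ltnP => ij.
      rewrite mulr_suml (big_ord_widen_cond n (fun k => (p * k + q * j == i)%N) (fun k => b j k * s ^+ i))//.
      apply: eq_bigl => k; case: eqP => //= <-.
      by rewrite ltnS (leq_trans (pk k))// leq_addr.
    rewrite big1// => k /eqP E; move: ij; rewrite -E ltnNge.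
    by rewrite (leq_trans qj)// leq_addl.
  rewrite (eq_bigr _ (fun i _ => E i)) exchange_big /=; apply: eq_bigr => j _.
  rewrite (exchange_big_dep (fun k : 'I_n => p * k + q * j < n)%N) /=.
    apply: eq_bigr => k hk; rewrite (big_pred1 (Ordinal hk))//.
  by move=> i k _ /eqP ->.
rewrite TE.
have -> : \sum_(j < n) \sum_(k < n - j) b j k * s ^+ (p * k + q * j) - T s =
   \sum_(j < n) \sum_(k < n - j | (n <= p * k + q * j)%N) b j k * s ^+ (p * k + q * j).
  rewrite /T -sumrB; apply: eq_bigr => j _.
  have -> : \sum_(k < n | (p * k + q * j < n)%N) b j k * s ^+ (p * k + q * j) =
     \sum_(k < n - j | (p * k + q * j < n)%N) b j k * s ^+ (p * k + q * j).
    rewrite [RHS](big_ord_widen_cond n (fun k => (p * k + q * j < n)%N) (fun k => b j k * s ^+ (p * k + q * j))) ?leq_subr//.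
    apply: eq_bigl => k; case: ltnP => //= h; apply/esym.
    rewrite ltn_subRL; apply: leq_ltn_trans h; rewrite addnC.
    by rewrite leq_add ?leq_pmull.
  rewrite (bigID (fun k : 'I_(n - j) => p * k + q * j < n)%N) /= addrAC subrr add0r.
  by apply: eq_bigl => k; rewrite -leqNgt.
apply: le_trans (nc_sum _ _ _) _; rewrite mulr_suml; apply: ler_sum => j _.
apply: le_trans (nc_sum _ _ _) _; rewrite mulr_suml.
rewrite [leRHS](bigID (fun k : 'I_(n - j) => n <= p * k + q * j)%N) /=.
rewrite -[leLHS]addr0; apply: lerD.
  apply: ler_sum => k hk; rewrite ncM ncX ler_wpM2l ?nc_ge0//.
  by rewrite ler_wiXn2l ?nc_ge0.
by rewrite sumr_ge0// => k _; rewrite mulr_ge0 ?exprn_ge0 ?nc_ge0.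
Qed.

Lemma asym_trunc n phi c : asym n.+1 phi c -> asym n phi c.
Proof.
move=> [C [d [d0 h]]]; exists (`|C| + nc (c n)), (Num.min 1 d).
split; first by rewrite lt_min ltr01.
move=> s s0; rewrite lt_min => /andP[/ltW s1 sd].
have := h s s0 sd; rewrite big_ord_recr /= => H.
have -> : phi s - \sum_(i < n) c i * s ^+ i =
  (phi s - (\sum_(i < n) c i * s ^+ i + c n * s ^+ n)) + c n * s ^+ n by ring.
apply: le_trans (ncD _ _) _; rewrite ncM ncX mulrDl lerD2r; apply: (le_trans H).
have sn : 0 <= nc s ^+ n by rewrite exprn_ge0 ?nc_ge0.
apply: (@le_trans _ _ (`|C| * nc s ^+ n.+1)).
  by rewrite ler_wpM2r ?exprn_ge0 ?nc_ge0// ler_norm.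
by rewrite ler_wpM2l// exprS ler_piMl.
Qed.

Lemma asym_pert n phi psi c : asym n phi c -> (exists C d : R, 0 < d /\
    forall s, s != 0 -> nc s < d -> nc (psi s - phi s) <= C * nc s ^+ n) ->
  asym n psi c.
Proof.
move=> [C [d [d0 h]]] [C' [d' [d'0 h']]]; exists (C' + C), (Num.min d d').
split; first by rewrite lt_min d0.
move=> s s0; rewrite lt_min => /andP[sd sd'].
have -> : psi s - \sum_(i < n) c i * s ^+ i =
  (psi s - phi s) + (phi s - \sum_(i < n) c i * s ^+ i) by ring.
by apply: le_trans (ncD _ _) _; rewrite mulrDl; apply: lerD; [exact: h'|exact: h].
Qed.

End Asymptotics.

Section Pullback.
Variable R : realType.
Notation nc := (@Normc.normc R).
Notation K := R[i].
Variables (p q : nat) (t : K).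
Hypotheses (p0 : (0 < p)%N) (q0 : (0 < q)%N).

(** The part of weight i of the series c, where x has weight p and y has
    weight q, restricted to x = 1. *)
Definition wpoly (c : nat -> nat -> K) i : {poly K} :=
  \poly_(j < i.+1) (\sum_(k < i.+1 | (p * k + q * j == i)%N) c j k).

Lemma coef_wpoly c j k : (wpoly c (p * k + q * j))`_j = c j k.
Proof.
have kk : (k < (p * k + q * j).+1)%N.
  by rewrite ltnS (leq_trans (leq_pmull k p0))// leq_addr.
rewrite coef_poly ltnS (leq_trans (leq_pmull j q0)) ?leq_addl//.
rewrite (big_pred1 (Ordinal kk))// => i /=.
by rewrite eqn_add2r eqn_pmul2l// -(inj_eq val_inj).
Qed.

Lemma horner_wpoly c i : (wpoly c i).[t] =
  \sum_(j < i.+1) \sum_(k < i.+1 | (p * k + q * j == i)%N) c j k * t ^+ j.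
Proof. by rewrite horner_poly; apply: eq_bigr => j _; rewrite mulr_suml. Qed.

Lemma horner_wpoly_deriv c i : (wpoly c i)^`().[t] =
  \sum_(j < i.+1) \sum_(k < i.+1 | (p * k + q * j == i)%N) c j k * (j%:R * t ^+ j.-1).
Proof.
rewrite /wpoly poly_def raddf_sum horner_sum /=; apply: eq_bigr => j _.
rewrite derivZ derivXn hornerZ hornerMn hornerXn mulr_suml.
by apply: eq_bigr => k _; rewrite -mulr_natl.
Qed.

(** Euler's identity in the chart x = 1: the operator p x d/dx multiplies
    monomials by p k, and is the total weight i minus q y d/dy. *)
Lemma horner_wpoly_euler c i : i%:R * (wpoly c i).[t] - q%:R * t * (wpoly c i)^`().[t] =
  p%:R * \sum_(j < i.+1) \sum_(k < i.+1 | (p * k + q * j == i)%N) k%:R * (c j k * t ^+ j).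
Proof.
rewrite horner_wpoly horner_wpoly_deriv !mulr_sumr -sumrB; apply: eq_bigr => j _.
rewrite !mulr_sumr -sumrB; apply: eq_bigr => k /eqP E.
have -> : i%:R = p%:R * k%:R + q%:R * j%:R :> K by rewrite -!natrM -natrD E.
case: (nat_of_ord j) => [|j'] /=; first by rewrite expr0 !(mul0r, mulr0); ring.
by rewrite exprS; ring.
Qed.

Let ray (s : K) : C2 R := (s ^+ p, s ^+ q * t).

Lemma pullback_max s : nc s <= 1 ->
  Num.max (nc (s ^+ p)) (nc (s ^+ q * t)) <= (1 + nc t) * nc s.
Proof.
move=> s1; have le k : (0 < k)%N -> nc s ^+ k <= nc s.
  by case: k => // k _; rewrite exprS ler_piMr ?nc_ge0// exprn_ile1// nc_ge0.
have ns := nc_ge0 s; have nt := nc_ge0 t.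
rewrite ge_max ncM !ncX mulrDl mul1r; apply/andP; split.
  by rewrite -[leLHS]addr0 lerD ?le// mulr_ge0.
by rewrite mulrC -[leLHS]add0r lerD// ler_wpM2l// le.
Qed.

Lemma pullback_small d : 0 < d -> exists2 d' : R, 0 < d' & forall s, nc s < d' ->
  [/\ nc s <= 1, nc (s ^+ p) < d & nc (s ^+ q * t) < d].
Proof.
move=> d0; have t1 : 0 < 1 + nc t by rewrite ltr_pwDl ?nc_ge0.
exists (Num.min 1 (d / (1 + nc t))); first by rewrite lt_min ltr01 divr_gt0.
move=> s; rewrite lt_min => /andP[/ltW s1]; rewrite ltr_pdivlMr// mulrC => sd.
have := le_lt_trans (pullback_max s1) sd; rewrite gt_max => /andP[h1 h2].
by split.
Qed.

Lemma pullback_pert n (phi psi : C2 R -> K) (C d : R) (m : K -> K) : 0 < d ->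
  (forall s, nc s <= 1 -> nc (m s) <= 1) ->
  (forall x y, nc x < d -> nc y < d ->
    nc (phi (x, y) - psi (x, y)) <= C * Num.max (nc x) (nc y) ^+ n) ->
  exists C' d' : R, 0 < d' /\ forall s, s != 0 -> nc s < d' ->
    nc (m s * phi (ray s) - m s * psi (ray s)) <= C' * nc s ^+ n.
Proof.
move=> d0 m1 h; have [d' d'0 hd] := pullback_small d0.
exists (`|C| * (1 + nc t) ^+ n), d'; split => // s s0 /hd[s1 h1 h2].
rewrite -mulrBr ncM; apply: (@le_trans _ _ (nc (phi (ray s) - psi (ray s)))).
  by rewrite ler_piMl ?nc_ge0// m1.
apply: le_trans (h _ _ h1 h2) _; rewrite -mulrA -exprMn.
set M := Num.max _ _.
have M0 : 0 <= M by rewrite le_max nc_ge0.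
apply: (@le_trans _ _ (`|C| * M ^+ n)).
  by rewrite ler_wpM2r ?exprn_ge0// ler_norm.
apply: ler_wpM2l => //; rewrite lerXn2r ?nnegrE//; last exact: pullback_max.
by rewrite mulr_ge0 ?nc_ge0// addr_ge0// nc_ge0.
Qed.

Variables (F : C2 R -> C1 R) (c : nat -> nat -> K) (d : R).
Hypothesis hc : taylor_at F 0 c d.

Lemma asym_fun n : asym n (fun s => F (ray s)) (fun i => (wpoly c i).[t]).
Proof.
have [C hC] := taylor_fun hc n.
apply: (@asym_pert _ _ (fun s => tpoly c n (s ^+ p) (s ^+ q * t))).
  apply: (asym_eq (asym_weight n (fun j k => c j k * t ^+ j) p0 q0)).
    move=> s _; apply: eq_bigr => j _; rewrite mulr_suml; apply: eq_bigr => k _.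
    by rewrite exprMn -!exprM exprD; ring.
  by move=> i _; rewrite horner_wpoly.
have [||C' [d' [d'0 hd]]] := @pullback_pert n F (fun z => tpoly c n z.1 z.2) C d (fun=> 1) (taylor_gt0 hc).
- by move=> s _; rewrite nc1.
- by move=> x y xd yd; have := hC x y xd yd; rewrite !add0r.
by exists C', d'; split => // s s0 sd; have := hd s s0 sd; rewrite !mul1r.
Qed.


Lemma asym_D1 n : asym n.+1 (fun s => p%:R * (s ^+ p * D1 F (ray s)))
  (fun i => i%:R * (wpoly c i).[t] - q%:R * t * (wpoly c i)^`().[t]).
Proof.
have [C hC] := taylor_D1 hc n.
pose b j k : K := k%:R * (c j k * t ^+ j).
apply: (@asym_eq _ _ (fun s => p%:R * (s ^+ p * D1 F (ray s))) _
  (fun i => p%:R * \sum_(j < i.+1) \sum_(k < i.+1 | (p * k + q * j == i)%N) b j k)) => //.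
  2: by move=> i _; rewrite horner_wpoly_euler.
apply: asymZ.
apply: (@asym_pert _ _ (fun s => s ^+ p * tpoly_x c n.+2 (s ^+ p) (s ^+ q * t))).
  apply: asym_trunc; apply: (asym_eq (asym_weight n.+2 b p0 q0)) => // s _.
  rewrite /tpoly_x mulr_sumr; apply: eq_bigr => j _.
  rewrite mulr_suml mulr_sumr; apply: eq_bigr => k _.
  rewrite /b; case: (nat_of_ord k) => [|k'] /=; first by rewrite !(mul0r, mulr0).
  by rewrite exprMn -!exprM exprD mulnS exprD; ring.
have [||C' [d' [d'0 hd]]] := @pullback_pert n.+1 (D1 F) (fun z => tpoly_x c n.+2 z.1 z.2) C d (fun s => s ^+ p) (taylor_gt0 hc).
- by move=> s s1; rewrite ncX exprn_ile1// nc_ge0.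
- by move=> x y xd yd; have := hC x y xd yd; rewrite !add0r.
by exists C', d'.
Qed.

Lemma asym_D2 n : asym n.+1 (fun s => s ^+ q * D2 F (ray s)) (fun i => (wpoly c i)^`().[t]).
Proof.
have [C hC] := taylor_D2 hc n.
pose b j k : K := c j k * (j%:R * t ^+ j.-1).
apply: (@asym_pert _ _ (fun s => s ^+ q * tpoly_y c n.+2 (s ^+ p) (s ^+ q * t))).
  apply: asym_trunc; apply: (asym_eq (asym_weight n.+2 b p0 q0)); last first.
    by move=> i _; rewrite horner_wpoly_deriv.
  move=> s _.
  rewrite /tpoly_y mulr_sumr; apply: eq_bigr => j _.
  rewrite mulr_suml mulr_sumr; apply: eq_bigr => k _.
  rewrite /b; move: (nat_of_ord k) => k0; case: (nat_of_ord j) => [|k'] /=; first by rewrite !(mul0r, mulr0).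
  by rewrite exprMn -!exprM exprD mulnS exprD; ring.
have [||C' [d' [d'0 hd]]] := @pullback_pert n.+1 (D2 F) (fun z => tpoly_y c n.+2 z.1 z.2) C d (fun s => s ^+ q) (taylor_gt0 hc).
- by move=> s s1; rewrite ncX exprn_ile1// nc_ge0.
- by move=> x y xd yd; have := hC x y xd yd; rewrite !add0r.
by exists C', d'.
Qed.

End Pullback.

(** * Vanishing of the component transverse to N *)
Section Key.
Variable R : realType.
Notation nc := (@Normc.normc R).
Notation K := R[i].

Lemma asym_lead_mul m phi psi c (psi0 : K) : asym m.+1 phi c ->
  (forall i, (i < m)%N -> c i = 0) ->
  (exists C d : R, 0 < d /\ forall s, s != 0 -> nc s < d -> nc (psi s - psi0) <= C * nc s) ->
  asym m.+1 (fun s => phi s * psi s) (fun i => c i * psi0).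
Proof.
move=> [C [d [d0 h]]] c0 [C' [d' [d'0 h']]].
exists (`|C| * (nc psi0 + `|C'|) + nc (c m) * C'), (Num.min 1 (Num.min d d')).
split; first by rewrite !lt_min ltr01 d0.
move=> s s0; rewrite !lt_min => /and3P[/ltW s1 sd sd'].
have := h s s0 sd; have := h' s s0 sd'.
have lead (e : nat -> K) : (forall i, (i < m)%N -> e i = 0) ->
    \sum_(i < m.+1) e i * s ^+ i = e m * s ^+ m.
  move=> e0; rewrite big_ord_recr /= big1 ?add0r// => i _.
  by rewrite e0 ?mul0r.
rewrite lead// (lead (fun i => c i * psi0)); last by move=> i im; rewrite c0// mul0r.
move=> H' H.
have -> : phi s * psi s - c m * psi0 * s ^+ m =
  (phi s - c m * s ^+ m) * psi s + c m * s ^+ m * (psi s - psi0) by ring.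
apply: le_trans (ncD _ _) _; rewrite !ncM ncX mulrDl.
have ns := nc_ge0 s.
have psib : nc (psi s) <= nc psi0 + `|C'|.
  rewrite -[psi s](subrK psi0) addrC; apply: le_trans (ncD _ _) _; rewrite lerD2l.
  apply: (le_trans H'); apply: (@le_trans _ _ (`|C'| * nc s)).
    by rewrite ler_wpM2r// ler_norm.
  by rewrite ler_piMr.
apply: lerD.
  rewrite mulrAC; apply: ler_pM; rewrite ?nc_ge0//.
  by apply: (le_trans H); rewrite ler_wpM2r ?exprn_ge0// ler_norm.
rewrite exprS -!mulrA ler_wpM2l ?nc_ge0// mulrCA [leRHS]mulrCA.
rewrite mulrC [leRHS](_ : _ = C' * nc s * nc s ^+ m); last by ring.
by rewrite ler_wpM2r ?exprn_ge0.
Qed.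

Lemma poly_eq0_cofinite (P ga : {poly K}) : ga != 0 ->
  (forall t, ga.[t] != 0 -> P.[t] = 0) -> P = 0.
Proof.
move=> ga0 h; suff /eqP : P * ga = 0 by rewrite mulf_eq0 (negPf ga0) orbF => /eqP.
apply/eqP; apply: contraT => Q0.
pose rs := [seq i%:R : K | i <- iota 0 (size (P * ga))].
have : (size rs < size (P * ga)%R)%N.
  apply: max_poly_roots => //.
    apply/allP => _ /mapP[i _ ->]; rewrite rootE hornerM.
    by have [->|/h ->] := eqVneq ga.[i%:R] 0; rewrite ?mulr0 ?mul0r.
  rewrite map_inj_uniq ?iota_uniq// => i j /eqP.
  by rewrite eqr_nat => /eqP.
by rewrite size_map size_iota ltnn.
Qed.

Variables (p q d : nat) (N1 N2 kap g : C2 R -> C1 R) (n1 n2 kp ga : {poly K}).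
Hypotheses (p0 : (0 < p)%N) (q0 : (0 < q)%N) (ga0 : ga != 0).
(* N in the chart (x, y) = (s^p, s^q t): it is s (lam s d/ds + mu d/dt). *)
Hypothesis N1E : forall s t, N1 (s ^+ p, s ^+ q * t) = s ^+ p.+1 * n1.[t].
Hypothesis N2E : forall s t, N2 (s ^+ p, s ^+ q * t) = s ^+ q.+1 * n2.[t].
Hypothesis kapE : forall s t, kap (s ^+ p, s ^+ q * t) = s * kp.[t].
Hypothesis gE : forall s t, g (s ^+ p, s ^+ q * t) = s ^+ d * ga.[t].

Let lam := (p%:R)^-1 *: n1.
Let mu := n2 - q%:R *: ('X * lam).

Variables (m0 m1 m2 l0 l1 : K).
Hypothesis muE : mu = m2 *: 'X^2 + m1 *: 'X + m0%:P.
Hypothesis lamE : lam = l1 *: 'X + l0%:P.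
Hypothesis poles : forall t m, root mu t -> lam.[t] + m.+1%:R * mu^`().[t] != 0.
Hypothesis pole_inf : forall n, n%:R * m2 != l1.

Variables (A B psi : C2 R -> C1 R).
Hypothesis HA : \forall z \near (0 : C2 R), differentiable A z.
Hypothesis HB : \forall z \near (0 : C2 R), differentiable B z.
Hypothesis Hpsi : differentiable psi (0 : C2 R).
Hypothesis psi0 : psi 0 != 0.
Hypothesis HNA : \forall z \near (0 : C2 R), g z != 0 ->
  N1 z * D1 A z + N2 z * D2 A z = kap z * A z.
Hypothesis HNB : \forall z \near (0 : C2 R), g z != 0 ->
  N1 z * D1 B z + N2 z * D2 B z = kap z * B z + A z * psi z.

Let ray (t s : K) : C2 R := (s ^+ p, s ^+ q * t).

(** The pullback of N(F) - kap F, divided by s. *)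
Definition bracket (F : C2 R -> C1 R) (t s : K) : K :=
  lam.[t] * (p%:R * (s ^+ p * D1 F (ray t s))) + n2.[t] * (s ^+ q * D2 F (ray t s))
  - kp.[t] * F (ray t s).

Lemma bracketE F t s :
  s * bracket F t s = N1 (ray t s) * D1 F (ray t s) + N2 (ray t s) * D2 F (ray t s)
                      - kap (ray t s) * F (ray t s).
Proof.
have pn : (p%:R : K) != 0 by rewrite pnatr_eq0 -lt0n.
have -> : N1 (ray t s) = s ^+ p.+1 * n1.[t] by exact: N1E.
have -> : N2 (ray t s) = s ^+ q.+1 * n2.[t] by exact: N2E.
have -> : kap (ray t s) = s * kp.[t] by exact: kapE.
rewrite /bracket /lam hornerZ !exprS; move: (p%:R : K) pn => x xn.
by field.
Qed.

(** The action of F |-> N(F) - kap F on parts of weight i. *)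
Definition weight_op (i : nat) (w : {poly K}) := i%:R *: (lam * w) + mu * w^`() - kp * w.

Lemma asym_bracket F c d0 t n : taylor_at F 0 c d0 ->
  asym n.+1 (bracket F t) (fun i => (weight_op i (wpoly p q c i)).[t]).
Proof.
move=> hc.
have h1 := asymZ lam.[t] (asym_D1 t p0 q0 hc n).
have h2 := asymZ n2.[t] (asym_D2 t p0 q0 hc n).
have h3 := asymZ (- kp.[t]) (asym_fun t p0 q0 hc n.+1).
apply: asym_eq (asymD (asymD h1 h2) h3) _ _.
  by move=> s _; rewrite /bracket mulNr.
move=> i _; rewrite /weight_op /mu !(hornerD, hornerN, hornerZ, hornerM, hornerX).
by ring.
Qed.

Lemma pullback_near (P : C2 R -> Prop) t : (\forall z \near (0 : C2 R), P z) ->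
  exists2 d' : R, 0 < d' & forall s, nc s < d' -> P (ray t s).
Proof.
move=> /nearC2[e e0 h]; have [d' d'0 hd] := pullback_small t p0 q0 e0.
by exists d' => // s /hd[_ h1 h2]; apply: h; rewrite subr0.
Qed.

Lemma g_ray t s : ga.[t] != 0 -> s != 0 -> g (ray t s) != 0.
Proof.
move=> gt s0; have -> : g (ray t s) = s ^+ d * ga.[t] by exact: gE.
by rewrite mulf_neq0 ?expf_neq0.
Qed.

Lemma asym0 n : asym n (fun _ : K => 0) (fun=> 0).
Proof.
exists 0, 1; split => // s _ _.
by rewrite big1 ?subrr ?nc0 ?mul0r// => i _; rewrite mul0r.
Qed.

Lemma psi_lip t : exists C d : R, 0 < d /\
  forall s, s != 0 -> nc s < d -> nc (psi (ray t s) - psi 0) <= C * nc s.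
Proof.
have [e e0 h] := diffC2P Hpsi ltr01.
have [d' d'0 hd] := pullback_small t p0 q0 e0.
set C := 1 + nc (D1 psi 0) + nc (D2 psi 0).
have C0 : 0 <= C by rewrite !addr_ge0// nc_ge0.
exists (C * (1 + nc t)), d'; split => // s _ /hd[s1 h1 h2].
have M1 := pullback_max t p0 q0 s1.
have := h _ _ h1 h2; rewrite diffE12 !add0r mul1r => H.
have -> : psi (ray t s) - psi 0 =
   (psi (ray t s) - psi 0 - (D1 psi 0 * s ^+ p + D2 psi 0 * (s ^+ q * t)))
   + (D1 psi 0 * s ^+ p + D2 psi 0 * (s ^+ q * t)) by ring.
set M := Num.max _ _ in M1 H.
apply: (@le_trans _ _ (C * M)); last by rewrite -mulrA ler_wpM2l.
have -> : C * M = M + (nc (D1 psi 0) * M + nc (D2 psi 0) * M) by rewrite /C; ring.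
apply: le_trans (ncD _ _) _; apply: lerD; first exact: H.
apply: le_trans (ncD _ _) _; rewrite (ncM (D1 _ _)) (ncM (D2 _ _)); apply: lerD.
  by rewrite ler_wpM2l ?nc_ge0// le_max lexx.
by rewrite ler_wpM2l ?nc_ge0// le_max lexx orbT.
Qed.

(** If A had a lowest part a_m, then together with the part b of weight m - 1
    of B it would contradict [no_rational_solution]. *)
Theorem commuting_part_vanishes : \forall z \near (0 : C2 R), A z = 0.
Proof.
have [ca [da hA]] := taylor_exists HA.
have [cb [db hB]] := taylor_exists HB.
have [ex|nex] := pselect (exists i, wpoly p q ca i != 0); last first.
  apply/nearC2; exists da => [|x y]; first exact: taylor_gt0 hA.
  rewrite !subr0 => xd yd; have := taylor_inj hA _ xd yd; rewrite !add0r; apply.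
  move=> j k; rewrite -(coef_wpoly p0 q0).
  have [->|w0] := eqVneq (wpoly p q ca (p * k + q * j)) 0; first by rewrite coef0.
  by exfalso; apply: nex; eexists; exact: w0.
exfalso; pose m := ex_minn ex.
have am0 : wpoly p q ca m != 0 by rewrite /m; case: ex_minnP.
have amin i : (i < m)%N -> wpoly p q ca i = 0.
  rewrite /m; case: ex_minnP => k _ hk ik; apply/eqP; apply: contraTT ik => wi.
  by rewrite -leqNgt; exact: hk.
have EA i : weight_op i (wpoly p q ca i) = 0.
  apply: (poly_eq0_cofinite ga0) => t gt.
  apply: (asym_uniq (asym_bracket t i hA) (asym0 i.+1)) => //.
  have [d' d'0 hd] := pullback_near t HNA; exists d' => // s s0 sd.
  apply: (mulfI s0); rewrite mulr0 bracketE.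
  by rewrite (hd s sd (g_ray gt s0)) subrr.
have EB t : ga.[t] != 0 ->
    (if m is j.+1 then (weight_op j (wpoly p q cb j)).[t] else 0) = (wpoly p q ca m).[t] * psi 0.
  move=> gt.
  have h1 : asym m.+1 (fun s => s * bracket B t s)
      (fun i => if i is j.+1 then (weight_op j (wpoly p q cb j)).[t] else 0).
    case: (m) => [|k]; last exact: asym_mulX (asym_bracket t k hB).
    exact: asym_trunc (asym_mulX (asym_bracket t 0 hB)).
  have h2 := asym_lead_mul (asym_fun t p0 q0 hA m.+1) _ (psi_lip t).
  apply: (asym_uniq h1 (h2 _)) => //.
    by move=> i im; rewrite amin// horner0.
  have [d' d'0 hd] := pullback_near t HNB; exists d' => // s s0 sd.
  by rewrite bracketE (hd s sd (g_ray gt s0)) addrC addKr.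
case: m am0 amin EB => [|m] am0 amin EB.
  have : wpoly p q ca 0 = 0.
    apply: (poly_eq0_cofinite ga0) => t /EB /esym/eqP.
    by rewrite mulf_eq0 (negPf psi0) orbF => /eqP.
  by move/eqP; rewrite (negPf am0).
have EB' : weight_op m (wpoly p q cb m) = psi 0 *: wpoly p q ca m.+1.
  apply/eqP; rewrite -subr_eq0; apply/eqP/(poly_eq0_cofinite ga0) => t gt.
  by rewrite hornerD hornerN hornerZ (EB t gt) mulrC subrr.
move: am0 EB' (EA m.+1); rewrite /weight_op.
move: (wpoly p q ca m.+1) (wpoly p q cb m) => a b a0 Eb Ea.
have H : mu * (b^`() * a - a^`() * b) = lam * a * b + psi 0 *: a ^+ 2.
  have mb : mu * b^`() = psi 0 *: a + kp * b - m%:R *: (lam * b).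
    by rewrite -Eb; ring.
  have ma : mu * a^`() = kp * a - m.+1%:R *: (lam * a).
    by move/eqP: Ea; rewrite subr_eq0 => /eqP <-; rewrite addrC addKr.
  have -> : mu * (b^`() * a - a^`() * b) = (mu * b^`()) * a - (mu * a^`()) * b by ring.
  rewrite mb ma -!mul_polyC -nat1r polyCD polyC1; ring.
by have := no_rational_solution muE lamE poles pole_inf H a0; apply/eqP.
Qed.

End Key.

(** * Calculus of partial derivatives *)
Section Partials.
Variable R : realType.
Notation nc := (@Normc.normc R).
Notation K := R[i].
Implicit Types (F G : C2 R -> C1 R) (z : C2 R).

Definition pd F z (a b : K) := [/\ differentiable F z, D1 F z = a & D2 F z = b].

Lemma pd_diff F z : differentiable F z -> pd F z (D1 F z) (D2 F z).
Proof. by split. Qed.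

Lemma pd_eq F z a b a' b' : pd F z a b -> a = a' -> b = b' -> pd F z a' b'.
Proof. by move=> h <- <-. Qed.

Lemma pd_cst (k : C1 R) z : pd (fun=> k) z 0 0.
Proof. by split; rewrite ?/D1 ?/D2 ?diff_cst//; exact: differentiable_cst. Qed.

Lemma pd_fst z : pd (fun z => z.1) z 1 0.
Proof.
apply: tdiff_diff => e e0; exists 1 => // u v _ _ /=.
by rewrite [_ + u]addrC addrK mul1r mul0r addr0 subrr nc0 mulr_ge0 ?(ltW e0)// le_max nc_ge0.
Qed.

Lemma pd_snd z : pd (fun z => z.2) z 0 1.
Proof.
apply: tdiff_diff => e e0; exists 1 => // u v _ _ /=.
by rewrite [_ + v]addrC addrK mul1r mul0r add0r subrr nc0 mulr_ge0 ?(ltW e0)// le_max nc_ge0.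
Qed.

Lemma pdD F G z a b a' b' : pd F z a b -> pd G z a' b' ->
  pd (fun z => F z + G z) z (a + a') (b + b').
Proof.
move=> [dF <- <-] [dG <- <-]; split.
- exact: (differentiableD dF dG).
- exact: (congr1 (fun L : C2 R -> C1 R => L (1, 0)) (diffD dF dG)).
- exact: (congr1 (fun L : C2 R -> C1 R => L (0, 1)) (diffD dF dG)).
Qed.

Lemma pdN F z a b : pd F z a b -> pd (fun z => - F z) z (- a) (- b).
Proof.
move=> [dF <- <-]; split.
- exact: (differentiableN dF).
- exact: (congr1 (fun L : C2 R -> C1 R => L (1, 0)) (diffN dF)).
- exact: (congr1 (fun L : C2 R -> C1 R => L (0, 1)) (diffN dF)).
Qed.

Lemma pdB F G z a b a' b' : pd F z a b -> pd G z a' b' ->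
  pd (fun z => F z - G z) z (a - a') (b - b').
Proof. by move=> hF hG; exact: pdD hF (pdN hG). Qed.

Lemma pdM F G z a b a' b' : pd F z a b -> pd G z a' b' ->
  pd (fun z => F z * G z) z (a * G z + F z * a') (b * G z + F z * b').
Proof.
move=> [dF <- <-] [dG <- <-]; split.
- exact: (differentiableM dF dG).
- rewrite addrC [_ * G z]mulrC.
  exact: (congr1 (fun L : C2 R -> C1 R => L (1, 0)) (diffM dF dG)).
- rewrite addrC [_ * G z]mulrC.
  exact: (congr1 (fun L : C2 R -> C1 R => L (0, 1)) (diffM dF dG)).
Qed.

Lemma pdV F z a b : pd F z a b -> F z != 0 ->
  pd (fun z => (F z)^-1) z (- a / F z ^+ 2) (- b / F z ^+ 2).
Proof.
move=> [dF <- <-] Fz; split.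
- exact: (differentiableV dF Fz).
- rewrite mulNr mulrC -mulNr.
  exact: (congr1 (fun L : C2 R -> C1 R => L (1, 0)) (diffV dF Fz)).
- rewrite mulNr mulrC -mulNr.
  exact: (congr1 (fun L : C2 R -> C1 R => L (0, 1)) (diffV dF Fz)).
Qed.

Lemma pdX F z a b n : pd F z a b ->
  pd (fun z => F z ^+ n) z (n%:R * F z ^+ n.-1 * a) (n%:R * F z ^+ n.-1 * b).
Proof.
move=> hF; elim: n => [|n IH]; first by rewrite !mul0r; exact: pd_cst.
have -> : (fun z => F z ^+ n.+1) = (fun z => F z * F z ^+ n).
  by apply/funext => x; rewrite exprS.
apply: pd_eq (pdM hF IH) _ _; case: n {IH} => [|n].
- by rewrite /= !expr0; ring.
- by rewrite /= -[in RHS]nat1r exprS; ring.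
- by rewrite /= !expr0; ring.
- by rewrite /= -[in RHS]nat1r exprS; ring.
Qed.

End Partials.

(** * The equations satisfied by a commuting field *)
Section Algebra.
Variable K : fieldType.
Variables (n1 n2 n11 n12 n21 n22 w1 w2 u1 v1 u2 v2 : K).

(** Here (u_i, v_i) are the partial derivatives of w_i, and the hypotheses say
    that the derivative of w along n is th n plus the derivative of n along w. *)
Lemma alg_detWN th : n1 * u1 + n2 * v1 = th * n1 + (w1 * n11 + w2 * n12) ->
  n1 * u2 + n2 * v2 = th * n2 + (w1 * n21 + w2 * n22) ->
  n1 * (u1 * n2 + w1 * n21 - (u2 * n1 + w2 * n11))
  + n2 * (v1 * n2 + w1 * n22 - (v2 * n1 + w2 * n12))
  = (n11 + n22) * (w1 * n2 - w2 * n1).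
Proof.
move=> X1 X2.
transitivity ((n1 * u1 + n2 * v1) * n2 - (n1 * u2 + n2 * v2) * n1
   + w1 * (n1 * n21 + n2 * n22) - w2 * (n1 * n11 + n2 * n12)); first by ring.
by rewrite X1 X2; ring.
Qed.

(** The identity delta w = det (w, n) e + det (e, w) n, with
    delta = det (e, n), rewrites th delta through the derivatives of g and f
    along e and n; the other terms simplify by Euler's relations for n. *)
Lemma alg_detEWf (p q d a : nat) (x y g g1 g2 f f1 f2 : K) : g != 0 -> f != 0 ->
  let e1 := p%:R * x in let e2 := q%:R * y in
  let th := a%:R * (w1 * g1 + w2 * g2) / g + (w1 * f1 + w2 * f2) / f in
  let b0 := e1 * w2 - e2 * w1 in
  e1 * n11 + e2 * n12 = p.+1%:R * n1 -> e1 * n21 + e2 * n22 = q.+1%:R * n2 ->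
  e1 * g1 + e2 * g2 = d%:R * g -> n1 * g1 + n2 * g2 = 0 ->
  n1 * u1 + n2 * v1 = th * n1 + (w1 * n11 + w2 * n12) ->
  n1 * u2 + n2 * v2 = th * n2 + (w1 * n21 + w2 * n22) ->
  n1 * ((p%:R * w2 + e1 * u2 - e2 * u1) * f^-1 - b0 * (f1 / f ^+ 2))
  + n2 * ((e1 * v2 - (q%:R * w1 + e2 * v1)) * f^-1 - b0 * (f2 / f ^+ 2))
  = (n11 + n22) * (b0 * f^-1) + (w1 * n2 - w2 * n1) *
    ((1 + (a * d)%:R) * f^-1 + (e1 * f1 + e2 * f2) * (f^-1 ^+ 2)).
Proof.
move=> gn fn e1 e2 th b0 E1 E2 Eg fi X1 X2.
pose delta := e1 * n2 - e2 * n1; pose a0 := w1 * n2 - w2 * n1.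
have td : th * delta = a0 * ((a * d)%:R + (e1 * f1 + e2 * f2) / f)
    + b0 * ((n1 * f1 + n2 * f2) / f).
  transitivity (a%:R * (a0 * (e1 * g1 + e2 * g2) + b0 * (n1 * g1 + n2 * g2)) / g
    + (a0 * (e1 * f1 + e2 * f2) + b0 * (n1 * f1 + n2 * f2)) / f).
    by rewrite /th /delta /a0 /b0; ring.
  by rewrite Eg fi natrM; clearbody a0 b0 e1 e2; field; rewrite fn gn.
have NB0 : p%:R * n1 * w2 - q%:R * n2 * w1
    + e1 * (n1 * u2 + n2 * v2) - e2 * (n1 * u1 + n2 * v1)
    = (n11 + n22) * b0 + a0 + th * delta.
  rewrite X1 X2.
  have q1 : e2 * n22 = q.+1%:R * n2 - e1 * n21 by rewrite -E2; ring.
  have p1 : e1 * n11 = p.+1%:R * n1 - e2 * n12 by rewrite -E1; ring.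
  clearbody th.
  transitivity (w2 * (p%:R * n1 + e1 * n22 - e2 * n12)
     - w1 * (q%:R * n2 + e2 * n11 - e1 * n21) + th * delta).
    by rewrite /delta; clearbody e1 e2; ring.
  have -> : (n11 + n22) * b0 = w2 * (e1 * n11 + e1 * n22) - w1 * (e2 * n11 + e2 * n22).
    by rewrite /b0; clearbody e1 e2; ring.
  by rewrite q1 p1 /a0 -!nat1r; clearbody e1 e2; ring.
transitivity ((p%:R * n1 * w2 - q%:R * n2 * w1
    + e1 * (n1 * u2 + n2 * v2) - e2 * (n1 * u1 + n2 * v1)) / f
  - b0 * ((n1 * f1 + n2 * f2) / f ^+ 2)).
  by clearbody e1 e2 b0; ring.
by rewrite NB0 td -/a0; clearbody a0 b0 e1 e2; field.
Qed.

End Algebra.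

Section Identities.
Variable R : realType.
Notation nc := (@Normc.normc R).
Notation K := R[i].

Lemma near_near (P : C2 R -> Prop) (z : C2 R) :
  (\forall q \near z, P q) -> \forall q \near z, \forall q' \near q, P q'.
Proof. exact: near_join. Qed.

Lemma near_neq0 (f : C2 R -> C1 R) z : differentiable f z -> f z != 0 ->
  \forall q \near z, f q != 0.
Proof.
move=> /differentiable_continuous fc fz.
have P : nbhs (f z) (fun w => w != 0).
  apply/nearC; exists (nc (f z)); first by rewrite nc_gt0.
  by move=> w; apply: contraTneq => ->; rewrite sub0r ncN ltxx.
exact: (fc _ P).
Qed.

Variables (p q d a : nat).
Variables (N1 N2 g N11 N12 N21 N22 g1 g2 f W1 W2 : C2 R -> C1 R).
Hypothesis pN1 : forall z, pd N1 z (N11 z) (N12 z).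
Hypothesis pN2 : forall z, pd N2 z (N21 z) (N22 z).
Hypothesis pg : forall z, pd g z (g1 z) (g2 z).
Hypothesis euler1 : forall z, p%:R * z.1 * N11 z + q%:R * z.2 * N12 z = p.+1%:R * N1 z.
Hypothesis euler2 : forall z, p%:R * z.1 * N21 z + q%:R * z.2 * N22 z = q.+1%:R * N2 z.
Hypothesis eulerg : forall z, p%:R * z.1 * g1 z + q%:R * z.2 * g2 z = d%:R * g z.
Hypothesis first_int : forall z, N1 z * g1 z + N2 z * g2 z = 0.
Hypothesis hf : \forall z \near (0 : C2 R), differentiable f z.
Hypothesis hW1 : \forall z \near (0 : C2 R), differentiable W1 z.
Hypothesis hW2 : \forall z \near (0 : C2 R), differentiable W2 z.
Hypothesis f0 : f 0 != 0.

(** The field under study is [mult] N. *)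
Definition mult : C2 R -> C1 R := fun z => g z ^+ a * f z.

(** A component of [mult N, W] = 0; Ni1 and Ni2 are the partial derivatives of
    the component Ni of N. *)
Definition commutes_with (W Ni Ni1 Ni2 : C2 R -> C1 R) z :=
  mult z * (N1 z * D1 W z + N2 z * D2 W z) =
  (W1 z * D1 mult z + W2 z * D2 mult z) * Ni z + mult z * (W1 z * Ni1 z + W2 z * Ni2 z).

Hypothesis comm1 : \forall z \near (0 : C2 R), commutes_with W1 N1 N11 N12 z.
Hypothesis comm2 : \forall z \near (0 : C2 R), commutes_with W2 N2 N21 N22 z.

Definition detWN : C2 R -> C1 R := fun z => W1 z * N2 z - W2 z * N1 z.
Definition detEW : C2 R -> C1 R := fun z => p%:R * z.1 * W2 z - q%:R * z.2 * W1 z.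
Definition detEWf : C2 R -> C1 R := fun z => detEW z * (f z)^-1.
Definition psi : C2 R -> C1 R := fun z => (1 + (a * d)%:R) * (f z)^-1 +
  (p%:R * z.1 * D1 f z + q%:R * z.2 * D2 f z) * ((f z)^-1 ^+ 2).
Definition divN : C2 R -> C1 R := fun z => N11 z + N22 z.

Lemma unit_near : \forall z \near (0 : C2 R), f z != 0.
Proof. by apply: near_neq0 => //; exact: nbhs_singleton hf. Qed.

(** The logarithmic derivative of [mult] along W. *)
Definition theta z := a%:R * (W1 z * g1 z + W2 z * g2 z) / g z + (W1 z * D1 f z + W2 z * D2 f z) / f z.

Lemma mult_theta z : differentiable f z -> f z != 0 -> g z != 0 ->
  W1 z * D1 mult z + W2 z * D2 mult z = mult z * theta z.
Proof.
move=> df fz gz; have [_ -> ->] := pdM (pdX a (pg z)) (pd_diff df).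
rewrite /mult /theta; case: (a) => [|k] /=.
  by rewrite !expr0; field; rewrite fz gz.
by rewrite exprS; field; rewrite fz gz.
Qed.

Lemma divide_theta (W Ni Ni1 Ni2 : C2 R -> C1 R) z :
  differentiable f z -> f z != 0 -> g z != 0 -> commutes_with W Ni Ni1 Ni2 z ->
  N1 z * D1 W z + N2 z * D2 W z = theta z * Ni z + (W1 z * Ni1 z + W2 z * Ni2 z).
Proof.
move=> df fz gz h.
have cancel (m x y u n : K) : m != 0 -> m * x = m * u * n + m * y -> x = u * n + y.
  by move=> m0; rewrite -mulrA -mulrDr; exact: mulfI.
apply: (@cancel (mult z)); first by rewrite /mult mulf_neq0// expf_neq0.
by rewrite -(mult_theta df fz gz); exact: h.
Qed.

Lemma detWN_pd z : differentiable W1 z -> differentiable W2 z ->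
  pd detWN z (D1 W1 z * N2 z + W1 z * N21 z - (D1 W2 z * N1 z + W2 z * N11 z))
    (D2 W1 z * N2 z + W1 z * N22 z - (D2 W2 z * N1 z + W2 z * N12 z)).
Proof. by move=> d1 d2; apply: pdB; apply: pdM => //; exact: pd_diff. Qed.

Lemma detEW_pd z : differentiable W1 z -> differentiable W2 z ->
  pd detEW z (p%:R * W2 z + p%:R * z.1 * D1 W2 z - q%:R * z.2 * D1 W1 z)
    (p%:R * z.1 * D2 W2 z - (q%:R * W1 z + q%:R * z.2 * D2 W1 z)).
Proof.
move=> d1 d2.
have h1 := pdM (pdM (pd_cst (p%:R) z) (pd_fst z)) (pd_diff d2).
have h2 := pdM (pdM (pd_cst (q%:R) z) (pd_snd z)) (pd_diff d1).
have h : pd detEW z _ _ := pdB h1 h2.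
by apply: (pd_eq h); rewrite !(mul0r, mulr0, mulr1, add0r, addr0).
Qed.

Lemma detEWf_pd z : differentiable W1 z -> differentiable W2 z ->
  differentiable f z -> f z != 0 ->
  pd detEWf z (D1 detEW z * (f z)^-1 - detEW z * (D1 f z / f z ^+ 2))
    (D2 detEW z * (f z)^-1 - detEW z * (D2 f z / f z ^+ 2)).
Proof.
move=> d1 d2 df fz; have [dE _ _] := detEW_pd d1 d2.
by apply: (pd_eq (pdM (pd_diff dE) (pdV (pd_diff df) fz))); rewrite mulNr mulrN.
Qed.

Lemma psi_diff : differentiable psi (0 : C2 R).
Proof.
have [dD1 dD2 _] := holo_partial hf.
have df := nbhs_singleton hf.
have hV := pdV (pd_diff df) f0.
have h1 := pdM (pd_cst (1 + (a * d)%:R) _) hV.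
have h2 := pdM (pdM (pd_cst (p%:R) 0) (pd_fst 0)) (pd_diff dD1).
have h3 := pdM (pdM (pd_cst (q%:R) 0) (pd_snd 0)) (pd_diff dD2).
by have [] := pdD h1 (pdM (pdD h2 h3) (pdX 2 hV)).
Qed.

Lemma psi0 : psi 0 != 0.
Proof.
by rewrite /psi /= !mulr0 !mul0r addr0 mul0r addr0 mulf_neq0 ?invr_eq0// nat1r pnatr_eq0.
Qed.

Lemma N_detWN : \forall z \near (0 : C2 R), g z != 0 ->
  N1 z * D1 detWN z + N2 z * D2 detWN z = divN z * detWN z.
Proof.
near=> z => gz.
have df : differentiable f z by near: z.
have fz : f z != 0 by near: z; exact: unit_near.
have d1 : differentiable W1 z by near: z.
have d2 : differentiable W2 z by near: z.
have c1 : commutes_with W1 N1 N11 N12 z by near: z.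
have c2 : commutes_with W2 N2 N21 N22 z by near: z.
have X1 := divide_theta df fz gz c1; have X2 := divide_theta df fz gz c2.
have [_ -> ->] := detWN_pd d1 d2.
exact: alg_detWN X1 X2.
Unshelve. all: by end_near.
Qed.

Lemma N_detEWf : \forall z \near (0 : C2 R), g z != 0 ->
  N1 z * D1 detEWf z + N2 z * D2 detEWf z = divN z * detEWf z + detWN z * psi z.
Proof.
near=> z => gz.
have df : differentiable f z by near: z.
have fz : f z != 0 by near: z; exact: unit_near.
have d1 : differentiable W1 z by near: z.
have d2 : differentiable W2 z by near: z.
have c1 : commutes_with W1 N1 N11 N12 z by near: z.
have c2 : commutes_with W2 N2 N21 N22 z by near: z.
have X1 := divide_theta df fz gz c1; have X2 := divide_theta df fz gz c2.
have [_ -> ->] := detEWf_pd d1 d2 df fz.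
have [_ -> ->] := detEW_pd d1 d2.
exact: (alg_detEWf gz fz (euler1 z) (euler2 z) (eulerg z) (first_int z) X1 X2).
Unshelve. all: by end_near.
Qed.

End Identities.

(** * Chain rule *)
Section ChangeOfCoordinates.
Variable R : realType.
Notation nc := (@Normc.normc R).
Notation K := R[i].

Lemma pd_near (F G : C2 R -> C1 R) (z : C2 R) a b :
  (\forall q \near z, F q = G q) -> pd F z a b -> pd G z a b.
Proof.
move=> /nearC2[d d0 h] [dF <- <-]; apply: tdiff_diff => e e0.
have [d' d'0 hd] := diff_tdiff dF e0; exists (Num.min d d') => [|u v].
  by rewrite lt_min d0.
rewrite !lt_min => /andP[ud ud'] /andP[vd vd'].
have := hd u v ud' vd'; rewrite !h// ?subrr ?nc0//.
  by rewrite addrC addKr.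
by rewrite addrC addKr.
Qed.

Lemma pd_uniq (F : C2 R -> C1 R) (z : C2 R) a b a' b' :
  pd F z a b -> pd F z a' b' -> a = a' /\ b = b'.
Proof. by move=> [_ <- <-] [_ <- <-]. Qed.

Lemma pd_comp (F P1 P2 : C2 R -> C1 R) (z : C2 R) a b a1 b1 a2 b2 :
  pd F (P1 z, P2 z) a b -> pd P1 z a1 b1 -> pd P2 z a2 b2 ->
  pd (fun z => F (P1 z, P2 z)) z (a * a1 + b * a2) (a * b1 + b * b2).
Proof.
move=> [dF <- <-] [dP1 <- <-] [dP2 <- <-].
pose P : C2 R -> C2 R := fun z => (P1 z, P2 z).
have dP : differentiable P z by exact: differentiable_pair.
have EP v : 'd P z v = ('d P1 z v, 'd P2 z v).
  exact: (congr1 (fun L : C2 R -> C2 R => L v) (diff_pair dP1 dP2)).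
have EC v : 'd (F \o P) z v = 'd F (P z) ('d P z v).
  exact: (congr1 (fun L : C2 R -> C1 R => L v) (diff_comp dP dF)).
split.
- exact: (differentiable_comp dP dF).
- exact: (etrans (EC (1, 0)) (etrans (congr1 ('d F (P z)) (EP (1, 0))) (diffE12 _ _ _ _))).
- exact: (etrans (EC (0, 1)) (etrans (congr1 ('d F (P z)) (EP (0, 1))) (diffE12 _ _ _ _))).
Qed.

Lemma diff_components (F : C2 R -> C2 R) (z : C2 R) : differentiable F z ->
  [/\ differentiable (fun z => (F z).1 : C1 R) z,
      differentiable (fun z => (F z).2 : C1 R) z &
   forall v, 'd F z v = ('d (fun z => (F z).1 : C1 R) z v, 'd (fun z => (F z).2 : C1 R) z v)].
Proof.
move=> dF.
have [d1 e11 e12] := @pd_fst R (F z); have [d2 e21 e22] := @pd_snd R (F z).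
split.
- exact: (differentiable_comp dF d1).
- exact: (differentiable_comp dF d2).
- move=> v.
  have F1 (w : C2 R) : 'd (fun z : C2 R => z.1 : C1 R) (F z) w = w.1.
    case: w => w1 w2; apply: (etrans (diffE12 _ _ _ _)).
    by rewrite e11 e12 mul1r mul0r addr0.
  have F2 (w : C2 R) : 'd (fun z : C2 R => z.2 : C1 R) (F z) w = w.2.
    case: w => w1 w2; apply: (etrans (diffE12 _ _ _ _)).
    by rewrite e21 e22 mul1r mul0r add0r.
  have E1 := congr1 (fun L : C2 R -> C1 R => L v) (diff_comp dF d1).
  have E2 := congr1 (fun L : C2 R -> C1 R => L v) (diff_comp dF d2).
  transitivity (('d F z v).1, ('d F z v).2); first by case: ('d F z v).
  congr pair.
    exact: (esym (etrans E1 (F1 _))).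
  exact: (esym (etrans E2 (F2 _))).
Qed.

End ChangeOfCoordinates.

(** * The six models *)
Section Models.
Variable R : realType.
Notation K := R[i].

(** The data on N and g used in the proof: weights, partial derivatives,
    Euler relations, the first integral, the polynomials n1, n2, divn, gn that
    describe N1, N2, div N and g in the chart (s^wx, s^wy t), and the
    coefficients of lam and mu, which satisfy the two non-resonance
    conditions of [no_rational_solution]. *)
Record quasihomogeneous (g : C1 R -> C1 R -> C1 R) (N : C1 R -> C1 R -> C2 R) := Quasihomogeneous {
  wx : nat; wy : nat; wg : nat;
  N11 : C2 R -> C1 R; N12 : C2 R -> C1 R; N21 : C2 R -> C1 R; N22 : C2 R -> C1 R;
  g1 : C2 R -> C1 R; g2 : C2 R -> C1 R;
  n1 : {poly K}; n2 : {poly K}; divn : {poly K}; gn : {poly K};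
  lam0 : K; lam1 : K; mu0 : K; mu1 : K; mu2 : K;
  wx_gt0 : (0 < wx)%N; wy_gt0 : (0 < wy)%N; gn_neq0 : gn != 0;
  pdN1 : forall z, pd (fun z => (N z.1 z.2).1) z (N11 z) (N12 z);
  pdN2 : forall z, pd (fun z => (N z.1 z.2).2) z (N21 z) (N22 z);
  pdg : forall z, pd (fun z => g z.1 z.2) z (g1 z) (g2 z);
  euler_N1 : forall z : C2 R, wx%:R * z.1 * N11 z + wy%:R * z.2 * N12 z = wx.+1%:R * (N z.1 z.2).1;
  euler_N2 : forall z : C2 R, wx%:R * z.1 * N21 z + wy%:R * z.2 * N22 z = wy.+1%:R * (N z.1 z.2).2;
  euler_g : forall z : C2 R, wx%:R * z.1 * g1 z + wy%:R * z.2 * g2 z = wg%:R * g z.1 z.2;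
  Ng : forall z : C2 R, (N z.1 z.2).1 * g1 z + (N z.1 z.2).2 * g2 z = 0;
  n1E : forall s t : K, (N (s ^+ wx) (s ^+ wy * t)).1 = s ^+ wx.+1 * n1.[t];
  n2E : forall s t : K, (N (s ^+ wx) (s ^+ wy * t)).2 = s ^+ wy.+1 * n2.[t];
  divnE : forall s t : K, N11 (s ^+ wx, s ^+ wy * t) + N22 (s ^+ wx, s ^+ wy * t) = s * divn.[t];
  gnE : forall s t : K, g (s ^+ wx) (s ^+ wy * t) = s ^+ wg * gn.[t];
  model_lamE : wx%:R^-1 *: n1 = lam1 *: 'X + lam0%:P;
  model_muE : n2 - wy%:R *: ('X * (wx%:R^-1 *: n1)) = mu2 *: 'X^2 + mu1 *: 'X + mu0%:P;
  no_pole : forall (t : K) r, mu2 * t ^+ 2 + mu1 * t + mu0 = 0 ->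
    lam1 * t + lam0 + r.+1%:R * (2 * mu2 * t + mu1) != 0;
  no_pole_at_inf : forall n, n%:R * mu2 != lam1 }.

Lemma not_dvd_neq0 (u v r : nat) : ~~ (v %| u)%N -> u%:R - r%:R * v%:R != 0 :> K.
Proof.
by apply: contraNneq => /eqP; rewrite subr_eq0 -natrM eqr_nat => /eqP ->; rewrite dvdn_mull.
Qed.

Lemma root01 (t m : K) : m != 0 -> m * t ^+ 2 - m * t = 0 -> t = 0 \/ t = 1.
Proof.
move=> m0 h; have : m * (t * (t - 1)) = 0 by rewrite -h; ring.
move/eqP; rewrite !mulf_eq0 (negPf m0) subr_eq0 /= => /orP[]/eqP; [left|right] => //.
Qed.

(** In every model but the fourth the roots of mu are 0 and 1; the last two
    items write lam + r mu' there as u - r v up to sign, with v not dividing u,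
    and rule out n m2 = l1. *)
Lemma model1 : quasihomogeneous (fun x y => x * y * (x - y))
    (fun x y => (x * (x - 2 * y), y * (y - 2 * x))).
Proof.
pose n1 : {poly K} := (- 2) *: 'X + 1%:P.
pose n2 : {poly K} := 'X^2 - 2 *: 'X.
pose dv : {poly K} := 0.
pose gn : {poly K} := 'X - 'X^2.
have n1E t : n1.[t] = 1 - 2 * t by rewrite /n1 !(hornerD, hornerN, hornerZ, hornerX, hornerXn, hornerC, hornerM, horner_exp, horner0); ring.
have n2E t : n2.[t] = t ^+ 2 - 2 * t by rewrite /n2 !(hornerD, hornerN, hornerZ, hornerX, hornerXn, hornerC, hornerM, horner_exp, horner0); ring.
have dvE t : dv.[t] = 0 by rewrite /dv ?(hornerD, hornerN, hornerZ, hornerX, hornerXn, hornerC, hornerM, horner_exp, horner0); ring.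
have gnE t : gn.[t] = t - t ^+ 2 by rewrite /gn !(hornerD, hornerN, hornerZ, hornerX, hornerXn, hornerC, hornerM, horner_exp, horner0); ring.
apply: (@Quasihomogeneous _ _ 1 1 3
  (fun z => 2 * z.1 - 2 * z.2) (fun z => - 2 * z.1)
  (fun z => - 2 * z.2) (fun z => 2 * z.2 - 2 * z.1)
  (fun z => 2 * z.1 * z.2 - z.2 ^+ 2) (fun z => z.1 ^+ 2 - 2 * z.1 * z.2)
  n1 n2 dv gn (1) (- 2) (0) (- 3) (3)).
- by [].
- by [].
- apply/eqP => E; have := gnE 2; rewrite E horner0 => /esym/eqP.
  by rewrite (_ : 2 - 2 ^+ 2 = - 2%:R :> K) ?oppr_eq0 ?pnatr_eq0//; ring.
- move=> z; have h := (pdM (pd_fst z) (pdB (pd_fst z) (pdM (pd_cst 2 z) (pd_snd z)))).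
  apply: (pd_eq h); case: z {h} => x y /=; ring.
- move=> z; have h := (pdM (pd_snd z) (pdB (pd_snd z) (pdM (pd_cst 2 z) (pd_fst z)))).
  apply: (pd_eq h); case: z {h} => x y /=; ring.
- move=> z; have h := (pdM (pdM (pd_fst z) (pd_snd z)) (pdB (pd_fst z) (pd_snd z))).
  apply: (pd_eq h); case: z {h} => x y /=; ring.
- move=> [x y] /=; ring.
- move=> [x y] /=; ring.
- move=> [x y] /=; ring.
- move=> [x y] /=; ring.
- move=> s t /=; rewrite n1E; ring.
- move=> s t /=; rewrite n2E; ring.
- move=> s t /=; rewrite dvE; ring.
- move=> s t /=; rewrite gnE; ring.
- by rewrite invr1 scale1r ?polyCN.
- rewrite /n1 /n2 invr1 !scale1r -!mul_polyC; ring.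
- move=> t r h; have [->|->] : t = 0 \/ t = 1.
    apply: (@root01 t 3); first by rewrite pnatr_eq0.
    rewrite -h; ring.
  + rewrite (_ : _ + _ = 1%:R - r.+1%:R * 3%:R); last by ring.
    exact: not_dvd_neq0.
  + rewrite (_ : _ + _ = - (1%:R - r.+1%:R * 3%:R)); last by ring.
    by rewrite oppr_eq0 not_dvd_neq0.
- move=> n; rewrite -subr_eq0 opprK.
  by rewrite -natrM -natrD pnatr_eq0 addn_eq0 andbF.
Qed.

Lemma model2 : quasihomogeneous (fun x y => x * y * (x - y) ^+ 2)
    (fun x y => (x * (x - 3 * y), y * (y - 3 * x))).
Proof.
pose n1 : {poly K} := (- 3) *: 'X + 1%:P.
pose n2 : {poly K} := 'X^2 - 3 *: 'X.
pose dv : {poly K} := - 'X - 1%:P.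
pose gn : {poly K} := 'X * (1%:P - 'X) ^+ 2.
have n1E t : n1.[t] = 1 - 3 * t by rewrite /n1 !(hornerD, hornerN, hornerZ, hornerX, hornerXn, hornerC, hornerM, horner_exp, horner0); ring.
have n2E t : n2.[t] = t ^+ 2 - 3 * t by rewrite /n2 !(hornerD, hornerN, hornerZ, hornerX, hornerXn, hornerC, hornerM, horner_exp, horner0); ring.
have dvE t : dv.[t] = - t - 1 by rewrite /dv ?(hornerD, hornerN, hornerZ, hornerX, hornerXn, hornerC, hornerM, horner_exp, horner0); ring.
have gnE t : gn.[t] = t * (1 - t) ^+ 2 by rewrite /gn !(hornerD, hornerN, hornerZ, hornerX, hornerXn, hornerC, hornerM, horner_exp, horner0); ring.
apply: (@Quasihomogeneous _ _ 1 1 4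
  (fun z => 2 * z.1 - 3 * z.2) (fun z => - 3 * z.1)
  (fun z => - 3 * z.2) (fun z => 2 * z.2 - 3 * z.1)
  (fun z => z.2 * (z.1 - z.2) ^+ 2 + 2 * z.1 * z.2 * (z.1 - z.2)) (fun z => z.1 * (z.1 - z.2) ^+ 2 - 2 * z.1 * z.2 * (z.1 - z.2))
  n1 n2 dv gn (1) (- 3) (0) (- 4) (4)).
- by [].
- by [].
- apply/eqP => E; have := gnE 2; rewrite E horner0 => /esym/eqP.
  by rewrite (_ : 2 * (1 - 2) ^+ 2 = 2%:R :> K) ?oppr_eq0 ?pnatr_eq0//; ring.
- move=> z; have h := (pdM (pd_fst z) (pdB (pd_fst z) (pdM (pd_cst 3 z) (pd_snd z)))).
  apply: (pd_eq h); case: z {h} => x y /=; ring.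
- move=> z; have h := (pdM (pd_snd z) (pdB (pd_snd z) (pdM (pd_cst 3 z) (pd_fst z)))).
  apply: (pd_eq h); case: z {h} => x y /=; ring.
- move=> z; have h := (pdM (pdM (pd_fst z) (pd_snd z)) (pdX 2 (pdB (pd_fst z) (pd_snd z)))).
  apply: (pd_eq h); case: z {h} => x y /=; ring.
- move=> [x y] /=; ring.
- move=> [x y] /=; ring.
- move=> [x y] /=; ring.
- move=> [x y] /=; ring.
- move=> s t /=; rewrite n1E; ring.
- move=> s t /=; rewrite n2E; ring.
- move=> s t /=; rewrite dvE; ring.
- move=> s t /=; rewrite gnE; ring.
- by rewrite invr1 scale1r ?polyCN.
- rewrite /n1 /n2 invr1 !scale1r -!mul_polyC; ring.
- move=> t r h; have [->|->] : t = 0 \/ t = 1.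
    apply: (@root01 t 4); first by rewrite pnatr_eq0.
    rewrite -h; ring.
  + rewrite (_ : _ + _ = 1%:R - r.+1%:R * 4%:R); last by ring.
    exact: not_dvd_neq0.
  + rewrite (_ : _ + _ = - (2%:R - r.+1%:R * 4%:R)); last by ring.
    by rewrite oppr_eq0 not_dvd_neq0.
- move=> n; rewrite -subr_eq0 opprK.
  by rewrite -natrM -natrD pnatr_eq0 addn_eq0 andbF.
Qed.

Lemma model3 : quasihomogeneous (fun x y => x * y ^+ 2 * (x - y) ^+ 3)
    (fun x y => (x * (2 * x - 5 * y), y * (y - 4 * x))).
Proof.
pose n1 : {poly K} := (- 5) *: 'X + 2%:P.
pose n2 : {poly K} := 'X^2 - 4 *: 'X.
pose dv : {poly K} := - 3 *: 'X.
pose gn : {poly K} := 'X ^+ 2 * (1%:P - 'X) ^+ 3.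
have n1E t : n1.[t] = 2 - 5 * t by rewrite /n1 !(hornerD, hornerN, hornerZ, hornerX, hornerXn, hornerC, hornerM, horner_exp, horner0); ring.
have n2E t : n2.[t] = t ^+ 2 - 4 * t by rewrite /n2 !(hornerD, hornerN, hornerZ, hornerX, hornerXn, hornerC, hornerM, horner_exp, horner0); ring.
have dvE t : dv.[t] = - 3 * t by rewrite /dv ?(hornerD, hornerN, hornerZ, hornerX, hornerXn, hornerC, hornerM, horner_exp, horner0); ring.
have gnE t : gn.[t] = t ^+ 2 * (1 - t) ^+ 3 by rewrite /gn !(hornerD, hornerN, hornerZ, hornerX, hornerXn, hornerC, hornerM, horner_exp, horner0); ring.
apply: (@Quasihomogeneous _ _ 1 1 6
  (fun z => 4 * z.1 - 5 * z.2) (fun z => - 5 * z.1)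
  (fun z => - 4 * z.2) (fun z => 2 * z.2 - 4 * z.1)
  (fun z => z.2 ^+ 2 * (z.1 - z.2) ^+ 3 + 3 * z.1 * z.2 ^+ 2 * (z.1 - z.2) ^+ 2) (fun z => 2 * z.1 * z.2 * (z.1 - z.2) ^+ 3 - 3 * z.1 * z.2 ^+ 2 * (z.1 - z.2) ^+ 2)
  n1 n2 dv gn (2) (- 5) (0) (- 6) (6)).
- by [].
- by [].
- apply/eqP => E; have := gnE 2; rewrite E horner0 => /esym/eqP.
  by rewrite (_ : 2 ^+ 2 * (1 - 2) ^+ 3 = - 4%:R :> K) ?oppr_eq0 ?pnatr_eq0//; ring.
- move=> z; have h := (pdM (pd_fst z) (pdB (pdM (pd_cst 2 z) (pd_fst z)) (pdM (pd_cst 5 z) (pd_snd z)))).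
  apply: (pd_eq h); case: z {h} => x y /=; ring.
- move=> z; have h := (pdM (pd_snd z) (pdB (pd_snd z) (pdM (pd_cst 4 z) (pd_fst z)))).
  apply: (pd_eq h); case: z {h} => x y /=; ring.
- move=> z; have h := (pdM (pdM (pd_fst z) (pdX 2 (pd_snd z))) (pdX 3 (pdB (pd_fst z) (pd_snd z)))).
  apply: (pd_eq h); case: z {h} => x y /=; ring.
- move=> [x y] /=; ring.
- move=> [x y] /=; ring.
- move=> [x y] /=; ring.
- move=> [x y] /=; ring.
- move=> s t /=; rewrite n1E; ring.
- move=> s t /=; rewrite n2E; ring.
- move=> s t /=; rewrite dvE; ring.
- move=> s t /=; rewrite gnE; ring.
- by rewrite invr1 scale1r ?polyCN.
- rewrite /n1 /n2 invr1 !scale1r -!mul_polyC; ring.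
- move=> t r h; have [->|->] : t = 0 \/ t = 1.
    apply: (@root01 t 6); first by rewrite pnatr_eq0.
    rewrite -h; ring.
  + rewrite (_ : _ + _ = 2%:R - r.+1%:R * 6%:R); last by ring.
    exact: not_dvd_neq0.
  + rewrite (_ : _ + _ = - (3%:R - r.+1%:R * 6%:R)); last by ring.
    by rewrite oppr_eq0 not_dvd_neq0.
- move=> n; rewrite -subr_eq0 opprK.
  by rewrite -natrM -natrD pnatr_eq0 addn_eq0 andbF.
Qed.

Lemma model4 : quasihomogeneous (fun x y => x ^+ 3 + y ^+ 2)
    (fun x y => (2 * y, - (3 * x ^+ 2))).
Proof.
pose n1 : {poly K} := 2 *: 'X.
pose n2 : {poly K} := (- 3)%:P.
pose dv : {poly K} := 0.
pose gn : {poly K} := 1%:P + 'X ^+ 2.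
have n1E t : n1.[t] = 2 * t by rewrite /n1 !(hornerD, hornerN, hornerZ, hornerX, hornerXn, hornerC, hornerM, horner_exp, horner0); ring.
have n2E t : n2.[t] = - 3 by rewrite /n2 !(hornerD, hornerN, hornerZ, hornerX, hornerXn, hornerC, hornerM, horner_exp, horner0); ring.
have dvE t : dv.[t] = 0 by rewrite /dv ?(hornerD, hornerN, hornerZ, hornerX, hornerXn, hornerC, hornerM, horner_exp, horner0); ring.
have gnE t : gn.[t] = 1 + t ^+ 2 by rewrite /gn !(hornerD, hornerN, hornerZ, hornerX, hornerXn, hornerC, hornerM, horner_exp, horner0); ring.
apply: (@Quasihomogeneous _ _ 2 3 6
  (fun z => 0) (fun z => 2)
  (fun z => - 6 * z.1) (fun z => 0)
  (fun z => 3 * z.1 ^+ 2) (fun z => 2 * z.2)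
  n1 n2 dv gn (0) (1) (- 3) (0) (- 3)).
- by [].
- by [].
- apply/eqP => E; have := gnE 2; rewrite E horner0 => /esym/eqP.
  by rewrite (_ : 1 + 2 ^+ 2 = 5%:R :> K) ?oppr_eq0 ?pnatr_eq0//; ring.
- move=> z; have h := (pdM (pd_cst 2 z) (pd_snd z)).
  apply: (pd_eq h); case: z {h} => x y /=; ring.
- move=> z; have h := (pdN (pdM (pd_cst 3 z) (pdX 2 (pd_fst z)))).
  apply: (pd_eq h); case: z {h} => x y /=; ring.
- move=> z; have h := (pdD (pdX 3 (pd_fst z)) (pdX 2 (pd_snd z))).
  apply: (pd_eq h); case: z {h} => x y /=; ring.
- move=> [x y] /=; ring.
- move=> [x y] /=; ring.
- move=> [x y] /=; ring.
- move=> [x y] /=; ring.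
- move=> s t /=; rewrite n1E; ring.
- move=> s t /=; rewrite n2E; ring.
- move=> s t /=; rewrite dvE; ring.
- move=> s t /=; rewrite gnE; ring.
- by rewrite scalerA mulVf ?pnatr_eq0// addr0.
- rewrite /n1 /n2 scalerA mulVf ?pnatr_eq0// scale1r -!mul_polyC; ring.
- move=> t r h.
  have t0 : t != 0.
    apply: contra_eq_neq h => ->.
    by rewrite expr0n !mulr0 !add0r oppr_eq0 pnatr_eq0.
  rewrite (_ : _ + _ = t * (1%:R - r.+1%:R * 6%:R)); last by ring.
  by rewrite mulf_neq0// not_dvd_neq0.
- move=> n; rewrite -subr_eq0 mulrN -opprD oppr_eq0.
  by rewrite -natrM natr1 pnatr_eq0.
Qed.

Lemma model5 : quasihomogeneous (fun x y => y * (y - x ^+ 2))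
    (fun x y => (2 * y - x ^+ 2, 2 * x * y)).
Proof.
pose n1 : {poly K} := 2 *: 'X - 1%:P.
pose n2 : {poly K} := 2 *: 'X.
pose dv : {poly K} := 0.
pose gn : {poly K} := 'X * ('X - 1%:P).
have n1E t : n1.[t] = 2 * t - 1 by rewrite /n1 !(hornerD, hornerN, hornerZ, hornerX, hornerXn, hornerC, hornerM, horner_exp, horner0); ring.
have n2E t : n2.[t] = 2 * t by rewrite /n2 !(hornerD, hornerN, hornerZ, hornerX, hornerXn, hornerC, hornerM, horner_exp, horner0); ring.
have dvE t : dv.[t] = 0 by rewrite /dv ?(hornerD, hornerN, hornerZ, hornerX, hornerXn, hornerC, hornerM, horner_exp, horner0); ring.
have gnE t : gn.[t] = t * (t - 1) by rewrite /gn !(hornerD, hornerN, hornerZ, hornerX, hornerXn, hornerC, hornerM, horner_exp, horner0); ring.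
apply: (@Quasihomogeneous _ _ 1 2 4
  (fun z => - 2 * z.1) (fun z => 2)
  (fun z => 2 * z.2) (fun z => 2 * z.1)
  (fun z => - 2 * z.1 * z.2) (fun z => 2 * z.2 - z.1 ^+ 2)
  n1 n2 dv gn (- 1) (2) (0) (4) (- 4)).
- by [].
- by [].
- apply/eqP => E; have := gnE 2; rewrite E horner0 => /esym/eqP.
  by rewrite (_ : 2 * (2 - 1) = 2%:R :> K) ?oppr_eq0 ?pnatr_eq0//; ring.
- move=> z; have h := (pdB (pdM (pd_cst 2 z) (pd_snd z)) (pdX 2 (pd_fst z))).
  apply: (pd_eq h); case: z {h} => x y /=; ring.
- move=> z; have h := (pdM (pdM (pd_cst 2 z) (pd_fst z)) (pd_snd z)).
  apply: (pd_eq h); case: z {h} => x y /=; ring.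
- move=> z; have h := (pdM (pd_snd z) (pdB (pd_snd z) (pdX 2 (pd_fst z)))).
  apply: (pd_eq h); case: z {h} => x y /=; ring.
- move=> [x y] /=; ring.
- move=> [x y] /=; ring.
- move=> [x y] /=; ring.
- move=> [x y] /=; ring.
- move=> s t /=; rewrite n1E; ring.
- move=> s t /=; rewrite n2E; ring.
- move=> s t /=; rewrite dvE; ring.
- move=> s t /=; rewrite gnE; ring.
- by rewrite invr1 scale1r ?polyCN.
- rewrite /n1 /n2 invr1 !scale1r -!mul_polyC; ring.
- move=> t r h; have [->|->] : t = 0 \/ t = 1.
    apply: (@root01 t 4); first by rewrite pnatr_eq0.
    apply/eqP; rewrite -oppr_eq0; apply/eqP; rewrite -h; ring.
  + rewrite (_ : _ + _ = - (1%:R - r.+1%:R * 4%:R)); last by ring.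
    by rewrite oppr_eq0 not_dvd_neq0.
  + rewrite (_ : _ + _ = 1%:R - r.+1%:R * 4%:R); last by ring.
    exact: not_dvd_neq0.
- move=> n; rewrite -subr_eq0 mulrN -opprD oppr_eq0.
  by rewrite -natrM -natrD pnatr_eq0 addn_eq0 andbF.
Qed.

Lemma model6 : quasihomogeneous (fun x y => y * (y - x ^+ 2) ^+ 2)
    (fun x y => (3 * y - x ^+ 2, 4 * x * y)).
Proof.
pose n1 : {poly K} := 3 *: 'X - 1%:P.
pose n2 : {poly K} := 4 *: 'X.
pose dv : {poly K} := 2%:P.
pose gn : {poly K} := 'X * ('X - 1%:P) ^+ 2.
have n1E t : n1.[t] = 3 * t - 1 by rewrite /n1 !(hornerD, hornerN, hornerZ, hornerX, hornerXn, hornerC, hornerM, horner_exp, horner0); ring.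
have n2E t : n2.[t] = 4 * t by rewrite /n2 !(hornerD, hornerN, hornerZ, hornerX, hornerXn, hornerC, hornerM, horner_exp, horner0); ring.
have dvE t : dv.[t] = 2 by rewrite /dv ?(hornerD, hornerN, hornerZ, hornerX, hornerXn, hornerC, hornerM, horner_exp, horner0); ring.
have gnE t : gn.[t] = t * (t - 1) ^+ 2 by rewrite /gn !(hornerD, hornerN, hornerZ, hornerX, hornerXn, hornerC, hornerM, horner_exp, horner0); ring.
apply: (@Quasihomogeneous _ _ 1 2 6
  (fun z => - 2 * z.1) (fun z => 3)
  (fun z => 4 * z.2) (fun z => 4 * z.1)
  (fun z => - 4 * z.1 * z.2 * (z.2 - z.1 ^+ 2)) (fun z => (z.2 - z.1 ^+ 2) ^+ 2 + 2 * z.2 * (z.2 - z.1 ^+ 2))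
  n1 n2 dv gn (- 1) (3) (0) (6) (- 6)).
- by [].
- by [].
- apply/eqP => E; have := gnE 2; rewrite E horner0 => /esym/eqP.
  by rewrite (_ : 2 * (2 - 1) ^+ 2 = 2%:R :> K) ?oppr_eq0 ?pnatr_eq0//; ring.
- move=> z; have h := (pdB (pdM (pd_cst 3 z) (pd_snd z)) (pdX 2 (pd_fst z))).
  apply: (pd_eq h); case: z {h} => x y /=; ring.
- move=> z; have h := (pdM (pdM (pd_cst 4 z) (pd_fst z)) (pd_snd z)).
  apply: (pd_eq h); case: z {h} => x y /=; ring.
- move=> z; have h := (pdM (pd_snd z) (pdX 2 (pdB (pd_snd z) (pdX 2 (pd_fst z))))).
  apply: (pd_eq h); case: z {h} => x y /=; ring.
- move=> [x y] /=; ring.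
- move=> [x y] /=; ring.
- move=> [x y] /=; ring.
- move=> [x y] /=; ring.
- move=> s t /=; rewrite n1E; ring.
- move=> s t /=; rewrite n2E; ring.
- move=> s t /=; rewrite dvE; ring.
- move=> s t /=; rewrite gnE; ring.
- by rewrite invr1 scale1r ?polyCN.
- rewrite /n1 /n2 invr1 !scale1r -!mul_polyC; ring.
- move=> t r h; have [->|->] : t = 0 \/ t = 1.
    apply: (@root01 t 6); first by rewrite pnatr_eq0.
    apply/eqP; rewrite -oppr_eq0; apply/eqP; rewrite -h; ring.
  + rewrite (_ : _ + _ = - (1%:R - r.+1%:R * 6%:R)); last by ring.
    by rewrite oppr_eq0 not_dvd_neq0.
  + rewrite (_ : _ + _ = 2%:R - r.+1%:R * 6%:R); last by ring.
    exact: not_dvd_neq0.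
- move=> n; rewrite -subr_eq0 mulrN -opprD oppr_eq0.
  by rewrite -natrM -natrD pnatr_eq0 addn_eq0 andbF.
Qed.

End Models.

(** * Transport of a commuting pair by a change of coordinates *)
Section PushForwardAlgebra.
Variable K : fieldType.

(** The second order terms d11, d12, d22 enter symmetrically in x and y; the
    remaining terms are those of the bracket. *)
Lemma alg_second (d1 d2 d11 d12 d22 x1 x2 y1 y2 x11 x12 x21 x22 y11 y12 y21 y22 : K) :
  y11 * x1 + y12 * x2 = x11 * y1 + x12 * y2 ->
  y21 * x1 + y22 * x2 = x21 * y1 + x22 * y2 ->
  x1 * (d11 * y1 + d1 * y11 + (d12 * y2 + d2 * y21)) +
  x2 * (d12 * y1 + d1 * y12 + (d22 * y2 + d2 * y22)) =
  y1 * (d11 * x1 + d1 * x11 + (d12 * x2 + d2 * x21)) +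
  y2 * (d12 * x1 + d1 * x12 + (d22 * x2 + d2 * x22)).
Proof.
move=> E1 E2.
transitivity (d1 * (y11 * x1 + y12 * x2) + d2 * (y21 * x1 + y22 * x2)
  + (d11 * x1 * y1 + d12 * (x1 * y2 + x2 * y1) + d22 * x2 * y2)); first by ring.
by rewrite E1 E2; ring.
Qed.

(** Here q is the inverse Jacobian matrix of p, so that m n = p x gives
    q (m n) = x. *)
Lemma alg_push (w1 w2 q11 q12 q21 q22 p11 p12 p21 p22 x1 x2 y1 y2 m n1 n2 e1 e2 : K) :
  m * n1 = p11 * x1 + p12 * x2 -> m * n2 = p21 * x1 + p22 * x2 ->
  q11 * p11 + q12 * p21 = 1 -> q11 * p12 + q12 * p22 = 0 ->
  q21 * p11 + q22 * p21 = 0 -> q21 * p12 + q22 * p22 = 1 ->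
  x1 * w1 + x2 * w2 = y1 * (e1 * p11 + e2 * p21) + y2 * (e1 * p12 + e2 * p22) ->
  m * (n1 * (w1 * q11 + w2 * q21) + n2 * (w1 * q12 + w2 * q22)) =
  (p11 * y1 + p12 * y2) * e1 + (p21 * y1 + p22 * y2) * e2.
Proof.
move=> M1 M2 I11 I12 I21 I22 XW.
transitivity (w1 * (q11 * (m * n1) + q12 * (m * n2)) + w2 * (q21 * (m * n1) + q22 * (m * n2))).
  by ring.
rewrite M1 M2.
transitivity (w1 * ((q11 * p11 + q12 * p21) * x1 + (q11 * p12 + q12 * p22) * x2)
  + w2 * ((q21 * p11 + q22 * p21) * x1 + (q21 * p12 + q22 * p22) * x2)); first by ring.
rewrite I11 I12 I21 I22.
transitivity (x1 * w1 + x2 * w2); first by ring.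
by rewrite XW; ring.
Qed.

Lemma alg_product (w1 w2 m1 m2 m n u v : K) :
  w1 * (m1 * n + m * u) + w2 * (m2 * n + m * v) =
  (w1 * m1 + w2 * m2) * n + m * (w1 * u + w2 * v).
Proof. by ring. Qed.

(** The determinant of (p y, p x) is det p times that of (y, x), and det p is
    invertible. *)
Lemma alg_dependent (q11 q12 q21 q22 p11 p12 p21 p22 x1 x2 y1 y2 m n1 n2 : K) :
  m * n1 = p11 * x1 + p12 * x2 -> m * n2 = p21 * x1 + p22 * x2 ->
  q11 * p11 + q12 * p21 = 1 -> q11 * p12 + q12 * p22 = 0 ->
  q21 * p11 + q22 * p21 = 0 -> q21 * p12 + q22 * p22 = 1 ->
  (p11 * y1 + p12 * y2) * n2 - (p21 * y1 + p22 * y2) * n1 = 0 ->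
  x1 * y2 = x2 * y1.
Proof.
move=> M1 M2 I11 I12 I21 I22 D; apply/eqP; rewrite -subr_eq0; apply/eqP.
transitivity ((q11 * q22 - q12 * q21) * (p11 * p22 - p12 * p21) * (x1 * y2 - x2 * y1)).
  have -> : (q11 * q22 - q12 * q21) * (p11 * p22 - p12 * p21) =
    (q11 * p11 + q12 * p21) * (q21 * p12 + q22 * p22)
    - (q11 * p12 + q12 * p22) * (q21 * p11 + q22 * p21) by ring.
  by rewrite I11 I12 I21 I22; ring.
transitivity ((q11 * q22 - q12 * q21) *
   ((p21 * y1 + p22 * y2) * (p11 * x1 + p12 * x2) - (p11 * y1 + p12 * y2) * (p21 * x1 + p22 * x2))).
  by ring.
rewrite -M1 -M2.
transitivity (- (q11 * q22 - q12 * q21) * m *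
  ((p11 * y1 + p12 * y2) * n2 - (p21 * y1 + p22 * y2) * n1)); first by ring.
by rewrite D mulr0.
Qed.

End PushForwardAlgebra.

Section Dependence.
Variable R : realType.

Lemma not_free2 (x y : C2 R) : x.1 * y.2 = x.2 * y.1 -> ~~ free [:: x; y].
Proof.
case: x => x1 x2; case: y => y1 y2 /= h; apply/negP => /(@freeP _ _ 2 [tuple (x1, x2); (y1, y2)]) F.
have rel (a b : R[i]) : a * x1 + b * y1 = 0 -> a * x2 + b * y2 = 0 -> a = 0 /\ b = 0.
  move=> h1 h2.
  have := F (fun i : 'I_2 => if i == 0 then a else b).
  rewrite !big_ord_recl big_ord0 /= => H.
  have {}H := H _.
  split; [have := H _ 0|have := H _ 1] => /=; apply.
    by rewrite addr0; congr pair.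
  by rewrite addr0; congr pair.
have [y10 x10] : y1 = 0 /\ - x1 = 0.
  by apply: rel; [rewrite mulNr mulrC subrr|rewrite mulNr h mulrC subrr].
have [y20 x20] : y2 = 0 /\ - x2 = 0.
  by apply: rel; [rewrite mulNr mulrC h subrr|rewrite mulNr mulrC subrr].
have [one0 _] : (1 : R[i]) = 0 /\ (0 : R[i]) = 0.
  apply: rel; rewrite mul0r addr0 mul1r; apply/eqP; rewrite -oppr_eq0; exact/eqP.
by move/eqP: one0; rewrite oner_eq0.
Qed.

End Dependence.

Section PushForward.
Variable R : realType.
Notation K := R[i].

Lemma nearI (P Q : C2 R -> Prop) : (\forall z \near (0 : C2 R), P z) ->
  (\forall z \near (0 : C2 R), Q z) -> \forall z \near (0 : C2 R), P z /\ Q z.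
Proof. exact: filterI. Qed.

Lemma near_comp0 (F : C2 R -> C2 R) (P : C2 R -> Prop) : differentiable F (0 : C2 R) -> F 0 = 0 ->
  (\forall z \near (0 : C2 R), P z) -> \forall z \near (0 : C2 R), P (F z).
Proof.
move=> /differentiable_continuous Fc F0 hP.
by apply: Fc; rewrite F0.
Qed.

Lemma inverse_partials (P1 P2 Q1 Q2 : C2 R -> C1 R) (z : C2 R) :
  differentiable P1 z -> differentiable P2 z ->
  differentiable Q1 (P1 z, P2 z) -> differentiable Q2 (P1 z, P2 z) ->
  (\forall w \near z, (Q1 (P1 w, P2 w), Q2 (P1 w, P2 w)) = w) ->
  let q := (P1 z, P2 z) in
  [/\ D1 Q1 q * D1 P1 z + D2 Q1 q * D1 P2 z = 1,
      D1 Q1 q * D2 P1 z + D2 Q1 q * D2 P2 z = 0,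
      D1 Q2 q * D1 P1 z + D2 Q2 q * D1 P2 z = 0 &
      D1 Q2 q * D2 P1 z + D2 Q2 q * D2 P2 z = 1].
Proof.
move=> dP1 dP2 dQ1 dQ2 h q.
have c1 := pd_comp (pd_diff dQ1) (pd_diff dP1) (pd_diff dP2).
have c2 := pd_comp (pd_diff dQ2) (pd_diff dP1) (pd_diff dP2).
have h1 : \forall w \near z, Q1 (P1 w, P2 w) = w.1 by apply: filterS h => w /(congr1 fst).
have h2 : \forall w \near z, Q2 (P1 w, P2 w) = w.2 by apply: filterS h => w /(congr1 snd).
have e1 := pd_near h1 c1; have e2 := pd_near h2 c2.
have [E11 E12] := pd_uniq e1 (@pd_fst R z).
have [E21 E22] := pd_uniq e2 (@pd_snd R z).
by split.
Qed.


Section Transport.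
Variables (X1 X2 Y1 Y2 P1 P2 Q1 Q2 f N1 N2 g : C2 R -> C1 R) (a : nat).
Variables (N11 N12 N21 N22 g1 g2 : C2 R -> C1 R).
Let P (z : C2 R) : C2 R := (P1 z, P2 z).
Let Q (z : C2 R) : C2 R := (Q1 z, Q2 z).
Hypothesis pN1 : forall z, pd N1 z (N11 z) (N12 z).
Hypothesis pN2 : forall z, pd N2 z (N21 z) (N22 z).
Hypothesis pg : forall z, pd g z (g1 z) (g2 z).
Hypothesis hX1 : \forall z \near (0 : C2 R), differentiable X1 z.
Hypothesis hX2 : \forall z \near (0 : C2 R), differentiable X2 z.
Hypothesis hY1 : \forall z \near (0 : C2 R), differentiable Y1 z.
Hypothesis hY2 : \forall z \near (0 : C2 R), differentiable Y2 z.
Hypothesis hP1 : \forall z \near (0 : C2 R), differentiable P1 z.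
Hypothesis hP2 : \forall z \near (0 : C2 R), differentiable P2 z.
Hypothesis hQ1 : \forall z \near (0 : C2 R), differentiable Q1 z.
Hypothesis hQ2 : \forall z \near (0 : C2 R), differentiable Q2 z.
Hypothesis hf : \forall z \near (0 : C2 R), differentiable f z.
Hypothesis P0 : P 0 = 0.
Hypothesis Q0 : Q 0 = 0.
Hypothesis QP : \forall z \near (0 : C2 R), Q (P z) = z.
Hypothesis PQ : \forall z \near (0 : C2 R), P (Q z) = z.
Hypothesis bracket1 : \forall z \near (0 : C2 R),
  D1 Y1 z * X1 z + D2 Y1 z * X2 z = D1 X1 z * Y1 z + D2 X1 z * Y2 z.
Hypothesis bracket2 : \forall z \near (0 : C2 R),
  D1 Y2 z * X1 z + D2 Y2 z * X2 z = D1 X2 z * Y1 z + D2 X2 z * Y2 z.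
Hypothesis push1 : \forall z \near (0 : C2 R),
  D1 P1 z * X1 z + D2 P1 z * X2 z = mult a g f (P z) * N1 (P z).
Hypothesis push2 : \forall z \near (0 : C2 R),
  D1 P2 z * X1 z + D2 P2 z * X2 z = mult a g f (P z) * N2 (P z).


Definition along (F V1 V2 : C2 R -> C1 R) : C2 R -> C1 R :=
  fun z => D1 F z * V1 z + D2 F z * V2 z.

Lemma along_pd (F V1 V2 : C2 R -> C1 R) z : (\forall w \near z, differentiable F w) ->
  differentiable V1 z -> differentiable V2 z ->
  pd (along F V1 V2) z
   (D1 (D1 F) z * V1 z + D1 F z * D1 V1 z + (D1 (D2 F) z * V2 z + D2 F z * D1 V2 z))
   (D1 (D2 F) z * V1 z + D1 F z * D2 V1 z + (D2 (D2 F) z * V2 z + D2 F z * D2 V2 z)).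
Proof.
move=> hF dV1 dV2; have [d1 d2 E] := holo_partial hF; rewrite -{2}E.
exact: (pdD (pdM (pd_diff d1) (pd_diff dV1)) (pdM (pd_diff d2) (pd_diff dV2))).
Qed.

Let W1 : C2 R -> C1 R := fun q => along P1 Y1 Y2 (Q q).
Let W2 : C2 R -> C1 R := fun q => along P2 Y1 Y2 (Q q).

Lemma P_diff0 : differentiable P (0 : C2 R).
Proof. by apply: differentiable_pair; [exact: nbhs_singleton hP1|exact: nbhs_singleton hP2]. Qed.

Lemma Q_diff0 : differentiable Q (0 : C2 R).
Proof. by apply: differentiable_pair; [exact: nbhs_singleton hQ1|exact: nbhs_singleton hQ2]. Qed.

(** Both sides are derivatives of the components of dPi(X) and dPi(Y); they
    differ by dPi([X, Y]) because second derivatives are symmetric. *)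
Lemma commute_along (Pi : C2 R -> C1 R) z :
  (\forall w \near z, differentiable Pi w) ->
  differentiable X1 z -> differentiable X2 z -> differentiable Y1 z -> differentiable Y2 z ->
  D1 Y1 z * X1 z + D2 Y1 z * X2 z = D1 X1 z * Y1 z + D2 X1 z * Y2 z ->
  D1 Y2 z * X1 z + D2 Y2 z * X2 z = D1 X2 z * Y1 z + D2 X2 z * Y2 z ->
  X1 z * D1 (along Pi Y1 Y2) z + X2 z * D2 (along Pi Y1 Y2) z =
  Y1 z * D1 (along Pi X1 X2) z + Y2 z * D2 (along Pi X1 X2) z.
Proof.
move=> hPi dX1 dX2 dY1 dY2 b1 b2.
have [_ -> ->] := along_pd hPi dX1 dX2; have [_ -> ->] := along_pd hPi dY1 dY2.
exact: (alg_second (D1 Pi z) (D2 Pi z) (D1 (D1 Pi) z) (D1 (D2 Pi) z) (D2 (D2 Pi) z) b1 b2).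
Qed.

(** At z = Q q the derivative of dPi(Y) along X equals that of
    dPi(X) = ([mult] Ni) o P along Y, by [commute_along]; both are read in the
    coordinates q by the chain rule. *)
Lemma push_comm (Pi Ni Ni1 Ni2 : C2 R -> C1 R) :
  (forall z, pd Ni z (Ni1 z) (Ni2 z)) ->
  (\forall z \near (0 : C2 R), differentiable Pi z) ->
  (\forall z \near (0 : C2 R), along Pi X1 X2 z = mult a g f (P z) * Ni (P z)) ->
  (\forall z \near (0 : C2 R), differentiable (fun q => along Pi Y1 Y2 (Q q)) z) /\
  \forall z \near (0 : C2 R),
    commutes_with a N1 N2 g f W1 W2 (fun q => along Pi Y1 Y2 (Q q)) Ni Ni1 Ni2 z.
Proof.
move=> pNi hPi hZ.
have diffW : \forall z \near (0 : C2 R), pd (fun q => along Pi Y1 Y2 (Q q)) z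
    (D1 (along Pi Y1 Y2) (Q z) * D1 Q1 z + D2 (along Pi Y1 Y2) (Q z) * D1 Q2 z)
    (D1 (along Pi Y1 Y2) (Q z) * D2 Q1 z + D2 (along Pi Y1 Y2) (Q z) * D2 Q2 z).
  have h1 := near_comp0 Q_diff0 Q0 (nearI (near_near hPi) (nearI hY1 hY2)).
  have H := nearI h1 (nearI hQ1 hQ2).
  apply: filterS H => z [[k1 [k2 k3]] [k4 k5]].
  have [dW _ _] := along_pd k1 k2 k3.
  exact: pd_comp (pd_diff dW) (pd_diff k4) (pd_diff k5).
split; first by apply: filterS diffW => z [].
have h1 := near_comp0 Q_diff0 Q0 (nearI (nearI (nearI hX1 hX2) (nearI hY1 hY2))
  (nearI (nearI bracket1 bracket2) (nearI (near_near hPi) (near_near hZ)))).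
have h2 := near_comp0 Q_diff0 Q0 (nearI (nearI push1 push2) (nearI (nearI hP1 hP2) (near_near QP))).
have H := nearI (nearI h1 h2) (nearI (nearI diffW PQ) (nearI (nearI hQ1 hQ2) hf)).
apply: filterS H => q [[[[[dX1 dX2] [dY1 dY2]] [[b1 b2] [nPi nZ]]]
  [[p1 p2] [[dP1 dP2] nQP]]] [[dW PQq] [[dQ1 dQ2] df]]].
have XW := commute_along nPi dX1 dX2 dY1 dY2 b1 b2.
have PQq' : (P1 (Q q), P2 (Q q)) = q := PQq.
have [dm e1 e2] : pd (mult a g f) q (D1 (mult a g f) q) (D2 (mult a g f) q).
  by apply: pd_diff; have [] := pdM (pdX a (pg q)) (pd_diff df).
have pmN := pdM (pd_diff dm) (pNi q).
have pmN' : pd (fun z => mult a g f z * Ni z) (P1 (Q q), P2 (Q q))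
   (D1 (mult a g f) q * Ni q + mult a g f q * Ni1 q) (D2 (mult a g f) q * Ni q + mult a g f q * Ni2 q).
  by rewrite PQq'; exact: pmN.
have cZ := pd_comp pmN' (pd_diff dP1) (pd_diff dP2).
have nZ' : \forall w \near Q q,
    mult a g f (P1 w, P2 w) * Ni (P1 w, P2 w) = along Pi X1 X2 w.
  by apply: filterS nZ => w /esym.
have [_ Z1 Z2] := pd_near nZ' cZ.
rewrite Z1 Z2 in XW.
have dQ1' : differentiable Q1 (P1 (Q q), P2 (Q q)) by rewrite PQq'; exact: dQ1.
have dQ2' : differentiable Q2 (P1 (Q q), P2 (Q q)) by rewrite PQq'; exact: dQ2.
have := inverse_partials dP1 dP2 dQ1' dQ2' nQP; rewrite /= PQq' => -[I11 I12 I21 I22].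
rewrite /commutes_with; have [_ -> ->] := dW.
rewrite PQq in p1 p2.
rewrite (alg_push (esym p1) (esym p2) I11 I12 I21 I22 XW).
exact: alg_product.
Qed.

Lemma push_dependent : (\forall z \near (0 : C2 R), detWN N1 N2 W1 W2 z = 0) ->
  \forall z \near (0 : C2 R), X1 z * Y2 z = X2 z * Y1 z.
Proof.
move=> hD.
have h1 := near_comp0 P_diff0 P0 (nearI hD (nearI hQ1 hQ2)).
have H := nearI (nearI h1 (nearI push1 push2)) (nearI (nearI hP1 hP2) (nearI QP (near_near QP))).
apply: filterS H => z [[[D [dQ1 dQ2]] [p1 p2]] [[dP1 dP2] [QPz nQP]]].
have [I11 I12 I21 I22] := inverse_partials dP1 dP2 dQ1 dQ2 nQP.
move: D; rewrite /detWN /W1 /W2 QPz => D.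
exact: alg_dependent (esym p1) (esym p2) I11 I12 I21 I22 D.
Qed.

End Transport.

Lemma elliptic_quasihomogeneous (g : C1 R -> C1 R -> C1 R) (N : C1 R -> C1 R -> C2 R) :
  elliptic_form g N -> inhabited (quasihomogeneous g N).
Proof.
case; constructor.
- exact: model1.
- exact: model2.
- exact: model3.
- exact: model4.
- exact: model5.
- exact: model6.
Qed.


Lemma model_poles (m0 m1 m2 l0 l1 : K) (mu lam : {poly K}) :
  mu = m2 *: 'X^2 + m1 *: 'X + m0%:P -> lam = l1 *: 'X + l0%:P ->
  (forall (t : K) r, m2 * t ^+ 2 + m1 * t + m0 = 0 ->
    l1 * t + l0 + r.+1%:R * (2 * m2 * t + m1) != 0) ->
  forall (t : K) r, root mu t -> lam.[t] + r.+1%:R * mu^`().[t] != 0.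
Proof.
move=> -> -> h t r /rootP.
rewrite !(derivD, derivZ, derivXn, derivX, derivC).
rewrite !(hornerD, hornerZ, hornerXn, hornerX, hornerC, hornerMn) expr1 addr0 mulr1.
move=> /(h t r); rewrite (_ : m2 * (t *+ 2) = 2 * m2 * t)//.
by rewrite -mulr_natl; ring.
Qed.

Lemma holomorphic_components (F : C2 R -> C2 R) : holomorphic_germ F ->
  [/\ \forall z \near (0 : C2 R), differentiable (fun z => (F z).1 : C1 R) z,
      \forall z \near (0 : C2 R), differentiable (fun z => (F z).2 : C1 R) z &
      \forall z \near (0 : C2 R), forall v : C2 R, 'd F z v =
        (D1 (fun z => (F z).1 : C1 R) z * v.1 + D2 (fun z => (F z).1 : C1 R) z * v.2,
         D1 (fun z => (F z).2 : C1 R) z * v.1 + D2 (fun z => (F z).2 : C1 R) z * v.2)].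
Proof.
move=> hF; split; apply: filterS hF => z /diff_components[d1 d2 dE] //.
move=> v; apply: (etrans (dE v)); case: v => v1 v2.
by congr pair; exact: diffE12.
Qed.

End PushForward.

Theorem proposition3p1 (R : realType) (X : C2 R -> C2 R) (hX : elliptic X) :
  ~ exists Y : C2 R -> C2 R, holomorphic_germ Y /\ rank2_commuting X Y.
Proof.
move=> [Y [hY [brk rk]]]; apply: rk.
case: hX => hXh _ [Phi [a [f [g [N [[Psi [hPhi hPsi Phi0 Psi0 [QP PQ]]] hf f0 form eqn]]]]]].
have [qh] := elliptic_quasihomogeneous form.
have [hX1 hX2 dX] := holomorphic_components hXh.
have [hY1 hY2 dY] := holomorphic_components hY.
have [hP1 hP2 dP] := holomorphic_components hPhi.
have [hQ1 hQ2 _] := holomorphic_components hPsi.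
pose X1 z : C1 R := (X z).1; pose X2 z : C1 R := (X z).2.
pose Y1 z : C1 R := (Y z).1; pose Y2 z : C1 R := (Y z).2.
pose P1 z : C1 R := (Phi z).1; pose P2 z : C1 R := (Phi z).2.
pose Q1 z : C1 R := (Psi z).1; pose Q2 z : C1 R := (Psi z).2.
pose N1 (z : C2 R) : C1 R := (N z.1 z.2).1; pose N2 (z : C2 R) : C1 R := (N z.1 z.2).2.
pose g' (z : C2 R) : C1 R := g z.1 z.2.
have P0 : (P1 0, P2 0) = 0 by rewrite /P1 /P2 -surjective_pairing.
have Q0 : (Q1 0, Q2 0) = 0 by rewrite /Q1 /Q2 -surjective_pairing.
have QP' : \forall z \near (0 : C2 R), (Q1 (P1 z, P2 z), Q2 (P1 z, P2 z)) = z.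
  apply: filterS QP => z; rewrite /Q1 /Q2 /P1 /P2 -surjective_pairing.
  by rewrite -surjective_pairing.
have PQ' : \forall z \near (0 : C2 R), (P1 (Q1 z, Q2 z), P2 (Q1 z, Q2 z)) = z.
  apply: filterS PQ => z; rewrite /Q1 /Q2 /P1 /P2 -surjective_pairing.
  by rewrite -surjective_pairing.
have brackets : \forall z \near (0 : C2 R),
    D1 Y1 z * X1 z + D2 Y1 z * X2 z = D1 X1 z * Y1 z + D2 X1 z * Y2 z /\
    D1 Y2 z * X1 z + D2 Y2 z * X2 z = D1 X2 z * Y1 z + D2 X2 z * Y2 z.
  apply: filterS (nearI brk (nearI dX dY)) => z [/subr0_eq E0 [dXz dYz]].
  have E := etrans (etrans (esym (dYz (X z))) E0) (dXz (Y z)).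
  by split; [exact: (congr1 fst E)|exact: (congr1 snd E)].
have pushes : \forall z \near (0 : C2 R),
    D1 P1 z * X1 z + D2 P1 z * X2 z = mult a g' f (P1 z, P2 z) * N1 (P1 z, P2 z) /\
    D1 P2 z * X1 z + D2 P2 z * X2 z = mult a g' f (P1 z, P2 z) * N2 (P1 z, P2 z).
  apply: filterS (nearI eqn dP) => z [E0 dPz].
  rewrite /P1 /P2 -surjective_pairing.
  have E := etrans (esym (dPz (X z))) E0.
  by split; [exact: (congr1 fst E)|exact: (congr1 snd E)].
have near_split (A B : C2 R -> Prop) : (\forall z \near (0 : C2 R), A z /\ B z) ->
    (\forall z \near (0 : C2 R), A z) /\ \forall z \near (0 : C2 R), B z.
  by move=> h; split; apply: filterS h => z [].
have [b1 b2] := near_split _ _ brackets; have [p1 p2] := near_split _ _ pushes.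
have pN1 : forall z, pd N1 z (N11 qh z) (N12 qh z) := pdN1 qh.
have pN2 : forall z, pd N2 z (N21 qh z) (N22 qh z) := pdN2 qh.
have pg : forall z, pd g' z (g1 qh z) (g2 qh z) := pdg qh.
have [dW1 c1] := push_comm pg hX1 hX2 hY1 hY2 hP1 hP2 hQ1 hQ2 hf Q0 QP' PQ' b1 b2 p1 p2 pN1 hP1 p1.
have [dW2 c2] := push_comm pg hX1 hX2 hY1 hY2 hP1 hP2 hQ1 hQ2 hf Q0 QP' PQ' b1 b2 p1 p2 pN2 hP2 p2.
have HA := N_detWN pN1 pN2 pg hf dW1 dW2 f0 c1 c2.
have HB := N_detEWf pg (euler_N1 qh) (euler_N2 qh) (euler_g qh) (Ng qh) hf dW1 dW2 f0 c1 c2.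
have dA : \forall z \near (0 : C2 R), differentiable (detWN N1 N2
    (fun q => along P1 Y1 Y2 (Q1 q, Q2 q)) (fun q => along P2 Y1 Y2 (Q1 q, Q2 q))) z.
  by apply: filterS (nearI dW1 dW2) => z [d1 d2]; have [] := detWN_pd pN1 pN2 d1 d2.
have dB : \forall z \near (0 : C2 R), differentiable (detEWf (wx qh) (wy qh) f
    (fun q => along P1 Y1 Y2 (Q1 q, Q2 q)) (fun q => along P2 Y1 Y2 (Q1 q, Q2 q))) z.
  apply: filterS (nearI (nearI dW1 dW2) (nearI hf (unit_near hf f0))) => z [[d1 d2] [df fz]].
  by have [] := detEWf_pd (wx qh) (wy qh) d1 d2 df fz.
have A0 := commuting_part_vanishes (wx_gt0 qh) (wy_gt0 qh) (gn_neq0 qh)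
  (n1E qh) (n2E qh) (divnE qh) (gnE qh) (model_muE qh) (model_lamE qh)
  (model_poles (model_muE qh) (model_lamE qh) (@no_pole _ _ _ qh)) (no_pole_at_inf qh)
  dA dB (psi_diff _ _ _ _ hf f0) (psi0 _ _ _ _ f0) HA HB.
have dep := push_dependent hP1 hP2 hQ1 hQ2 P0 QP' p1 p2 A0.
by apply: filterS dep => z; exact: not_free2.
Qed.
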